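(* Let $T>0$, $0\le\alpha<2$, $\beta\in\mathbb{R}$, $\mu<\mu(\alpha+\beta)$ where $\mu(\delta):=(1-\delta)^2/4$, $a:=\frac{\alpha+\beta-1}{2}-\sqrt{\mu(\alpha+\beta)-\mu}$, and $\nu:=\sqrt{\mu(\alpha+\beta)-\mu}/\kappa_\alpha$ with $\kappa_\alpha:=\frac{2-\alpha}{2}$. Let $f\in L^2(0,T)$ and $u_0\in\mathcal{H}^{-s}$ with $s>\nu$. Then the formula $$\langle u(\tau),z^\tau\rangle_{\mathcal{H}^{-s},\mathcal{H}^s}=\langle u_0,S(\tau)z^\tau\rangle_{\mathcal{H}^{-s},\mathcal{H}^s}+\int_0^\tau f(t)\,\mathcal{O}_a(S(\tau-t)z^\tau)\,dt\quad\text{for all }z^\tau\in\mathcal{H}^s\qquad(\ast)$$ defines for each $\tau\in[0,T]$ a unique element $u(\tau)\in\mathcal{H}^{-s}$ that can be written as $$u(\tau)=S(\tau)u_0+B(\tau)f,\quad\tau\in(0,T],$$ where $B(\tau)$ is the strongly continuous family of bounded operators $B(\tau):L^2(0,T)\to\mathcal{H}^{-s}$ given by $$\langle B(\tau)f,z^\tau\rangle_{\mathcal{H}^{-s},\mathcal{H}^s}=\int_0^\tau f(t)\,\mathcal{O}_a(S(\tau-t)z^\tau)\,dt\quad\text{for all }z^\tau\in\mathcal{H}^s.$$ Furthermore, the unique weak solution $u$ on $[0,T]$ (in the sense of $(\ast)$) of the system $$\begin{cases}u_t-(x^\alpha u_x)_x-\beta x^{\alpha-1}u_x-\dfrac{\mu}{x^{2-\alpha}}u=0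 & \text{in }(0,1)\times(0,T),\\ [u(\cdot,t),x^{-a}](0)=f(t),\quad a\,u(1,t)+u_x(1,t)=0 & \text{on }(0,T),\\ u(x,0)=u_0(x) & \text{in }(0,1)\end{cases}$$ belongs to $C^0([0,T];\mathcal{H}^{-s})$ and satisfies $$\|u\|_{L^\infty([0,T];\mathcal{H}^{-s})}\le C\left(\|u_0\|_{\mathcal{H}^{-s}}+\|f\|_{L^2(0,T)}\right)$$ for a constant $C>0$ independent of $u_0$ and $f$.
   Context: $J_\nu$ is the Bessel function of the first kind and $0<j_{\nu+1,1}<j_{\nu+1,2}<\dots$ are the positive zeros of $J_{\nu+1}$. $L^2_\beta(0,1):=L^2((0,1);x^\beta dx)$ with inner product $\langle f,g\rangle_\beta=\int_0^1f(x)g(x)x^\beta dx$. The Lagrange form is $[u,v](x)=(u\,p\,v'-v\,p\,u')(x)$ with $p(x)=x^{\alpha+\beta}$, and $[u,v](0)$ is its limit as $x\to0^+$. Put $\Phi_0(x)=\sqrt{2(\nu+1)\kappa_\alpha}\,x^{-a}$ and, for $k\ge1$, $\Phi_k(x)=\frac{\sqrt{2\kappa_\alpha}}{|J_\nu(j_{\nu+1,k})|}x^{(1-\alpha-\beta)/2}J_\nu(j_{\nu+1,k}x^{\kappa_\alpha})$; put $\lambda_0=0$ and $\lambda_k=\kappa_\alpha^2j_{\nu+1,k}^2$ for $k\ge1$. The family $\{\Phi_k\}_{k\ge0}$ is an orthonormal basis of $L^2_\beta(0,1)$. For $s\ge0$, $\mathcal{H}^s:=\{u=\sum_{k\ge0}a_k\Phi_k:\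 \|u\|_{\mathcal{H}^s}^2=|a_0|^2+\sum_{k\ge1}|a_k|^2\lambda_k^s<\infty\}$, and $\mathcal{H}^{-s}$ is the dual of $\mathcal{H}^s$ with respect to the pivot space $L^2_\beta(0,1)$ (equivalently, the completion of $L^2_\beta(0,1)$ for the norm $\|u\|_{-s}^2=|\langle u,\Phi_0\rangle_\beta|^2+\sum_{k\ge1}\lambda_k^{-s}|\langle u,\Phi_k\rangle_\beta|^2$). The semigroup $S(t)\sum_ka_k\Phi_k:=\sum_ke^{-\lambda_kt}a_k\Phi_k$ acts on every $\mathcal{H}^s$, $s\in\mathbb{R}$. For $h:(0,1)\to\mathbb{R}$, $\mathcal{O}_a(h):=\lim_{x\to0^+}x^ah(x)$. A weak solution of the system is a function $u\in C^0([0,T];\mathcal{H}^{-s})$ such that $(\ast)$ holds for every $\tau\in(0,T]$ and every $z^\tau\in\mathcal{H}^s$. *)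

(* Defs.v *)
From HB Require Import structures.
From mathcomp Require Import all_boot all_order all_algebra.
From mathcomp Require Import all_classical all_reals all_analysis.
From mathcomp Require Import ess_sup_inf.

Set Implicit Arguments.
Unset Strict Implicit.
Unset Printing Implicit Defensive.

Import Order.TTheory GRing.Theory Num.Theory.
Import numFieldNormedType.Exports.

Local Open Scope classical_set_scope.
Local Open Scope ring_scope.

Notation leb R := (@lebesgue_measure R).

Section SpecialFunctions.
Context {R : realType}.

Definition Gamma (z : R) : R :=
  \int[leb R]_(t in `]0, +oo[) (t `^ (z - 1) * expR (- t)).

Definition besselJ (nu x : R) : R :=
  limn (series (fun m : nat =>
    (-1) ^+ m / (m`!%:R * Gamma (m%:R + nu + 1)) *
    (x / 2) `^ (2 * m%:R + nu))).

(* [j] lists the positive zeros of [g] increasingly, the first one being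
   [j 0]: for [g] the Bessel function of order nu + 1, [j k] is the zero
   written j_{nu+1,k+1}. *)
Definition positive_zeros (g : R -> R) (j : nat -> R) : Prop :=
  {homo j : m n / (m < n)%N >-> m < n} /\
  range j = [set x | 0 < x /\ g x = 0].

End SpecialFunctions.

(* Elements of L^2 spaces over an interval (0, b) are represented by functions
   on R of which only the restriction to (0, b) matters, up to equality almost
   everywhere. *)
Section WeightedL2.
Context {R : realType}.
Variables (w : R -> R) (b : R).

Definition L2 : set (R -> R) :=
  [set f : R -> R | measurable_fun (`]0, b[ : set R) f /\
           (leb R).-integrable `]0, b[ (fun x : R => (f x ^+ 2 * w x)%:E)].

Definition L2dot (f g : R -> R) : R :=
  \int[leb R]_(x in `]0, b[) (f x * g x * w x).

Definition L2norm (f : R -> R) : R := Num.sqrt (L2dot f f).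

(* Convergence in norm; the integral is extended-real valued, so that a
   difference that is not square integrable has infinite distance. *)
Definition L2cvg (f_ : nat -> R -> R) (f : R -> R) : Prop :=
  (\int[leb R]_(x in `]0%R, b[) ((f x - f_ n x) ^+ 2 * w x)%:E)%E @[n --> \oo]
    --> 0%E.

End WeightedL2.

Section DegenerateParabolic.
Context {R : realType}.
Variables alpha beta mu : R.

Definition mucrit (delta : R) : R := (1 - delta) ^+ 2 / 4.
Definition kappa : R := (2 - alpha) / 2.
Definition expa : R :=
  (alpha + beta - 1) / 2 - Num.sqrt (mucrit (alpha + beta) - mu).
Definition nu : R := Num.sqrt (mucrit (alpha + beta) - mu) / kappa.

Definition weight (x : R) : R := x `^ beta.

(* O_a(h), the limit of x^a h(x) as x decreases to 0 *)
Definition Oa (h : R -> R) : R := lim (x `^ expa * h x @[x --> 0^'+]).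

Variable j : nat -> R.

Definition Phi (k : nat) (x : R) : R :=
  match k with
  | 0%N => Num.sqrt (2 * (nu + 1) * kappa) * x `^ (- expa)
  | k'.+1 => Num.sqrt (2 * kappa) / `|besselJ nu (j k')| *
             x `^ ((1 - alpha - beta) / 2) * besselJ nu (j k' * x `^ kappa)
  end.

Definition lam (k : nat) : R :=
  match k with 0%N => 0 | k'.+1 => kappa ^+ 2 * j k' ^+ 2 end.

Definition coef (u : R -> R) (k : nat) : R := L2dot weight 1 u (Phi k).

(* The constant mode carries weight 1 in every H^s, since lam 0 = 0. *)
Definition spectral_weight (s : R) (k : nat) : R :=
  if k == 0%N then 1 else lam k `^ s.

(* H^s for s >= 0: as (Phi k) is orthonormal, the coefficients of an expansion
   of u along (Phi k) can only be the numbers [coef u k]. *)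
Definition Hs (s : R) : set (R -> R) :=
  [set u | [/\ L2 weight 1 u,
     L2cvg weight 1 (fun n x => \sum_(k < n) coef u k * Phi k x) u &
     cvgn (series (fun k => spectral_weight s k * coef u k ^+ 2))]].

Definition Hs_norm (s : R) (u : R -> R) : R :=
  Num.sqrt (limn (series (fun k => spectral_weight s k * coef u k ^+ 2))).

(* H^{-s}, the dual of H^s: bounded linear functionals on H^s. A functional is
   given as a map on all functions, of which only the restriction to H^s
   matters; [Hd_eq] is equality in H^{-s}. An element u of the pivot space is
   identified with the functional z |-> <u, z>_beta. *)
Definition Hd (s : R) : set ((R -> R) -> R) :=
  [set l | (forall (c : R) (y z : R -> R), Hs s y -> Hs s z ->
              l (fun x => c * y x + z x) = c * l y + l z) /\
           exists M : R, forall z, Hs s z -> `|l z| <= M * Hs_norm s z].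

Definition Hd_eq (s : R) (l l' : (R -> R) -> R) : Prop :=
  forall z, Hs s z -> l z = l' z.

Definition Hd_norm (s : R) (l : (R -> R) -> R) : R :=
  sup [set `|l z| | z in [set z | Hs s z /\ Hs_norm s z <= 1]].

(* u belongs to C^0([0,T]; H^{-s}) *)
Definition Hd_continuous (T s : R) (u : R -> (R -> R) -> R) : Prop :=
  (forall t, t \in `[0, T] -> Hd s (u t)) /\
  forall t, t \in `[0, T] ->
    Hd_norm s (fun z => u t' z - u t z) @[t' --> within `[0, T] (nbhs t)] --> 0.

(* S(t) on H^s, s >= 0. For t > 0 the series converges at every point of (0,1)
   and its pointwise sum is the function to which O_a applies. At t = 0 the
   series converges in L^2_beta only, and its sum is z. *)
Definition Sgrp (t : R) (z : R -> R) : R -> R :=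
  if t == 0 then z
  else fun x => limn (series (fun k => expR (- lam k * t) * coef z k * Phi k x)).

(* S(t) on H^{-s}: the k-th coefficient of l is its value at Phi k. *)
Definition Sdual (t : R) (l : (R -> R) -> R) (z : R -> R) : R :=
  limn (series (fun k => expR (- lam k * t) * l (Phi k) * coef z k)).

Definition Bop (tau : R) (f : R -> R) (z : R -> R) : R :=
  \int[leb R]_(t in `]0, tau[) (f t * Oa (Sgrp (tau - t) z)).

(* the transposition identity at time tau, with l in the role of u(tau) *)
Definition duality_formula (s : R) (u0 : (R -> R) -> R) (f : R -> R) (tau : R)
    (l : (R -> R) -> R) : Prop :=
  forall z, Hs s z ->
    l z = u0 (Sgrp tau z) +
      \int[leb R]_(t in `]0, tau[) (f t * Oa (Sgrp (tau - t) z)).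

(* weak solutions on [0,T], with initial datum u0 in H^{-s}, of
     u_t - (x^alpha u_x)_x - beta x^(alpha-1) u_x - mu x^(alpha-2) u = 0,
     [u(.,t), x^(-a)](0) = f(t),   a u(1,t) + u_x(1,t) = 0 *)
Definition weak_solution (T s : R) (u0 : (R -> R) -> R) (f : R -> R)
    (u : R -> (R -> R) -> R) : Prop :=
  Hd_continuous T s u /\
  forall tau, tau \in `]0, T] -> duality_formula s u0 f tau (u tau).

End DegenerateParabolic.

(* the norm of L^infty([0,T]) *)
Definition Linfty_norm {R : realType} (T : R) (g : R -> R) : \bar R :=
  ess_sup (mrestr (leb R) (measurable_itv `[0, T])) (fun t => `|g t|%:E).

Notation L2time := (L2 (fun=> 1)).
Notation L2time_norm := (L2norm (fun=> 1)).

(* Main.v *)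
Require Import Defs.
From HB Require Import structures.
From mathcomp Require Import all_boot all_order all_algebra.
From mathcomp Require Import all_classical all_reals all_analysis.
From mathcomp Require Import ess_sup_inf measurable_realfun.
From mathcomp Require Import ring lra.

Set Implicit Arguments.
Unset Strict Implicit.
Unset Printing Implicit Defensive.

Import Order.TTheory GRing.Theory Num.Theory.
Import numFieldNormedType.Exports.

Local Open Scope classical_set_scope.
Local Open Scope ring_scope.

(* With [w k] the weight of the k-th mode in [H^s], a functional [l] on [H^s] is
   the sequence [l (Phi k)], and its norm squared is the sum of
   [l (Phi k)^2 / w k].  Put [c k = O_a (Phi k)].  For [tau - t > 0] the
   function [S(tau - t) z] has the trace
   [O_a (S(tau - t) z) = sum_k exp(- lam k (tau - t)) z_k c k], so that [B(tau) f]
   has the coefficients [c k * I_k(tau)], where [I_k(tau)] is the integral of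
   [f(t) exp(- lam k (tau - t))] over [(0, tau)].  By Cauchy-Schwarz
   [I_k(tau)^2 <= |f|^2 (T + 1/2) / (1 + lam k)], and everything reduces to the
   convergence of the sum of [c k^2 / (w k (1 + lam k))].

   As [c k^2] is of order [j_k^(2 nu) / J_nu(j_k)^2], this follows from three
   facts on Bessel functions: [1 / J_nu(j_k)^2 = O(j_k)], the lower bound on the
   gaps of the zeros obtained by Sturm comparison, and [s > nu]; the sum is then
   bounded by that of [j_k^(2 nu - 1 - 2 s)].  Continuity in time is dominated
   convergence, mode by mode. *)

(** * Calculus and the Gamma function *)

(** Bessel functions enter through the entire series G_v with J_v(y) = (y/2)^v G_v(y^2/4): its
    derivative is minus the series of order v + 1, and three consecutive orders satisfy a linear
    relation. Bounds, zeros and integrals of products come from these identities, by exhibiting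
    functions whose derivative has a sign or is the wanted integrand; in particular 1 / J_nu(j_k)^2
    = O(j_k) rests on a monotone energy, not on asymptotic expansions. In the variable rho = x^(2
    kappa) each mode is x^(-a) times a function largest in modulus at rho = 0. Hence x^(-a), an
    element of L^2_beta, dominates all expansions, and the constants c_k govern both convergence
    inside (0, 1) and the limit defining [Oa]. Coefficients being integrals, orthonormality of the
    modes has to be proved to identify those of S(t) z. *)

Section RealDerivatives.
Context {R : realType}.
Implicit Types (f g : R -> R) (x a b c : R).

Lemma is_derive_cst_fun x c : is_derive x 1 (fun _ : R => c) 0.
Proof. exact: is_derive_cst. Qed.

Lemma is_derive_id_fun x : is_derive x 1 (fun y : R => y) 1.
Proof. exact: is_derive_id. Qed.

Lemma is_derive_add_fun f g x a b : is_derive x 1 f a -> is_derive x 1 g b ->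
  is_derive x 1 (fun y => f y + g y) (a + b).
Proof. by move=> fa gb; exact: is_deriveD. Qed.

Lemma is_derive_opp_fun f x a : is_derive x 1 f a ->
  is_derive x 1 (fun y => - f y) (- a).
Proof. by move=> fa; exact: is_deriveN. Qed.

Lemma is_derive_mul_fun f g x a b : is_derive x 1 f a -> is_derive x 1 g b ->
  is_derive x 1 (fun y => f y * g y) (a * g x + f x * b).
Proof.
move=> fa gb; apply: (is_derive_eq (is_deriveM fa gb)).
by rewrite /GRing.scale /= addrC (mulrC (g x)).
Qed.

Lemma is_derive_comp_fun f g x a b : is_derive (g x) 1 f a -> is_derive x 1 g b ->
  is_derive x 1 (fun y => f (g y)) (a * b).
Proof. by move=> fa gb; exact: (@is_derive1_comp _ f g). Qed.

Lemma is_derive_sqr_fun f x a : is_derive x 1 f a ->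
  is_derive x 1 (fun y => f y ^+ 2) (2 * f x * a).
Proof.
move=> fa; apply: (is_derive_eq (is_derive_mul_fun fa fa)); ring.
Qed.

Lemma is_derive_expR_fun g x b : is_derive x 1 g b ->
  is_derive x 1 (fun y => expR (g y)) (expR (g x) * b).
Proof. exact: is_derive_comp_fun. Qed.

Lemma is_derive_powR_fun g x b c : 0 < g x -> is_derive x 1 g b ->
  is_derive x 1 (fun y => g y `^ c) (c * g x `^ (c - 1) * b).
Proof. by move=> gx; exact: (is_derive_comp_fun (is_derive1_powR c gx)). Qed.

Lemma is_derive_continuous f x a : is_derive x 1 f a -> {for x, continuous f}.
Proof. by move=> fa; apply/differentiable_continuous/derivable1_diffP. Qed.

End RealDerivatives.

(** Follows the syntax of the function and builds the derivative in an evar, to be compared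
    afterwards with the expected one by [ring] or [field]. Derivatives of abstract functions are
    taken from the context, and the positivity of the base of a real power is left as a goal. *)
Ltac derive_fun :=
  lazymatch goal with
  | |- is_derive _ _ (GRing.mul ?c) _ => change (GRing.mul c) with (fun y => c * y);
      eapply is_derive_mul_fun; derive_fun
  | |- is_derive _ _ (GRing.add ?c) _ => change (GRing.add c) with (fun y => c + y);
      eapply is_derive_add_fun; derive_fun
  | |- is_derive _ _ -%R _ => eapply (is_derive_opp_fun (is_derive_id_fun _))
  | |- is_derive _ _ (fun _ => ?c) _ => eapply is_derive_cst_fun
  | |- is_derive _ _ (fun x => x) _ => eapply is_derive_id_fun
  | |- is_derive _ _ (fun _ => _ + _) _ => eapply is_derive_add_fun; derive_fun
  | |- is_derive _ _ (fun _ => - _) _ => eapply is_derive_opp_fun; derive_fun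
  | |- is_derive _ _ (fun _ => _ * _) _ => eapply is_derive_mul_fun; derive_fun
  | |- is_derive _ _ (fun _ => _ ^+ 2) _ => eapply is_derive_sqr_fun; derive_fun
  | |- is_derive _ _ (fun _ => expR _) _ => eapply is_derive_expR_fun; derive_fun
  | |- is_derive _ _ expR _ => eapply is_derive_expR
  | |- is_derive _ _ (fun _ => _ `^ _) _ => eapply is_derive_powR_fun; [|derive_fun]
  | |- _ => try eassumption
  end.

Section RealIntegrability.
Context d (T : measurableType d) (R : realType).
Variables (mu : {measure set T -> \bar R}) (D : set T) (mD : measurable D).
Implicit Types (f g : T -> R) (k : R).

Local Notation Rintegrable f := (mu.-integrable D (EFin \o f)).

Lemma Rintegrable_measurable f : Rintegrable f -> measurable_fun D f.
Proof. by move=> /measurable_int/measurable_EFinP. Qed.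

Lemma RintegrableZ k f : Rintegrable f -> Rintegrable (fun x => k * f x).
Proof. exact: integrableZl. Qed.

Lemma RintegrableD f g : Rintegrable f -> Rintegrable g ->
  Rintegrable (fun x => f x + g x).
Proof. exact: integrableD. Qed.

Lemma RintegrableB f g : Rintegrable f -> Rintegrable g ->
  Rintegrable (fun x => f x - g x).
Proof. exact: integrableB. Qed.

Lemma Rintegrable_le f g : measurable_fun D f ->
  (forall x, D x -> `|f x| <= g x) -> Rintegrable g -> Rintegrable f.
Proof.
move=> mf fg; apply: le_integrable => //; first exact/measurable_EFinP.
by move=> x Dx; rewrite /= lee_fin (le_trans (fg x Dx))// ler_norm.
Qed.

Lemma eq_Rintegrable f g : (forall x, D x -> f x = g x) ->
  Rintegrable f -> Rintegrable g.
Proof.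
by move=> fg; apply: eq_integrable => // x; rewrite inE => Dx /=; rewrite fg.
Qed.

End RealIntegrability.

Lemma Rintegrable_cst_cc (R : realType) (a b k : R) :
  (leb R).-integrable `[a, b] (EFin \o (fun=> k)).
Proof.
apply: continuous_compact_integrable; first exact: segment_compact.
by apply: continuous_subspaceT => x; exact: cst_continuous.
Qed.

Section GammaFunction.
Context {R : realType}.
Implicit Types (z t c x : R).

(** The function t^z e^(-c t) is largest at t = z / c. The inequality is ln y <= y - 1 at y = c t /
    z, with the term -1 (a factor e^(-z)) given away. *)
Lemma powR_le_expR z c t : 0 < z -> 0 < c -> 0 < t ->
  t `^ z <= (z / c) `^ z * expR (c * t).
Proof.
move=> z0 c0 t0; have zc0 : 0 < z / c by rewrite divr_gt0.
rewrite /powR !gt_eqF// -expRD ler_expR.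
suff : ln t <= ln (z / c) + t * (c / z).
  rewrite -(ler_pM2l z0) => /le_trans; apply; rewrite mulrDr lerD2l le_eqVlt.
  by apply/orP; left; apply/eqP; field; rewrite gt_eqF.
have tE : t = (z / c) * (t * (c / z)) by field; rewrite !gt_eqF.
have tc0 : 0 < t * (c / z) by rewrite mulr_gt0// divr_gt0.
rewrite {1}tE lnM ?posrE// lerD2l.
have := @le_ln1Dx R (t * (c / z) - 1); rewrite addrCA subrr addr0 => /(_ _)/le_trans.
by apply; lra.
Qed.

Let cvg_expRN c : 0 < c -> expR (- c * t) @[t --> +oo] --> (0 : R).
Proof.
move=> c0; rewrite (_ : (fun t => expR (- c * t)) = (fun t => expR (- t)) \o (fun t => c * t)).
  by apply: (@cvg_comp _ _ _ _ _ _ (pinfty_nbhs R)); [exact: gt0_cvgMry|exact: cvgr_expR].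
by apply/funext => t /=; rewrite mulNr.
Qed.

Let contexp c : continuous (fun t : R => expR (- c * t)).
Proof. by move=> t; apply: is_derive_continuous; derive_fun. Qed.

Lemma integral_expRN c : 0 < c ->
  (\int[leb R]_(t in `[0%R, +oo[) (expR (- c * t))%:E = (c^-1)%:E)%E.
Proof.
move=> c0.
have dF (x : R) : is_derive x 1 (fun t => - c^-1 * expR (- c * t)) (expR (- c * x)).
  by eapply is_derive_eq; [derive_fun|rewrite /=; field; rewrite gt_eqF].
rewrite (@ge0_continuous_FTC2y _ _ (fun t => - c^-1 * expR (- c * t)) _ 0).
- by rewrite mulr0 expR0 mulr1 EFinN oppeK add0e.
- by move=> x _; rewrite expR_ge0.
- by apply: continuous_subspaceT => t; exact: contexp.
- by rewrite -(mulr0 (- c^-1)); apply: cvgM; [exact: cvg_cst|exact: cvg_expRN].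
- by move=> x _; case: (dF x).
- by apply: cvg_at_right_filter; apply: cvgM; [exact: cvg_cst|exact: contexp].
- by move=> x _ /=; rewrite derive1E; case: (dF x) => _ ->.
Qed.

Lemma integrable_expRN c : 0 < c ->
  (leb R).-integrable `[0, +oo[ (EFin \o (fun t => expR (- c * t))).
Proof.
move=> c0; apply/integrableP; split.
  apply/measurable_EFinP; apply: measurable_funTS; apply: continuous_measurable_fun.
  exact: contexp.
under eq_integral do rewrite /= ger0_norm ?expR_ge0//.
by rewrite integral_expRN// ltry.
Qed.

Definition gammaf z t : R := t `^ (z - 1) * expR (- t).

(** Half of the exponential decay absorbs the power ([powR_le_expR] with c = 1/2); the other half
    remains as an integrable majorant. *)
Lemma gammaf_le z : 1 < z -> forall t, 0 <= t ->
  gammaf z t <= (2 * (z - 1)) `^ (z - 1) * expR (- 2^-1 * t).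
Proof.
move=> z1 t; rewrite /gammaf le_eqVlt => /predU1P[<-|t0].
  by rewrite powR0 ?mul0r ?mulr_ge0 ?expR_ge0 ?powR_ge0// subr_eq0 gt_eqF.
have := @powR_le_expR (z - 1) 2^-1 t; rewrite subr_gt0 invr_gt0 ltr0n invrK (mulrC (z - 1)).
move=> /(_ z1 isT t0); rewrite -(ler_pM2r (expR_gt0 (- t))) => /le_trans; apply.
by rewrite -mulrA -expRD le_eqVlt (_ : 2^-1 * t - t = - 2^-1 * t) ?eqxx//; lra.
Qed.

Lemma gammaf_ge0 z t : 0 <= gammaf z t.
Proof. by rewrite mulr_ge0 ?powR_ge0 ?expR_ge0. Qed.

Lemma measurable_gammaf z : measurable_fun setT (gammaf z).
Proof.
apply: measurable_funM; first exact: measurable_powR.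
by apply: measurableT_comp => //; exact: measurable_funN.
Qed.

Lemma continuous_gammaf z : 1 < z -> {within `[0, +oo[, continuous (gammaf z)}.
Proof.
move=> z1; apply/continuous_within_itvcyP; split.
  move=> x /[!in_itv]/= /andP[x0 _]; rewrite /gammaf.
  apply: is_derive_continuous; derive_fun => //.
rewrite /gammaf powR0 ?mul0r ?subr_eq0 ?gt_eqF//.
have h1 : (fun x : R => x `^ (z - 1)) @ (0 : R)^'+ --> (0 : R) by apply: powR_cvg0; rewrite
  subr_gt0.
have h2 : (fun t : R => expR (- t)) @ (0 : R)^'+ --> expR (- 0).
  apply: cvg_at_right_filter.
  have : {for 0, continuous (fun t : R => expR (- t))} by apply: is_derive_continuous;
    derive_fun.
  exact.
by rewrite -[X in _ --> X](mul0r (expR (- 0))); exact: cvgM h1 h2.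
Qed.

Lemma integrable_gammaf z : 1 < z -> (leb R).-integrable `[0, +oo[ (EFin \o gammaf z).
Proof.
move=> z1; pose g (t : R) := (2 * (z - 1)) `^ (z - 1) * expR (- 2^-1 * t).
have g_ge0 t : 0 <= g t by rewrite mulr_ge0 ?powR_ge0 ?expR_ge0.
have ig : (leb R).-integrable `[0, +oo[ (EFin \o g).
  by apply: (integrableZl _ _ (integrable_expRN _)) => //; rewrite invr_gt0.
apply: (le_integrable _ _ _ ig) => //.
- by apply/measurable_EFinP/measurable_funTS; exact: measurable_gammaf.
- move=> t /= /[!in_itv]/= /andP[t0 _]; rewrite lee_fin !ger0_norm ?gammaf_ge0//.
  exact: gammaf_le.
Qed.

Lemma GammaE z : 1 < z -> Gamma z = \int[leb R]_(t in `[0, +oo[) gammaf z t.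
Proof.
move=> z1; rewrite /Gamma Rintegral_itv_obnd_cbnd//.
apply: (integrableS _ _ _ (integrable_gammaf z1)) => //.
by move=> t /=; rewrite !in_itv/= !andbT; exact: ltW.
Qed.

(** Integration by parts, carried out on the primitive t^z e^(-t). For z > 1 the integrand is
    continuous at 0; the arguments met below are m + v + 1 with v > 0. *)
Lemma GammaS z : 1 < z -> Gamma (z + 1) = z * Gamma z.
Proof.
move=> z1; have z0 : 0 < z by lra.
have z11 : 1 < z + 1 by lra.
rewrite !GammaE//; apply/eqP; rewrite eq_sym -subr_eq0; apply/eqP.
have iz := integrable_gammaf z1; have iz1 := integrable_gammaf z11.
rewrite -RintegralZl// -RintegralB//; last exact: (integrableZl _ z iz).
pose C := (2 * z) `^ z.
have bd t : 0 <= t -> gammaf (z + 1) t <= C * expR (- 2^-1 * t).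
  by move=> t0; have := gammaf_le z11 t0; rewrite addrK.
(* t^z e^-t, the antiderivative of the integrand, tends to 0 at both ends; adding C
   e^(-t/2) makes the integrand nonnegative. *)
pose F t := gammaf (z + 1) t - 2 * C * expR (- 2^-1 * t).
pose f t := z * gammaf z t - gammaf (z + 1) t + C * expR (- 2^-1 * t).
have dF (t : R) : 0 < t -> is_derive t 1 F (f t).
  move=> t0; rewrite /F /gammaf; eapply is_derive_eq; first by derive_fun.
  by rewrite /= /f /gammaf addrK; field.
have CE0 x : 0 <= C * expR (- 2^-1 * x) by rewrite mulr_ge0 ?powR_ge0 ?expR_ge0.
have f_ge0 x : 0 <= x -> 0 <= f x.
  move=> x0; rewrite /f -addrA; apply: addr_ge0.
    by rewrite mulr_ge0 ?gammaf_ge0// ltW.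
  by rewrite addrC subr_ge0 bd.
have cE : continuous (fun t : R => 2 * C * expR (- 2^-1 * t)).
  by move=> t; apply: is_derive_continuous; derive_fun.
have cf : {within `[0, +oo[, continuous f}.
  apply/continuous_within_itvcyP; split.
    move=> x /[!in_itv]/= /andP[x0 _]; rewrite /f /gammaf.
    by apply: is_derive_continuous; derive_fun.
  have /continuous_within_itvcyP[_ g0] := continuous_gammaf z1.
  have /continuous_within_itvcyP[_ g10] := continuous_gammaf z11.
  apply: cvgD; last first.
    apply: cvg_at_right_filter.
    have : {for 0, continuous (fun t : R => C * expR (- 2^-1 * t))}.
      by apply: is_derive_continuous; derive_fun.
    exact.
  by apply: cvgB => //; apply: cvgM => //; exact: cvg_cst.
have F0 : F 0 = - (2 * C).
  by rewrite /F /gammaf addrK powR0 ?gt_eqF// mul0r mulr0 expR0 mulr1 add0r.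
have Fy : F x @[x --> +oo] --> (0 : R).
  rewrite -(subr0 0); apply: cvgB.
    apply: (@squeeze_cvgr _ _ _ _ (cst 0) (fun t => C * expR (- 2^-1 * t))).
    - near=> t; rewrite gammaf_ge0 bd//.
    - exact: cvg_cst.
    - by rewrite -[X in _ --> X](mulr0 C); apply: cvgM; [exact: cvg_cst|exact: cvg_expRN].
  by rewrite -[X in _ --> X](mulr0 (2 * C)); apply: cvgM; [exact: cvg_cst|exact: cvg_expRN].
have F0r : F x @[x --> 0^'+] --> F 0.
  apply: cvgB; last exact/cvg_at_right_filter/cE.
  by have /continuous_within_itvcyP[_] := continuous_gammaf z11.
have fE : \int[leb R]_(x in `[0, +oo[) f x = 2 * C.
  rewrite (@Rintegral_ge0_continuous_FTC2y _ f F 0 0)//.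
  - by rewrite F0 opprK add0r.
  - by move=> x x0; case: (dF x x0).
  - by move=> x /[!in_itv]/= /andP[x0 _]; rewrite derive1E; case: (dF x x0).
have h20 : (0 : R) < 2^-1 by rewrite invr_gt0.
have expE : \int[leb R]_(x in `[0, +oo[) (C * expR (- 2^-1 * x)) = 2 * C.
  rewrite RintegralZl//; last exact: integrable_expRN.
  by rewrite /Rintegral integral_expRN//= invrK mulrC.
have iE : (leb R).-integrable `[0, +oo[ (EFin \o (fun x => C * expR (- 2^-1 * x))).
  by apply: RintegrableZ => //; exact: integrable_expRN.
have iB : (leb R).-integrable `[0, +oo[ (EFin \o (fun x => z * gammaf z x - gammaf (z + 1) x)).
  by apply: RintegrableB => //; exact: RintegrableZ.
by have := fE; rewrite (RintegralD _ iB iE)// expE => /(canRL (addrK _)); rewrite subrr.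
Unshelve. all: by end_near. Qed.

(** On [1, 2] the integrand is at least e^(-2), since t^(z-1) >= 1 there. *)
Lemma Gamma_gt0 z : 1 < z -> 0 < Gamma z.
Proof.
move=> z1; have iz := integrable_gammaf z1; rewrite GammaE//.
have sub12 : (`[1, 2] : set R) `<=` `[0, +oo[.
  by move=> t /=; rewrite !in_itv/= andbT => /andP[+ _]; exact: le_trans.
have i12 : (leb R).-integrable `[1, 2] (EFin \o gammaf z) by exact: integrableS iz.
have e2 : 0 < expR (- (2 : R)) by exact: expR_gt0.
apply: (@lt_le_trans _ _ (\int[leb R]_(t in `[1, 2]) expR (- (2 : R)))).
  rewrite Rintegral_cst//= mulr_gt0//.
  have := @lebesgue_measure_itv R `[1, 2].
  rewrite /= lte_fin ltr1n /= => ->.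
  by rewrite -EFinB/=; lra.
apply: (@le_trans _ _ (\int[leb R]_(t in `[1, 2]) gammaf z t)).
  apply: le_Rintegral => //.
    exact: Rintegrable_cst_cc.
  move=> t /= /[!in_itv]/= /andP[t1 t2]; rewrite /gammaf.
  rewrite -[leLHS]mul1r; apply: ler_pM; rewrite ?ler01 ?expR_ge0//.
    by rewrite -[leLHS](powRr0 t) ler_powR// subr_ge0 ltW.
  by rewrite ler_expR lerN2.
rewrite /Rintegral fine_le//; try exact: integrable_fin_num.
apply: ge0_subset_integral => //; first exact: measurable_int iz.
by move=> t _; rewrite lee_fin gammaf_ge0.
Qed.

End GammaFunction.

(** * The Bessel series *)

Section RealSeries.
Context {R : realType}.
Implicit Types (f g : nat -> R) (k l : R).

Lemma cvg_seriesZ k f l : series f @ \oo --> l ->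
  series (fun n => k * f n) @ \oo --> k * l.
Proof.
move=> fl; rewrite (_ : series _ = fun n => k * series f n); last first.
  by apply/funext => n; rewrite /series/= mulr_sumr.
by apply: cvgM => //; exact: cvg_cst.
Qed.

Lemma cvg_seriesD f g k l : series f @ \oo --> k -> series g @ \oo --> l ->
  series (fun n => f n + g n) @ \oo --> k + l.
Proof.
move=> fk gl; rewrite (_ : series _ = fun n => series f n + series g n).
  exact: cvgD.
by apply/funext => n; rewrite /series/= big_split.
Qed.

Lemma eq_cvg_series f g l : f =1 g -> series f @ \oo --> l -> series g @ \oo --> l.
Proof. by move=> /funext ->. Qed.

Lemma cvg_series_unique f k l : series f @ \oo --> k -> series f @ \oo --> l -> k = l.
Proof. by move=> fk fl; rewrite -(cvg_lim _ fk)// -(cvg_lim _ fl). Qed.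

End RealSeries.
Arguments cvg_seriesZ {R} k [f l].

Local Opaque Gamma.

Section BesselEntire.
Context {R : realType}.
Implicit Types (v r x y : R) (m : nat).

Definition bessel_coef v m : R := (-1) ^+ m / (m`!%:R * Gamma (m%:R + v + 1)).

(** The entire part of J_v (see [besselJE]): the factor (y/2)^v is split off and the remaining even
    series is read in r = y^2/4. Up to the factor 1 / Gamma(v + 1) it is the hypergeometric function
    0F1(; v + 1; -r). *)
Definition besselG v r : R := limn (pseries (bessel_coef v) r).

Lemma Gamma_addn_gt0 v m : 0 < v -> 0 < Gamma (m%:R + v + 1).
Proof. by move=> v0; apply: Gamma_gt0; rewrite ltrDr ltr_wpDl. Qed.

Lemma Gamma_addnS v m : 0 < v ->
  Gamma (m.+1%:R + v + 1) = (m%:R + v + 1) * Gamma (m%:R + v + 1).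
Proof.
move=> v0; rewrite -GammaS; last by rewrite ltrDr ltr_wpDl.
by congr Gamma; rewrite -natr1; ring.
Qed.

Lemma Gamma_addn_ge v m : 0 < v -> Gamma (v + 1) <= Gamma (m%:R + v + 1).
Proof.
move=> v0; elim: m => [|m IH]; first by rewrite add0r.
rewrite Gamma_addnS//; apply: (le_trans IH).
rewrite -[leLHS]mul1r ler_pM2r ?Gamma_addn_gt0//.
by rewrite lerDr addr_ge0// ltW.
Qed.

(** The factor m + 1 cancels against (m + 1)!, and the Gamma argument of index m + 1 and order v is
    that of index m and order v + 1. *)
Lemma bessel_coef_diffs v :
  pseries_diffs (bessel_coef v) = (fun m => - bessel_coef (v + 1) m).
Proof.
apply/funext => m; rewrite /pseries_diffs /bessel_coef.
have -> : m.+1%:R + v + 1 = m%:R + (v + 1) + 1 :> R by rewrite -natr1; ring.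
rewrite factS natrM exprS mulN1r -mulrA invfM mulNr mulrN; congr (- _).
by rewrite !mulrA [_ * (-1) ^+ m]mulrC mulfK// pnatr_eq0.
Qed.

(** Gamma(m + v + 1) >= Gamma(v + 1), so the exponential series is a majorant and the radius of
    convergence is infinite. *)
Lemma bessel_coef_le v m : 0 < v ->
  `|bessel_coef v m| <= (Gamma (v + 1))^-1 * (m`!%:R)^-1.
Proof.
move=> v0; rewrite /bessel_coef normrM normrX normrN1 expr1n mul1r.
have fm : 0 < m`!%:R :> R by rewrite ltr0n fact_gt0.
have g0 := Gamma_addn_gt0 m v0; have g1 := Gamma_addn_ge m v0.
have g2 : 0 < Gamma (v + 1) by apply: Gamma_gt0; rewrite ltrDr.
move: (Gamma _) (Gamma _) g0 g1 g2 => a b a0 ba b0.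
rewrite gtr0_norm ?invr_gt0 ?mulr_gt0// invfM mulrC ler_pM2r ?invr_gt0//.
by rewrite lef_pV2 ?posrE.
Qed.

Lemma is_cvg_besselG v r : 0 < v -> cvgn (pseries (bessel_coef v) r).
Proof.
move=> v0; apply: normed_cvg.
apply: (@series_le_cvg _ _ (fun m => (Gamma (v + 1))^-1 * exp_coeff `|r| m)) => //.
- by move=> m; rewrite /=.
- move=> m; rewrite /exp_coeff/= mulr_ge0 ?invr_ge0 ?divr_ge0//.
  by rewrite ltW//; have := Gamma_addn_gt0 0 v0; rewrite add0r.
- move=> m; rewrite /exp_coeff/= normrM normrX mulrA mulrAC ler_pM//.
  exact: bessel_coef_le.
- exact/is_cvg_seriesZ/is_cvg_series_exp_coeff.
Qed.

Lemma cvg_besselG v r : 0 < v ->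
  series (fun m => bessel_coef v m * r ^+ m) @ \oo --> besselG v r.
Proof. exact: is_cvg_besselG. Qed.

Lemma cvg_bessel_coef_diffs v r : 0 < v ->
  pseries (pseries_diffs (bessel_coef v)) r @ \oo --> - besselG (v + 1) r.
Proof.
move=> v0; rewrite bessel_coef_diffs -mulN1r.
apply: (@eq_cvg_series _ (fun m => -1 * (bessel_coef (v + 1) m * r ^+ m))).
  by move=> m; rewrite mulN1r/= mulNr.
by apply: cvg_seriesZ; apply: cvg_besselG; rewrite addr_gt0.
Qed.

Lemma is_derive_besselG v r : 0 < v ->
  is_derive r 1 (besselG v) (- besselG (v + 1) r).
Proof.
move=> v0; have v10 : 0 < v + 1 by rewrite addr_gt0.
have v20 : 0 < v + 1 + 1 by rewrite addr_gt0.
rewrite -(cvg_lim _ (cvg_bessel_coef_diffs (v:=v) (r:=r) v0))//.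
(* Termwise differentiation asks for convergence of the series and of its first two derived series
   at a point of modulus larger than that of r; the derived series are again Bessel series up to
   sign. *)
apply: (@pseries_snd_diffs _ _ (`|r| + 1)).
- exact: is_cvg_besselG.
- by apply/cvg_ex; eexists; exact: cvg_bessel_coef_diffs.
- rewrite bessel_coef_diffs (_ : (fun m => - _) = - bessel_coef (v + 1))//.
  rewrite pseries_diffsN bessel_coef_diffs.
  rewrite (_ : - (fun m => - _) = bessel_coef (v + 1 + 1)); first exact: is_cvg_besselG.
  by apply/funext => m; rewrite fctE opprK.
- by rewrite [ltRHS]ger0_norm ?addr_ge0// ltrDl.
Qed.

(** Bessel's equation r G'' + (v + 1) G' + G = 0 in disguise, as G' = - G_(v+1) and G'' = G_(v+2).
    On coefficients it is Gamma(m + v + 2) = (m + v + 1) Gamma(m + v + 1). *)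
Lemma besselG_rec v r : 0 < v ->
  r * besselG (v + 1 + 1) r = (v + 1) * besselG (v + 1) r - besselG v r.
Proof.
move=> v0; have v10 : 0 < v + 1 by rewrite addr_gt0.
have cd := cvg_bessel_coef_diffs (r:=r) v10.
have := pseries_diffs_equiv (cvgP _ cd).
rewrite (cvg_lim _ cd)// => /(cvg_seriesZ r) h1.
have h2 := cvg_seriesZ (v + 1) (cvg_besselG (r:=r) v10).
have h := cvg_seriesD h1 h2.
suff /cvg_series_unique/(_ (cvg_besselG (r:=r) v0)) : series (fun m => bessel_coef v m * r
  ^+ m) @ \oo -->
    r * - besselG (v + 1 + 1) r + (v + 1) * besselG (v + 1) r.
  move=> <-; move: (besselG _ _) (besselG _ _) => a b; ring.
apply: (eq_cvg_series _ h) => m.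
have -> : r * (m%:R * bessel_coef (v + 1) m * r ^+ m.-1) = m%:R * bessel_coef (v + 1) m * r
  ^+ m.
  by case: m => [|m]; rewrite ?mul0r ?mulr0// mulrCA -exprS.
rewrite mulrA -mulrDl -mulrDl; congr (_ * _).
rewrite /bessel_coef (_ : m%:R + (v + 1) + 1 = m.+1%:R + v + 1); last first.
  by rewrite -natr1; ring.
rewrite Gamma_addnS//; have := Gamma_addn_gt0 m v0; move: (Gamma _) => g g0.
have m1 : m%:R + v + 1 != 0 by rewrite gt_eqF// ltr_wpDl// addr_ge0// ltW.
by field; rewrite (gt_eqF g0) m1 pnatr_eq0 -lt0n fact_gt0.
Qed.

Lemma besselG0 v : 0 < v -> besselG v 0 = (Gamma (v + 1))^-1.
Proof.
move=> v0; have := cvg_besselG (r:=0) v0; rewrite -(cvg_shiftS _) => h.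
rewrite /besselG; apply/cvg_lim => //; rewrite -cvg_shiftS.
rewrite (_ : (fun n => _) = cst (Gamma (v + 1))^-1); first exact: cvg_cst.
apply/funext => n; rewrite /pseries seriesEnat/= big_nat_recl//= big1 ?addr0.
  by rewrite /bessel_coef expr0 mulr1 mul1r add0r fact0 mul1r.
by move=> i _; rewrite expr0n mulr0.
Qed.

Lemma besselJE v y : 0 < v -> 0 < y ->
  besselJ v y = (y / 2) `^ v * besselG v (y ^+ 2 / 4).
Proof.
move=> v0 y0; apply/cvg_lim => //.
apply: (eq_cvg_series _ (cvg_seriesZ ((y / 2) `^ v) (cvg_besselG (r:=y ^+ 2 / 4) v0))) => m.
have y20 : 0 < y / 2 by rewrite divr_gt0.
rewrite powRD; last by rewrite (gt_eqF y20) implybT.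
have -> : (y / 2) `^ (2 * m%:R) = (y ^+ 2 / 4) ^+ m.
  by rewrite -natrM powR_mulrn ?ltW// exprM; congr (_ ^+ _); field.
by rewrite /bessel_coef; move: (Gamma _) => g; ring.
Qed.

End BesselEntire.

(** * Growth and zeros of Bessel functions *)

Lemma ge0_derive_le (R : realType) (f f' : R -> R) (x y : R) : x <= y ->
  (forall z, x <= z -> z <= y -> is_derive z 1 f (f' z)) ->
  (forall z, x < z -> z < y -> 0 <= f' z) -> f x <= f y.
Proof.
rewrite le_eqVlt => /predU1P[-> //|xy] df f'0.
have cf : {within `[x, y], continuous f}.
  apply: continuous_in_subspaceT => z; rewrite inE/= in_itv/= => /andP[xz zy].
  by apply: is_derive_continuous; exact: df.
have df' z : z \in `]x, y[ -> is_derive z 1 f (f' z).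
  by rewrite in_itv/= => /andP[xz zy]; apply: df; exact: ltW.
have [z + h] := MVT xy df' cf; rewrite in_itv/= => /andP[xz zy].
by rewrite -subr_ge0 h mulr_ge0 ?f'0// subr_ge0 ltW.
Qed.

Section BesselOde.
Context {R : realType}.
Variable v : R.
Hypothesis v0 : 0 < v.
Implicit Types (r s x y z c : R).

(** These stand for G_v, G_(v+1) and G_(v+2). The relations assumed next carry all the information
    used about the series. *)
Variables A B C : R -> R.
Hypotheses (dA : forall r, is_derive r 1 A (- B r))
  (dB : forall r, is_derive r 1 B (- C r))
  (recC : forall r, r * C r = (v + 1) * B r - A r) (A0 : 0 < A 0).

(** With y = 2 sqrt r this is r^(-v) (J_v(y)^2 + J_(v+1)(y)^2). *)
Definition bessel_sq r := A r ^+ 2 + r * B r ^+ 2.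
Local Notation N := bessel_sq.

Lemma is_derive_bessel_sq r : is_derive r 1 N (- (2 * v + 1) * B r ^+ 2).
Proof.
have hA := dA r; have hB := dB r.
rewrite /bessel_sq; eapply is_derive_eq; first by derive_fun.
rewrite /=; have := recC r; move: (A r) (B r) (C r) => a b c h.
have -> : 2 * a * - b + (1 * b ^+ 2 + r * (2 * b * - c)) =
  - 2 * a * b + b ^+ 2 - 2 * b * (r * c) by ring.
by rewrite h; ring.
Qed.

Lemma bessel_sq_ge0 r : 0 <= r -> 0 <= N r.
Proof. by move=> r0; apply: addr_ge0; [|apply: mulr_ge0 => //]; exact: sqr_ge0. Qed.

(** [bessel_sq] decreases, its derivative being -(2v+1) B^2; hence A(r)^2 <= N(r) <= N(0) =
    A(0)^2. *)
Lemma besselG_le r : 0 <= r -> `|A r| <= A 0.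
Proof.
move=> r0; rewrite -(@ler_pXn2r _ 2)// ?nnegrE ?(ltW A0)//.
rewrite real_normK ?num_real//.
have cN : {within `[0, r], continuous N}.
  apply: continuous_subspaceT => x; apply: is_derive_continuous; exact: is_derive_bessel_sq.
have [c _ Nr] := MVT_segment r0 (fun x _ => is_derive_bessel_sq x) cN.
have : N r <= N 0.
  rewrite -subr_le0 Nr subr0 mulr_le0_ge0// mulNr oppr_le0 mulr_ge0 ?sqr_ge0//.
  by rewrite addr_ge0// mulr_ge0// ltW.
rewrite /N mul0r addr0; apply: le_trans.
by rewrite lerDl mulr_ge0// sqr_ge0.
Qed.

(** Counterpart to the decrease of N: the factor r^(2v+1) makes the terms in B cancel, and the
    derivative becomes (2v+1) r^(2v) A^2. This bounds N from below on bounded ranges. *)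
Lemma powR_bessel_sq_homo x y : 0 < x -> x <= y ->
  x `^ (2 * v + 1) * N x <= y `^ (2 * v + 1) * N y.
Proof.
move=> x0 xy; pose q := 2 * v + 1.
have q0 : 0 < q by rewrite addr_gt0// mulr_gt0.
have D z : 0 < z -> is_derive z 1 (fun z => z `^ q * N z) (q * z `^ (q - 1) * A z ^+ 2).
  move=> z0; have hN := is_derive_bessel_sq z.
  eapply is_derive_eq; first by derive_fun.
  rewrite /= /N mulr1 -/q.
  have -> : z `^ q = z `^ (q - 1) * z by rewrite mulrC mulr_powRB1// ltW.
  by move: (A z) (B z) (z `^ (q - 1)) => a b p; ring.
apply: (ge0_derive_le xy (fun z xz _ => D z (lt_le_trans x0 xz))) => z xz _.
by rewrite mulr_ge0 ?sqr_ge0// mulr_ge0 ?powR_ge0// ltW.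
Qed.

(** A zero of N at r would propagate to all of (0, r] by [powR_bessel_sq_homo], whereas A is
    positive near 0. Consequently A and B have no common positive zero. *)
Lemma bessel_sq_gt0 r : 0 < r -> 0 < N r.
Proof.
move=> r0; rewrite lt_neqAle bessel_sq_ge0 ?ltW// andbT eq_sym; apply/eqP => Nr.
have cA : A x @[x --> 0^'+] --> A 0.
  by apply: cvg_at_right_filter; apply: is_derive_continuous; exact: dA.
have : \forall x \near 0^'+, 0 < A x.
  by apply: (cvgr_gt (A 0)) => //; exact: A0.
move=> Apos.
have [x [Ax x0 xr]] : exists x, [/\ 0 < A x, 0 < x & x <= r].
  apply: (@filter_ex _ (0 : R)^'+); near=> x; split.
  - by near: x.
  - by near: x; exact: nbhs_right_gt.
  - by near: x; exact: nbhs_right_le.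
have := powR_bessel_sq_homo x0 xr; rewrite Nr mulr0 leNgt => /negP; apply.
rewrite mulr_gt0 ?powR_gt0// ltr_pwDl ?exprn_gt0// mulr_ge0 ?sqr_ge0// ltW//.
Unshelve. all: by end_near. Qed.

(* In terms of y = 2 sqrt r, the function r^p (2 N - 2 p A B) is, up to a constant,
   y (J_v^2 + J_(v+1)^2) - (2v+1) J_v J_(v+1); its logarithmic derivative is O(r^(-3/2)),
   so it stays away from 0 at infinity. *)
Let p := v + 2^-1.
Let p0 : 0 < p. Proof. by rewrite addr_gt0. Qed.
Definition bessel_energy r := r `^ p * (2 * N r - 2 * p * (A r * B r)).
Local Notation V := bessel_energy.

Lemma is_derive_bessel_energy r : 0 < r ->
  is_derive r 1 V (p * r `^ (p - 1) * (A r * B r)).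
Proof.
move=> r0; have hA := dA r; have hB := dB r; have hN := is_derive_bessel_sq r.
rewrite /bessel_energy; eapply is_derive_eq; first by derive_fun.
rewrite /= /N mulr1 mul0r add0r.
have -> : r `^ p = r `^ (p - 1) * r by rewrite mulrC mulr_powRB1// ltW.
have := recC r; move: (A r) (B r) (C r) (r `^ (p - 1)) => a b c q h.
have -> : p * q * (2 * (a ^+ 2 + r * b ^+ 2) - 2 * p * (a * b)) +
  q * r * (2 * (- (2 * v + 1) * b ^+ 2) - (0 * (a * b) + 2 * p * (- b * b + a * - c))) =
  q * (p * (2 * (a ^+ 2 + r * b ^+ 2) - 2 * p * (a * b)) +
   (r * (2 * (- (2 * v + 1) * b ^+ 2)) + 2 * p * r * b * b) + 2 * p * a * (r * c)) by ring.
by rewrite h /p; field.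
Qed.

(** The difference is r^p times (A - p B)^2 + (r - p^2) B^2, hence the threshold p^2. *)
Lemma bessel_energy_ge r : 0 < r -> p ^+ 2 <= r -> r `^ p * N r <= V r.
Proof.
move=> r0 pr; rewrite /bessel_energy ler_pM2l ?powR_gt0// -subr_ge0.
have -> : 2 * N r - 2 * p * (A r * B r) - N r =
  (A r - p * B r) ^+ 2 + (r - p ^+ 2) * B r ^+ 2 by rewrite /N; ring.
apply: addr_ge0; first exact: sqr_ge0.
by apply: mulr_ge0; rewrite ?sqr_ge0 ?subr_ge0.
Qed.

(** From 2 sqrt r |A B| <= N and [bessel_energy_ge] one gets V' >= -(p/2) r^(-3/2) V; the
    exponential is the integrating factor of this inequality. *)
Lemma bessel_energy_homo x y : 0 < x -> p ^+ 2 <= x -> x <= y ->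
  expR (- p * x `^ (- 2^-1)) * V x <= expR (- p * y `^ (- 2^-1)) * V y.
Proof.
move=> x0 px xy; pose W z := expR (- p * z `^ (- 2^-1)) * V z.
pose W' z := expR (- p * z `^ (- 2^-1)) *
  (p * 2^-1 * z `^ (- 2^-1 - 1) * V z + p * z `^ (p - 1) * (A z * B z)).
have D z : 0 < z -> is_derive z 1 W (W' z).
  move=> z0; have hV := is_derive_bessel_energy z0.
  rewrite /W; eapply is_derive_eq; first by derive_fun.
  by rewrite /W' /=; field.
apply: (ge0_derive_le xy (fun z xz _ => D z (lt_le_trans x0 xz))) => c xc _.
have c0 : 0 < c by exact: lt_trans xc.
rewrite /W' mulr_ge0 ?expR_ge0//.
apply: (@le_trans _ _ (p * 2^-1 * c `^ (- 2^-1 - 1) * (c `^ p * N c) + p * c `^ (p - 1) *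
  (A c * B c))).
  (* With s = sqrt c the lower bound becomes a positive multiple of the square (A c + s B c)^2. *)
  pose s := c `^ (2^-1); have s0 : 0 < s by rewrite powR_gt0.
  have sE : c = s ^+ 2 by rewrite -powR_mulrn ?ltW// -powRrM mulVf// powRr1// ltW.
  have -> : c `^ (- 2^-1 - 1) = s^-1 * (s ^+ 2)^-1.
    by rewrite powRD ?(gt_eqF c0) ?implybT// powRN powR_inv1 ?ltW// -sE.
  have -> : c `^ p = c `^ (p - 1) * s ^+ 2 by rewrite -sE mulrC mulr_powRB1// ltW.
  have -> : p * 2^-1 * (s^-1 * (s ^+ 2)^-1) * (c `^ (p - 1) * s ^+ 2 * N c) +
     p * c `^ (p - 1) * (A c * B c) =
     p * c `^ (p - 1) * (2^-1 * s^-1) * (A c + s * B c) ^+ 2.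
    have -> : N c = A c ^+ 2 + s ^+ 2 * B c ^+ 2 by rewrite /N -sE.
    move: (A c) (B c) (c `^ (p - 1)) => a b q.
    by field; rewrite gt_eqF.
  by rewrite mulr_ge0 ?sqr_ge0// !mulr_ge0 ?powR_ge0 ?invr_ge0 ?(ltW s0)// ltW.
rewrite lerD2r ler_pM2l ?mulr_gt0 ?powR_gt0 ?invr_gt0//.
by apply: bessel_energy_ge => //; exact: le_trans (ltW xc).
Qed.

(** With y = 2 sqrt r the bounded quantity is (y/2) J_v(y)^2, so this is 1 / J_v(j)^2 = O(j) at the
    zeros of J_(v+1). At such zeros N = A^2 and V = 2 r^p A^2: the energy settles r > p^2, and the
    growth of r^(2v+1) N settles the bounded range from r0 to p^2. *)
Lemma besselG_at_zero_ge r0 : 0 < r0 -> exists2 c, 0 < c &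
  forall r, r0 <= r -> B r = 0 -> c <= r `^ (v + 2^-1) * A r ^+ 2.
Proof.
move=> r00; pose q := 2 * v + 1.
have q0 : 0 < q by rewrite addr_gt0// mulr_gt0.
have pp0 : 0 < p ^+ 2 by rewrite exprn_gt0.
pose c1 := r0 `^ p * (((p ^+ 2) `^ q)^-1 * (r0 `^ q * N r0)).
pose c2 := expR (- p * (p ^+ 2) `^ (- 2^-1)) * V (p ^+ 2) / 2.
have c10 : 0 < c1 by rewrite !mulr_gt0 ?invr_gt0 ?powR_gt0 ?bessel_sq_gt0.
have V0 : 0 < V (p ^+ 2).
  by apply: lt_le_trans (bessel_energy_ge pp0 _) => //; rewrite mulr_gt0 ?powR_gt0
    ?bessel_sq_gt0.
have c20 : 0 < c2 by rewrite divr_gt0// mulr_gt0 ?expR_gt0.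
exists (Num.min c1 c2); first by rewrite lt_min c10.
move=> r rr0 Br; have rpos : 0 < r by exact: lt_le_trans rr0.
have NE : N r = A r ^+ 2 by rewrite /N Br expr0n/= mulr0 addr0.
rewrite ge_min; have [rp|pr] := leP r (p ^+ 2).
  apply/orP; left; rewrite /c1 ler_pM ?powR_ge0//.
  - by rewrite !mulr_ge0 ?invr_ge0 ?powR_ge0 ?bessel_sq_ge0// ltW.
  - by rewrite ge0_ler_powR ?nnegrE// ltW.
  rewrite mulrC ler_pdivrMr ?powR_gt0// -NE.
  apply: (le_trans (powR_bessel_sq_homo r00 rr0)).
  rewrite mulrC ler_wpM2l ?bessel_sq_ge0 ?(ltW rpos)//.
  by rewrite ge0_ler_powR ?nnegrE// ltW.
apply/orP; right; rewrite /c2 ler_pdivrMr//.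
apply: (le_trans (bessel_energy_homo pp0 (lexx _) (ltW pr))).
have -> : V r = r `^ p * A r ^+ 2 * 2 by rewrite /bessel_energy Br NE; ring.
rewrite ler_piMl//; first by apply: mulr_ge0 => //; apply: mulr_ge0; rewrite ?powR_ge0 ?sqr_ge0.
by rewrite -expR0 ler_expR mulNr oppr_le0 mulr_ge0 ?powR_ge0// ltW.
Qed.

End BesselOde.

(** * Spacing of the zeros by Sturm comparison *)

Section NoZeroSign.
Context {R : realType}.

(** The intermediate value theorem. The sign is returned as a factor s with s^2 = 1, so that both
    signs share one argument later. *)
Lemma no_zero_sign (f : R -> R) (c d : R) :
  (forall x, c < x -> x < d -> {for x, continuous f}) ->
  (forall x, c < x -> x < d -> f x != 0) ->
  exists2 s : R, s ^+ 2 = 1 & forall x, c < x -> x < d -> 0 < s * f x.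
Proof.
move=> cf f0.
have [h|/existsNP[x /not_implyP[cx /not_implyP[xd /negP]]]] :=
    pselect (forall x, c < x -> x < d -> 0 < f x).
  by exists 1; rewrite ?expr1n// => x cx xd; rewrite mul1r h.
rewrite -leNgt le_eqVlt (negbTE (f0 _ cx xd))/= => fx.
exists (-1); first by rewrite sqrrN expr1n.
move=> y cy yd; rewrite mulN1r oppr_gt0 lt_neqAle f0//= leNgt; apply/negP => fy.
have cwf a b : c < a -> b < d -> {within `[a, b], continuous f}.
  move=> ca bd; apply: continuous_in_subspaceT => z.
  rewrite inE/= in_itv/= => /andP[az zb].
  by apply: cf; [exact: lt_le_trans az|exact: le_lt_trans bd].
have [xy|/ltW yx] := leP x y.
  have [|z] := IVT xy (cwf _ _ cx yd) (v := 0).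
    by rewrite ge_min le_max !(ltW fx) (ltW fy) orbT.
  rewrite in_itv/= => /andP[xz zy] /eqP; apply/negP/f0.
    exact: lt_le_trans xz.
  exact: le_lt_trans yd.
have [|z] := IVT yx (cwf _ _ cy xd) (v := 0).
  by rewrite ge_min le_max (ltW fx) (ltW fy) orbT.
rewrite in_itv/= => /andP[xz zy] /eqP; apply/negP/f0.
  exact: lt_le_trans xz.
exact: le_lt_trans xd.
Qed.

End NoZeroSign.

Section BesselGap.
Context {R : realType}.
Variable v : R.
Hypothesis v0 : 0 < v.
Implicit Types (r s x y z c d : R).
Variables A B C : R -> R.
Hypotheses (dA : forall r, is_derive r 1 A (- B r))
  (dB : forall r, is_derive r 1 B (- C r))
  (recC : forall r, r * C r = (v + 1) * B r - A r) (A0 : 0 < A 0).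

Let a y := A (y ^+ 2 / 4).
Let b y := B (y ^+ 2 / 4).
Let c_ y := C (y ^+ 2 / 4).

Let dsq y : is_derive y 1 (fun y : R => y ^+ 2 / 4) (y / 2).
Proof. by eapply is_derive_eq; [derive_fun|rewrite /=; field]. Qed.

Let da y : is_derive y 1 a (- b y * (y / 2)).
Proof. exact: (is_derive_comp_fun (dA _) (dsq y)). Qed.

Let db y : is_derive y 1 b (- c_ y * (y / 2)).
Proof. exact: (is_derive_comp_fun (dB _) (dsq y)). Qed.

Let rec_ y : y ^+ 2 * c_ y = 4 * ((v + 1) * b y - a y).
Proof. by rewrite -recC /c_; field. Qed.

(* Sturm comparison: [y^(v+1/2) X] below is the Wronskian of [sqrt y J_(v+1)(y)] with the
   test function [phi y = (y - c) - (y - c)^2/2], for which [phi'' + phi < 0] on [[c, c+1]]. *)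
Lemma bessel_zero_gap c d : 0 < c -> c < d -> B (c ^+ 2 / 4) = 0 ->
  B (d ^+ 2 / 4) = 0 -> (forall y, c < y -> y < d -> B (y ^+ 2 / 4) != 0) ->
  1 <= d - c.
Proof.
move=> c0 cd Bc Bd Bn0; rewrite leNgt; apply/negP => dc1.
have d0 : 0 < d by exact: lt_trans cd.
have cb y : {for y, continuous b} by apply: is_derive_continuous; exact: db.
have ca y : {for y, continuous a} by apply: is_derive_continuous; exact: da.
have [s s1 sb] := no_zero_sign (fun y _ _ => cb y) Bn0.
pose p := v + 2^-1; have p0 : 0 < p by rewrite addr_gt0.
pose phi y := (y - c) - (y - c) ^+ 2 / 2.
pose X y := (2 * a y - p * b y) * phi y - y * b y * (1 - (y - c)).
pose X' y := y `^ (p - 1) * ((s * b y) * (y ^+ 2 * (1 - phi y) + p * (p + 1) * phi y)).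
have dX y : 0 < y -> is_derive y 1 (fun y => s * (y `^ p * X y)) (X' y).
  move=> y0; have hda := da y; have hdb := db y.
  rewrite /X /phi; eapply is_derive_eq; first by derive_fun.
  rewrite /= /X' /phi !mulr1.
  have -> : y `^ p = y `^ (p - 1) * y by rewrite mulrC mulr_powRB1// ltW.
  have := rec_ y; move: (a y) (b y) (c_ y) (y `^ (p - 1)) => ay by_ cy q h.
  have pE : v = p - 2^-1 by rewrite /p addrK.
  rewrite pE in h; move: h; move: (p) => p' h.
  apply/eqP; rewrite -subr_eq0; apply/eqP.
  (* The two sides differ by a multiple of the recurrence [h], which eliminates C. *)
  transitivity (s * q * (p' * (y - c - (y - c) ^+ 2 / 2) / 2 + y * (1 - (y - c)) / 2) *
     (y ^+ 2 * cy - 4 * ((p' - 2^-1 + 1) * by_ - ay))).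
    by field.
  by rewrite h subrr mulr0.
have phi_ge0 y : c <= y -> y <= d -> 0 <= phi y <= 2^-1.
  move=> cy yd; rewrite /phi; have : 0 <= y - c <= 1 by lra.
  move: (y - c) => t /andP[t0 t1]; apply/andP; split; nra.
(* As d - c < 1, phi stays between 0 and 1/2 on [c, d], so [X'] is s b times a positive factor, and
   s b > 0 between the two zeros. *)
have Xcd : s * (c `^ p * X c) <= s * (d `^ p * X d).
  apply: (ge0_derive_le (ltW cd) (fun z xz _ => dX z (lt_le_trans c0 xz))) => y cy yd.
  have /andP[f0 f1] := phi_ge0 y (ltW cy) (ltW yd).
  rewrite /X' mulr_ge0 ?powR_ge0// mulr_ge0 ?ltW ?sb//.
  apply: ltr_wpDr; first by rewrite !mulr_ge0// ?addr_ge0// ltW.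
  rewrite mulr_gt0 ?exprn_gt0//; first exact: lt_trans cy.
  by lra.
have bc : b c = 0 by []. have bd : b d = 0 by [].
have Xc : X c = 0 by rewrite /X /phi bc subrr; ring.
have Xd : X d = 2 * a d * phi d by rewrite /X bd; ring.
have phid : 0 < phi d.
  rewrite /phi (_ : _ - _ = (d - c) * (1 - (d - c) / 2)); last by field.
  by rewrite mulr_gt0; lra.
(* X vanishes at c and equals 2 a(d) phi(d) at d, so the monotonicity just obtained gives s a(d) >=
   0; equality is excluded because A and B have no common positive zero. *)
have sad : 0 < s * a d.
  have sad0 : 0 <= s * a d.
    move: Xcd; rewrite Xc Xd !mulr0 (_ : s * _ = (s * a d) * (2 * d `^ p * phi d)); last by
      ring.
    by rewrite pmulr_lge0// mulr_gt0// mulr_gt0// powR_gt0.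
  rewrite lt_neqAle sad0 andbT eq_sym mulf_neq0//.
    by apply/eqP => s_0; move: s1 => /eqP; rewrite s_0 expr0n eq_sym oner_eq0.
  have r0 : 0 < d ^+ 2 / 4 by rewrite divr_gt0// exprn_gt0.
  apply/eqP => ad; have := bessel_sq_gt0 v0 dA dB recC A0 r0.
  by rewrite /bessel_sq Bd -/(a d) ad expr0n/= mulr0 addr0 ltxx.
(* The derivative of s b is (2/y) s (a - (v + 1) b), which is positive just left of d. Then s b
   would increase to its value 0 at d, although it is positive before d. *)
have cq : {for d, continuous (fun y => s * (a y - (v + 1) * b y))}.
  apply: cvgM; first exact: cvg_cst.
  by apply: cvgB; [exact: ca|apply: cvgM; [exact: cvg_cst|exact: cb]].
have : \forall y \near d^'-, c < y /\ 0 < s * (a y - (v + 1) * b y).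
  near=> y; split; first by near: y; exact: nbhs_left_gt.
  near: y; apply: (cvgr_gt (s * (a d - (v + 1) * b d))).
    exact/cvg_at_left_filter/cq.
  by rewrite bd mulr0 subr0.
move=> [e /= e0 he].
pose x := Num.max ((c + d) / 2) (d - e / 2).
have xd : x < d by rewrite gt_max; apply/andP; split; lra.
have cx : c < x by rewrite lt_max; apply/orP; left; lra.
have xe : d - e < x by rewrite lt_max; apply/orP; right; lra.
have : s * b x <= s * b d.
  apply: (@ge0_derive_le _ (fun y => s * b y) (fun y => s * (a y - (v + 1) * b y) * (2 / y))).
  - exact: ltW.
  - move=> z xz _; have hdb := db z; eapply is_derive_eq; first by derive_fun.
    have z0 : 0 < z by apply: lt_le_trans xz; exact: lt_trans cx.
    rewrite /= mul0r add0r.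
    have -> : a z = (v + 1) * b z - z ^+ 2 * c_ z / 4 by rewrite rec_; field.
    by field; rewrite gt_eqF.
  - move=> z xz zd; rewrite mulr_ge0//; last first.
      by rewrite divr_ge0// ltW// (lt_trans c0)// (lt_trans cx).
    have [] := he z _ zd; last by move=> _ /ltW.
    by rewrite /= gtr0_norm ?subr_gt0//; lra.
by rewrite bd mulr0 leNgt sb.
Unshelve. all: by end_near. Qed.

End BesselGap.

(** * Convergence of the sum of n^(-1-e) *)

Section PowerSums.
Context {R : realType}.

Lemma is_cvg_series_powR (e : R) : 0 < e ->
  cvgn (series (fun n => n.+1%:R `^ (- (1 + e)))).
Proof.
move=> e0; have step n : (n.+2%:R : R) `^ (- (1 + e)) <=
    e^-1 * (n.+1%:R `^ (- e) - n.+2%:R `^ (- e)).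
  set M := n.+2%:R; set m := n.+1%:R.
  have mM : m + 1 = M by rewrite /m /M natr1.
  have m0 : 0 < m :> R by rewrite ltr0n.
  (* Integral test by monotonicity: f has the derivative t^(-1-e) - M^(-1-e), nonnegative on [m, M],
     and f m <= f M is the telescoping bound. *)
  pose f (t : R) : R := - e^-1 * t `^ (- e) - t * M `^ (- (1 + e)).
  pose f' (t : R) : R := t `^ (- (1 + e)) - M `^ (- (1 + e)).
  have df (t : R) : 0 < t -> is_derive t 1 f (f' t).
    move=> t0; rewrite /f; eapply is_derive_eq; first by derive_fun.
    rewrite /f' /= (_ : - e - 1 = - (1 + e)); last by ring.
    by field; rewrite gt_eqF.
  have : f m <= f M.
    apply: (@ge0_derive_le _ f f'); first by rewrite -mM lerDl.
      by move=> z mz _; apply: df; exact: lt_le_trans mz.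
    move=> z mz zM; have z0 : 0 < z by exact: lt_trans mz.
    rewrite /f' !powRN subr_ge0 lef_pV2 ?posrE ?powR_gt0 ?ltr0n//.
    by rewrite ge0_ler_powR ?nnegrE ?ltW// addr_gt0.
  rewrite /f -mM; lra.
apply: nondecreasing_is_cvgn.
  by apply: nondecreasing_series => n _ _; exact: powR_ge0.
exists (1 + e^-1) => _ [n _ <-].
have : series (fun n => n.+1%:R `^ (- (1 + e))) n.+1 <= 1 + e^-1 - e^-1 * n.+1%:R `^ (- e).
  elim: n => [|n IH].
    by rewrite /series/= big_nat1 !powR1 mulr1 addrK.
  rewrite /series/= big_nat_recr//=; have := step n; move: IH; rewrite /series/=.
  by move: (\sum_(0 <= _ < _) _) => S; lra.
move=> h; have h' : e^-1 * n.+1%:R `^ (- e) >= 0 by rewrite mulr_ge0 ?powR_ge0// invr_ge0 ltW.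
have : series (fun n => n.+1%:R `^ (- (1 + e))) n <= series (fun n => n.+1%:R `^ (- (1 +
  e))) n.+1 :> R.
  by rewrite /series/= big_nat_recr//= lerDl powR_ge0.
by move: h h'; lra.
Qed.

End PowerSums.

(** * Integrals over (0, 1) evaluated through primitives *)

Section IntegralPower.
Context {R : realType}.

(** The hypotheses concern only the open interval and the limits at its ends, because the powers
    integrated below may be singular at 0. Compact subintervals exhaust ]a, b[, and f >= 0 allows
    monotone convergence. *)
Lemma ge0_FTC_open (F f : R -> R) (a b la lb : R) : a < b ->
  (forall x, a < x -> x < b -> is_derive x 1 F (f x)) ->
  (forall x, a < x -> x < b -> {for x, continuous f}) ->
  (forall x, a < x -> x < b -> 0 <= f x) ->
  F x @[x --> a^'+] --> la -> F x @[x --> b^'-] --> lb ->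
  (\int[leb R]_(x in `]a, b[) (f x)%:E = (lb - la)%:E)%E.
Proof.
move=> ab dF cf f0 Fa Fb.
have ab2 : 0 < (b - a) / 2 by rewrite divr_gt0// subr_gt0.
pose u n := a + (b - a) / 2 / n.+1%:R.
pose w n := b - (b - a) / 2 / n.+1%:R.
have ua n : a < u n by rewrite ltrDl divr_gt0.
have wb n : w n < b by rewrite gtrBl divr_gt0.
have du n : (b - a) / 2 / n.+1%:R <= (b - a) / 2.
  by rewrite ler_pdivrMr// ler_peMr ?ler1n// ltW.
have uw n : u n <= w n by rewrite /u /w; have := du n; move: (_ / n.+1%:R) => t; lra.
have cu : u n @[n --> \oo] --> a.
  rewrite -[X in _ --> X]addr0; apply: cvgD; first exact: cvg_cst.
  by rewrite -(mulr0 ((b - a) / 2)); apply: cvgM; [exact: cvg_cst|exact: cvg_harmonic].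
have cw : w n @[n --> \oo] --> b.
  rewrite -[X in _ --> X]subr0; apply: cvgB; first exact: cvg_cst.
  by rewrite -(mulr0 ((b - a) / 2)); apply: cvgM; [exact: cvg_cst|exact: cvg_harmonic].
have nu m n : (m <= n)%N -> u n <= u m /\ w m <= w n.
  move=> mn; rewrite /u /w.
  have : (b - a) / 2 / n.+1%:R <= (b - a) / 2 / m.+1%:R.
    by rewrite ler_pM2l// lef_pV2 ?posrE// ler_nat ltnS.
  by move: (_ / n.+1%:R) (_ / m.+1%:R) => s t; lra.
have eqU : `]a, b[%classic = \bigcup_n `[u n, w n]%classic.
  apply/seteqP; split=> x /=; last first.
    move=> [n _]; rewrite /= !in_itv/= => /andP[ux xw].
    by rewrite (lt_le_trans (ua n) ux) (le_lt_trans xw (wb n)).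
  rewrite in_itv/= => /andP[ax xb].
  have : \forall n \near \oo, u n <= x /\ x <= w n.
    near=> n; split; near: n.
      by apply: (cvgr_le a).
    by apply: (cvgr_ge b).
  by move=> [n _ /(_ n (leqnn n))[ux xw]]; exists n => //=; rewrite in_itv/= ux.
have FTC n : (\int[leb R]_(x in `[u n, w n]) (f x)%:E = (F (w n) - F (u n))%:E)%E.
  (* At n = 0 both endpoints are the midpoint and the interval degenerates. *)
  have := uw n; rewrite le_eqVlt => /predU1P[->|uwn].
    by rewrite set_itv1 integral_set1 subrr.
  have I x : u n <= x -> x <= w n -> a < x /\ x < b.
    by move=> ux xw; split; [exact: lt_le_trans ux|exact: le_lt_trans (wb n)].
  rewrite (@continuous_FTC2 _ f F)//.
  - apply: continuous_in_subspaceT => x; rewrite inE/= in_itv/= => /andP[ux xw].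
    by have [ax xb] := I _ ux xw; exact: cf.
  - split.
    + move=> x; rewrite in_itv/= => /andP[/ltW ux /ltW xw].
      by have [ax xb] := I _ ux xw; have [] := dF x ax xb.
    + have [ax xb] := I _ (lexx _) (uw n).
      by apply: cvg_at_right_filter; apply: is_derive_continuous; exact: dF.
    + have [ax xb] := I _ (uw n) (lexx _).
      by apply: cvg_at_left_filter; apply: is_derive_continuous; exact: dF.
  - move=> x; rewrite in_itv/= => /andP[/ltW ux /ltW xw].
    by have [ax xb] := I _ ux xw; rewrite derive1E; have [] := dF x ax xb.
have cvgI : (\int[leb R]_(x in `[u n, w n]) (f x)%:E)%E @[n --> \oo] --> (lb - la)%:E.
  under eq_fun do rewrite FTC.
  apply: cvg_EFin; first exact: nearW.
  apply: cvgB.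
    by have /cvg_at_leftP := Fb; apply; split => // n; rewrite wb.
  by have /cvg_at_rightP := Fa; apply; split => // n; rewrite ua.
rewrite eqU; apply: (cvg_unique _ _ cvgI) => //.
apply: ge0_nondecreasing_set_cvg_integral => //.
- move=> m n mn; rewrite subsetEset; apply: subset_itv; rewrite bnd_simp.
    by have [] := nu _ _ mn.
  by have [] := nu _ _ mn.
- move=> n; apply/measurable_EFinP; apply: subspace_continuous_measurable_fun => //.
  apply: continuous_in_subspaceT => x; rewrite inE/= in_itv/= => /andP[ux xw].
  by apply: cf; [exact: lt_le_trans ux|exact: le_lt_trans (wb n)].
- move=> n x /=; rewrite in_itv/= => /andP[ux xw]; rewrite lee_fin.
  by apply: f0; [exact: lt_le_trans ux|exact: le_lt_trans (wb n)].
Unshelve. all: by end_near. Qed.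

End IntegralPower.

Section IntegralPowerComp.
Context {R : realType}.
Variables th s : R.
Hypotheses (th0 : 0 < th) (s0 : 0 < s).

Let ths0 : 0 < th * s. Proof. by rewrite mulr_gt0. Qed.

Let powR_ths (x : R) : 0 < x -> x `^ (th * s) = x * x `^ (th * s - 1).
Proof. by move=> x0; rewrite mulr_powRB1// ltW. Qed.

Let cvg_powR0 (e : R) : 0 < e -> (fun x : R => x `^ e) @ (0 : R)^'+ --> (0 : R).
Proof. by move=> e0; exact: powR_cvg0. Qed.

(** With rho = x^th this differentiates rho^s F(rho): th x^(th s - 1) dx plays the role of rho^(s-1)
    d rho. *)
Lemma is_derive_powR_comp (F F' : R -> R) (x : R) : 0 < x ->
  is_derive (x `^ th) 1 F (F' (x `^ th)) ->
  is_derive x 1 (fun x : R => x `^ (th * s) * F (x `^ th))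
    (th * x `^ (th * s - 1) * (s * F (x `^ th) + x `^ th * F' (x `^ th))).
Proof.
move=> x0 dF.
have dx : is_derive x 1 (fun y : R => y `^ th) (th * x `^ (th - 1)).
  by eapply is_derive_eq; [derive_fun|rewrite /= mulr1].
have dFx := @is_derive_comp_fun _ F (fun y : R => y `^ th) _ _ _ dF dx.
eapply is_derive_eq; first by derive_fun.
rewrite /= mulr1 powR_ths//.
have -> : x `^ th = x * x `^ (th - 1) by rewrite mulr_powRB1// ltW.
by ring.
Qed.

Lemma integral_powR_pred :
  (\int[leb R]_(x in `]0%R, 1%R[) (th * s * x `^ (th * s - 1))%:E = 1)%E.
Proof.
have := @ge0_FTC_open _ (fun x : R => x `^ (th * s)) (fun x => th * s * x `^ (th * s - 1))
  0 1 0 1.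
rewrite subr0; apply => //.
- by move=> x x0 _; eapply is_derive_eq; [derive_fun|rewrite /= mulr1].
- move=> x x0 _.
  have := @is_derive_mul_fun _ (fun=> th * s) (fun x => x `^ (th * s - 1)) x _ _
    (is_derive_cst_fun _ _) (is_derive1_powR _ x0).
  exact: is_derive_continuous.
- by move=> x x0 _; rewrite mulr_ge0 ?powR_ge0// ltW.
- exact: cvg_powR0.
- apply: cvg_at_left_filter; have h1ths : (1 : R) `^ (th * s) = 1 by rewrite powR1.
  rewrite -[X in _ --> X]h1ths.
  exact: is_derive_continuous (is_derive1_powR (th * s) ltr01).
Qed.

Let measurable_powR_oo (e k : R) : measurable_fun (`]0%R, 1%R[%classic : set R)
  (fun x : R => k * x `^ e).
Proof.
apply: measurable_funM; first exact: measurable_cst.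
by apply: measurable_funTS; exact: measurable_powR.
Qed.

Lemma Rintegrable_powR_pred :
  (leb R).-integrable `]0, 1[ (EFin \o (fun x => th * s * x `^ (th * s - 1))).
Proof.
apply/integrableP; split; first by apply/measurable_EFinP; exact: measurable_powR_oo.
under eq_integral do rewrite /= ger0_norm ?mulr_ge0 ?powR_ge0 ?(ltW th0) ?(ltW s0)//.
by rewrite integral_powR_pred ltry.
Qed.

(** In the variable rho = x^th, rho^s F is a primitive of rho^(s-1) h that vanishes at 0 and equals
    F(1) at 1. *)
Lemma integral_powR_comp (F F' h : R -> R) :
  (forall r : R, is_derive r 1 F (F' r)) -> continuous F' ->
  (forall r, s * F r + r * F' r = h r) ->
  (leb R).-integrable `]0, 1[ (EFin \o (fun x => th * x `^ (th * s - 1) * h (x `^ th))) /\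
  \int[leb R]_(x in `]0, 1[) (th * x `^ (th * s - 1) * h (x `^ th)) = F 1.
Proof.
move=> dF cF' hE.
have cF : continuous F by move=> r; apply: is_derive_continuous; exact: dF.
have ch : continuous h.
  move=> r; rewrite -(_ : (fun r => s * F r + r * F' r) = h); last exact/funext.
  apply: cvgD; apply: cvgM => //; [exact: cvg_cst|exact: cF|exact: cF'].
have [C hC] : exists C, forall r, 0 <= r -> r <= 1 -> `|h r| <= C * s.
  have cah : {within `[0, 1], continuous (fun r => `|h r|)}.
    apply: continuous_subspaceT => r; apply: cvg_norm; exact: ch.
  have [c _ hc] := EVT_max ler01 cah.
  exists (`|h c| / s) => r r0 r1; rewrite divfK ?gt_eqF//.
  by apply: hc; rewrite in_itv/= r0.
pose g x := th * x `^ (th * s - 1) * h (x `^ th).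
pose m x := th * s * x `^ (th * s - 1).
have h1th : (1 : R) `^ th = 1 by rewrite powR1.
have h1ths : (1 : R) `^ (th * s) = 1 by rewrite powR1.
have xth (x : R) : 0 < x -> x < 1 -> 0 <= x `^ th <= 1.
  move=> x0 x1; rewrite powR_ge0/= -h1th.
  by rewrite ge0_ler_powR ?nnegrE ?ltW.
have gm (x : R) : 0 < x -> x < 1 -> `|g x| <= C * m x.
  move=> x0 x1; have /andP[y0 y1] := xth x x0 x1.
  have -> : C * m x = th * x `^ (th * s - 1) * (C * s) by rewrite /m; ring.
  have tx : 0 <= th * x `^ (th * s - 1) by rewrite mulr_ge0 ?powR_ge0// ltW.
  by rewrite /g normrM ger0_norm// ler_wpM2l// hC.
have cxp (e x : R) : 0 < x -> {for x, continuous (fun x : R => x `^ e)}.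
  by move=> x0; exact: is_derive_continuous (is_derive1_powR e x0).
have cg (x : R) : 0 < x -> {for x, continuous g}.
  move=> x0; apply: cvgM; first by apply: cvgM; [exact: cvg_cst|exact: cxp].
  apply: (@continuous_comp _ _ _ (fun x : R => x `^ th) h); first exact: cxp.
  exact: ch.
have mg : measurable_fun (`]0%R, 1%R[%classic : set R) g.
  apply: open_continuous_measurable_fun => // x; rewrite inE/= in_itv/= => /andP[x0 _].
  exact: cg.
have im : (leb R).-integrable `]0, 1[ (EFin \o m) by exact: Rintegrable_powR_pred.
have iCm : (leb R).-integrable `]0, 1[ (EFin \o (fun x => C * m x)) by exact: RintegrableZ.
have ig : (leb R).-integrable `]0, 1[ (EFin \o g).
  by apply: Rintegrable_le iCm => // x /=; rewrite in_itv/= => /andP[]; exact: gm.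
split => //.
have Im : \int[leb R]_(x in `]0, 1[) m x = 1 by rewrite /Rintegral integral_powR_pred.
(* h may change sign while [ge0_FTC_open] asks for a nonnegative integrand: C m, whose integral is
   C, dominates |g| and is subtracted afterwards. *)
have : \int[leb R]_(x in `]0, 1[) (g x + C * m x) = F 1 + C.
  rewrite /Rintegral -[RHS]/(fine (F 1 + C)%:E) -[X in _ = fine X%:E]subr0; congr fine.
  apply: (@ge0_FTC_open _ (fun x : R => x `^ (th * s) * F (x `^ th) + C * x `^ (th * s))
    (fun x => g x + C * m x) 0 1 0 (F 1 + C)) => //.
  - move=> x x0 _; have := is_derive_powR_comp x0 (dF (x `^ th)); rewrite hE => D.
    eapply is_derive_eq; first by eapply is_derive_add_fun; [exact: D|derive_fun].
    by rewrite /= mulr1 mul0r add0r /g /m; ring.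
  - move=> x x0 _; apply: cvgD; first exact: cg.
    by apply: cvgM; [exact: cvg_cst|apply: cvgM; [exact: cvg_cst|exact: cxp]].
  - by move=> x x0 x1; have := gm x x0 x1; rewrite ler_norml => /andP[]; lra.
  - rewrite -[X in _ --> X](addr0 0) -{3}(mulr0 C) -[X in X + _](mul0r (F 0)).
    apply: cvgD; last by apply: cvgM; [exact: cvg_cst|exact: cvg_powR0].
    apply: cvgM; first exact: cvg_powR0.
    apply: (cvg_comp (fun x : R => x `^ th) F); first exact: cvg_powR0.
    exact: cF.
  - apply: cvg_at_left_filter.
    have D1 := is_derive_powR_comp ltr01 (dF (1 `^ th)).
    have D2 : is_derive (1 : R) 1 (fun x : R => C * x `^ (th * s)) (C * (th * s)).
      by eapply is_derive_eq; [derive_fun|rewrite /= powR1; ring].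
    have := is_derive_continuous (is_derive_add_fun D1 D2).
    by rewrite /prop_for /continuous_at h1th h1ths mul1r mulr1.
rewrite (RintegralD _ ig iCm)// RintegralZl// Im mulr1; exact: addIr.
Qed.

End IntegralPowerComp.

(** * Lommel integrals *)

Section BesselOrthogonality.
Context {R : realType}.
Variables v th : R.
Hypotheses (v0 : 0 < v) (th0 : 0 < th).
Variables A B C : R -> R.
Hypotheses (dA : forall r : R, is_derive r 1 A (- B r))
  (dB : forall r : R, is_derive r 1 B (- C r)) (cC : continuous C)
  (recC : forall r, r * C r = (v + 1) * B r - A r).
Implicit Types (r q x : R).

Let s : R := v + 1.
Let s0 : 0 < s. Proof. by rewrite addr_gt0. Qed.

Local Notation mode_weight x := (th * x `^ (th * s - 1)).

Let dM q : forall x, is_derive x 1 (fun x : R => q * x) q.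
Proof. by move=> x; eapply is_derive_eq; [derive_fun|rewrite /=; ring]. Qed.

Let cA : continuous A. Proof. by move=> x; apply: is_derive_continuous; exact: dA. Qed.
Let cB : continuous B. Proof. by move=> x; apply: is_derive_continuous; exact: dB. Qed.

Let ccomp (f : R -> R) q : continuous f -> continuous (fun x => f (q * x)).
Proof.
move=> cf x; apply: (@continuous_comp _ _ _ (fun x => q * x) f); last exact: cf.
by apply: is_derive_continuous; exact: dM.
Qed.

(** rho^(v+1) B(r rho) is a primitive of rho^v A(r rho), and its value at 1 is B(r). *)
Lemma integral_bessel_const r : B r = 0 ->
  (leb R).-integrable `]0, 1[ (EFin \o (fun x => mode_weight x * A (r * x `^ th))) /\
  \int[leb R]_(x in `]0, 1[) (mode_weight x * A (r * x `^ th)) = 0.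
Proof.
move=> Br.
have := @integral_powR_comp _ th s th0 s0 (fun x => B (r * x))
  (fun x => - C (r * x) * r) (fun x => A (r * x)).
rewrite mulr1 Br; apply.
- by move=> x; exact: (is_derive_comp_fun (dB _) (dM r x)).
- by move=> x; apply: cvgM; [apply: cvgN; exact: ccomp|exact: cvg_cst].
- move=> x; have -> : x * (- C (r * x) * r) = - ((r * x) * C (r * x)) by ring.
  by rewrite recC /s; ring.
Qed.

(** F is the Wronskian of A(r rho) and A(q rho) divided by r - q; at rho = 1 each of its terms
    contains B(r) or B(q). *)
Lemma integral_bessel_neq r q : r != q -> B r = 0 -> B q = 0 ->
  (leb R).-integrable `]0, 1[
    (EFin \o (fun x => mode_weight x * (A (r * x `^ th) * A (q * x `^ th)))) /\
  \int[leb R]_(x in `]0, 1[) (mode_weight x * (A (r * x `^ th) * A (q * x `^ th))) = 0.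
Proof.
move=> rq Br Bq; have rq0 : r - q != 0 by rewrite subr_eq0.
pose F x := (r * B (r * x) * A (q * x) - q * A (r * x) * B (q * x)) / (r - q).
pose F' x := (r * (- C (r * x) * r) * A (q * x) - q * A (r * x) * (- C (q * x) * q)) / (r - q).
have := @integral_powR_comp _ th s th0 s0 F F' (fun x => A (r * x) * A (q * x)).
have -> : F 1 = 0 by rewrite /F !mulr1 Br Bq; ring.
apply.
- move=> x.
  have d1 := is_derive_comp_fun (dA _) (dM r x); have d2 := is_derive_comp_fun (dA _) (dM q x).
  have d3 := is_derive_comp_fun (dB _) (dM r x); have d4 := is_derive_comp_fun (dB _) (dM q x).
  rewrite /F; eapply is_derive_eq.
    derive_fun.
  by rewrite /= /F'; ring.
- move=> x; apply: cvgM; last exact: cvg_cst.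
  have c1 := ccomp (q:=r) cA; have c2 := ccomp (q:=q) cA.
  have c3 := ccomp (q:=r) cC; have c4 := ccomp (q:=q) cC.
  apply: cvgB; (apply: cvgM; [apply: cvgM; first exact: cvg_cst|]).
  + by apply: cvgM; [apply: cvgN; exact: c3|exact: cvg_cst].
  + exact: c2.
  + exact: c1.
  + by apply: cvgM; [apply: cvgN; exact: c4|exact: cvg_cst].
- move=> x; rewrite /F /F' /s; have h1 := recC (r * x); have h2 := recC (q * x).
  move: h1 h2; move: (A (r * x)) (A (q * x)) (B (r * x)) (B (q * x)) (C (r * x)) (C (q * x)).
  move=> a1 a2 b1 b2 c1 c2 h1 h2.
  have -> : (v + 1) * ((r * b1 * a2 - q * a1 * b2) / (r - q)) +
   x * ((r * (- c1 * r) * a2 - q * a1 * (- c2 * q)) / (r - q)) =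
   ((v + 1) * (r * b1 * a2 - q * a1 * b2) - r * a2 * (r * x * c1) + q * a1 * (q * x * c2))
     / (r - q).
    by field.
  by rewrite h1 h2; field.
Qed.

(** The confluent case q = r of the previous integral. The primitive is built on N - v A B, of which
    only A(r)^2 survives at rho = 1. *)
Lemma integral_bessel_sq r : B r = 0 ->
  (leb R).-integrable `]0, 1[ (EFin \o (fun x => mode_weight x * A (r * x `^ th) ^+ 2)) /\
  \int[leb R]_(x in `]0, 1[) (mode_weight x * A (r * x `^ th) ^+ 2) = A r ^+ 2.
Proof.
move=> Br.
pose F x := bessel_sq A B (r * x) - v * (A (r * x) * B (r * x)).
pose F' x := - (2 * v + 1) * B (r * x) ^+ 2 * r -
  v * (- B (r * x) * r * B (r * x) + A (r * x) * (- C (r * x) * r)).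
have := @integral_powR_comp _ th s th0 s0 F F' (fun x => A (r * x) ^+ 2).
have -> : F 1 = A r ^+ 2 by rewrite /F /bessel_sq !mulr1 Br; ring.
apply.
- move=> x.
  have d1 := is_derive_comp_fun (dA _) (dM r x).
  have d2 := is_derive_comp_fun (dB _) (dM r x).
  have d3 := is_derive_comp_fun (is_derive_bessel_sq dA dB recC _) (dM r x).
  rewrite /F; eapply is_derive_eq.
    derive_fun.
  by rewrite /= /F'; ring.
- move=> x.
  have c1 : {for x, continuous (fun x => A (r * x))} by exact: ccomp.
  have c2 : {for x, continuous (fun x => B (r * x))} by exact: ccomp.
  have c3 : {for x, continuous (fun x => C (r * x))} by exact: ccomp.
  apply: cvgB.
    apply: cvgM; last exact: cvg_cst.
    by apply: cvgM; [exact: cvg_cst|apply: cvgM; exact: c2].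
  apply: cvgM; first exact: cvg_cst.
  apply: cvgD.
    apply: cvgM; last exact: c2.
    by apply: cvgM; [apply: cvgN; exact: c2|exact: cvg_cst].
  apply: cvgM; first exact: c1.
  by apply: cvgM; [apply: cvgN; exact: c3|exact: cvg_cst].
- move=> x; rewrite /F /F' /s /bessel_sq; have h := recC (r * x).
  move: h; move: (A (r * x)) (B (r * x)) (C (r * x)) => a b c h.
  have -> : (v + 1) * (a ^+ 2 + r * x * b ^+ 2 - v * (a * b)) +
    x * (- (2 * v + 1) * b ^+ 2 * r - v * (- b * r * b + a * (- c * r))) =
    (v + 1) * (a ^+ 2 + r * x * b ^+ 2 - v * (a * b)) +
    x * (- (2 * v + 1) * b ^+ 2 * r + v * b ^+ 2 * r) + v * a * (r * x * c) by ring.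
  by rewrite h; ring.
Qed.

End BesselOrthogonality.

(** * Fourier-Bessel modes *)

Local Opaque Gamma besselG bessel_coef.

Lemma is_cvg_series_shift1 (R : realType) (f : nat -> R) :
  cvgn (series (fun n => f n.+1)) -> cvgn (series f).
Proof.
move=> cf; apply/cvg_ex; exists (f 0%N + limn (series (fun n => f n.+1))).
rewrite -cvg_shiftS (_ : (fun n => _) = (fun n => f 0%N + series (fun n => f n.+1) n)).
  by apply: cvgD; [exact: cvg_cst|exact: cf].
by apply/funext => n; rewrite /series/= big_nat_recl.
Qed.

Section Modes.
Context {R : realType}.
Variables (alpha beta mu s : R) (j : nat -> R).
Hypotheses (alpha_lt2 : alpha < 2) (mu_lt : mu < mucrit (alpha + beta))
  (j_zeros : positive_zeros (besselJ (nu alpha beta mu + 1)) j)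
  (s_gt : nu alpha beta mu < s).
Implicit Types (x r : R) (k : nat).

Local Notation kap := (kappa alpha).
Local Notation v := (nu alpha beta mu).
Local Notation a := (expa alpha beta mu).
Local Notation A := (besselG v).
Local Notation B := (besselG (v + 1)).
Local Notation C := (besselG (v + 1 + 1)).
Local Notation r_ k := (j k ^+ 2 / 4).
Local Notation w := (spectral_weight alpha j s).

Lemma kappa_gt0 : 0 < kap.
Proof. by rewrite /kappa divr_gt0// subr_gt0. Qed.

Lemma nu_gt0 : 0 < v.
Proof. by rewrite /nu divr_gt0 ?kappa_gt0// sqrtr_gt0 subr_gt0. Qed.

Let v0 := nu_gt0.
Let v10 : 0 < v + 1. Proof. by rewrite addr_gt0. Qed.
Let dA r : is_derive r 1 A (- B r). Proof. exact: is_derive_besselG. Qed.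
Let dB r : is_derive r 1 B (- C r). Proof. exact: is_derive_besselG. Qed.
Let recC r : r * C r = (v + 1) * B r - A r. Proof. exact: besselG_rec. Qed.
Let A0 : 0 < A 0.
Proof. by rewrite besselG0// invr_gt0 Gamma_gt0// ltrDr. Qed.
Let cA : continuous A.
Proof. by move=> r; apply: is_derive_continuous; exact: dA. Qed.
Let cC : continuous C.
Proof.
move=> r; apply: is_derive_continuous; apply: is_derive_besselG.
by rewrite addr_gt0.
Qed.

(** x^(kap v) is the leading power of J_v(j x^kap) at 0, so x^a exactly compensates the behaviour of
    every mode there. *)
Lemma expaE : - a = (1 - alpha - beta) / 2 + kap * v.
Proof.
rewrite /nu /expa; have k0 := kappa_gt0.
by move: (Num.sqrt _) => q; field; rewrite gt_eqF.
Qed.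

Lemma zero_gt0 k : 0 < j k.
Proof.
have [_ rj] := j_zeros; have : range j (j k) by exists k.
by rewrite rj => -[].
Qed.

Lemma besselJ_eq0 y : 0 < y -> besselJ (v + 1) y = 0 <-> B (y ^+ 2 / 4) = 0.
Proof.
move=> y0; rewrite besselJE//; split => [/eqP|->]; last by rewrite mulr0.
by rewrite mulf_eq0 gt_eqF ?powR_gt0 ?divr_gt0//= => /eqP.
Qed.

Lemma besselG_zero k : B (r_ k) = 0.
Proof.
apply: (besselJ_eq0 (zero_gt0 k)).1.
have [_ rj] := j_zeros; have : range j (j k) by exists k.
by rewrite rj => -[].
Qed.

Let r0 k : 0 < r_ k. Proof. by rewrite divr_gt0// exprn_gt0// zero_gt0. Qed.

(** Ensures that the normalisation of [Phi] divides by a nonzero number rather than using the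
    default inverse of 0. *)
Lemma besselG_at_zero_neq0 k : A (r_ k) != 0.
Proof.
apply/eqP => Ar; have := bessel_sq_gt0 v0 dA dB recC A0 (r0 k).
by rewrite /bessel_sq Ar besselG_zero expr0n/= mulr0 addr0 ltxx.
Qed.

(** A zero strictly between would be some j l by the enumeration, with k < l < k + 1 by
    monotonicity; so the Sturm bound applies to neighbouring values of j. *)
Lemma zero_step k : 1 <= j k.+1 - j k.
Proof.
have [hj rj] := j_zeros.
have jk : j k < j k.+1 by exact: hj.
apply: (bessel_zero_gap v0 dA dB recC A0 (zero_gt0 k) jk); try exact: besselG_zero.
move=> y jy yj; apply/eqP => By.
have y0 : 0 < y by apply: lt_trans jy; exact: zero_gt0.
have [l _ jl] : range j y by rewrite rj; split => //; exact: (besselJ_eq0 y0).2.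
have lt_of m n : j m < j n -> (m < n)%N.
  move=> mn; rewrite ltnNge; apply/negP; rewrite leq_eqVlt => /predU1P[nm|/hj].
    by move: mn; rewrite nm ltxx.
  by move=> /(lt_trans mn); rewrite ltxx.
rewrite -jl in jy yj; have := lt_of _ _ jy; have := lt_of _ _ yj.
by rewrite ltnS => h1 h2; have := leq_trans h2 h1; rewrite ltnn.
Qed.

Lemma zero_ge : exists2 m, 0 < m & forall k, m * k.+1%:R <= j k.
Proof.
exists (Num.min 1 (j 0%N)); first by rewrite lt_min ltr01 zero_gt0.
elim=> [|k IH]; first by rewrite mulr1 ge_min lexx orbT.
rewrite -natr1 mulrDr mulr1; have := zero_step k.
have : Num.min 1 (j 0%N) <= 1 by rewrite ge_min lexx.
lra.
Qed.

Lemma lam_ge0 k : 0 <= lam alpha j k.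
Proof. by case: k => [|k] //=; rewrite mulr_ge0 ?sqr_ge0. Qed.

Lemma spectral_weight_gt0 k : 0 < w k.
Proof.
rewrite /spectral_weight; case: k => [|k] //=.
by rewrite powR_gt0// mulr_gt0 ?exprn_gt0 ?kappa_gt0 ?zero_gt0.
Qed.

(* [mode k] is [x^a Phi k] written in the variable [rho = x^(2 kappa)], and [trace k] its
   value at 0. *)
Definition mode k (rho : R) : R := match k with
  | 0%N => Num.sqrt (2 * (v + 1) * kap)
  | k'.+1 => Num.sqrt (2 * kap) / `|A (r_ k')| * A (r_ k' * rho)
  end.

Definition trace k : R := mode k 0.

(** The factor (j/2)^v of the Bessel function cancels against the one in |J_v(j)|, and x^(kap v)
    turns the prefactor into x^(-a). *)
Lemma PhiE k x : 0 < x -> Phi alpha beta mu j k x = x `^ (- a) * mode k (x `^ (2 * kap)).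
Proof.
move=> x0; case: k => [|k] /=; first by rewrite mulrC.
have j0 := zero_gt0 k; have k0 := kappa_gt0.
have jx : 0 < j k * x `^ kap by rewrite mulr_gt0// powR_gt0.
rewrite !besselJE// expaE.
have -> : (j k * x `^ kap) ^+ 2 / 4 = r_ k * x `^ (2 * kap).
  have -> : x `^ (2 * kap) = (x `^ kap) ^+ 2.
    by rewrite mulrC powRrM powR_mulrn// powR_ge0.
  by rewrite exprMn; ring.
have -> : (j k * x `^ kap / 2) `^ v = (j k / 2) `^ v * x `^ (kap * v).
  have jk2 : 0 <= j k / 2 by rewrite divr_ge0// ltW.
  rewrite (_ : j k * x `^ kap / 2 = j k / 2 * x `^ kap); last by ring.
  by rewrite [LHS]powRM ?powR_ge0// -powRrM.
rewrite powRD; last by rewrite (gt_eqF x0) implybT.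
have q0 : 0 < (j k / 2) `^ v by rewrite powR_gt0// divr_gt0.
rewrite normrM (gtr0_norm q0).
have n0 : `|A (r_ k)| != 0 by rewrite normr_eq0 besselG_at_zero_neq0.
move: (A _) (A _) n0 (Num.sqrt _) ((j k / 2) `^ v) q0 => g h n0 q t t0.
by field; rewrite n0 gt_eqF.
Qed.

(** By [besselG_le] a mode is largest at rho = 0, so its trace is also its uniform bound. *)
Lemma mode_le k rho : 0 <= rho -> `|mode k rho| <= trace k.
Proof.
move=> rho0; rewrite /trace; case: k => [|k] /=; first by rewrite ger0_norm ?sqrtr_ge0.
rewrite mulr0 normrM ger0_norm ?divr_ge0 ?sqrtr_ge0//.
rewrite ler_wpM2l ?divr_ge0 ?sqrtr_ge0//.
by apply: (besselG_le v0 dA dB recC A0); rewrite mulr_ge0// ltW.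
Qed.

Lemma trace_ge0 k : 0 <= trace k.
Proof. exact: le_trans (mode_le k (lexx 0)). Qed.

Lemma continuous_mode k : continuous (mode k).
Proof.
case: k => [|k] rho; first exact: cst_continuous.
apply: cvgM; first exact: cvg_cst.
apply: (@continuous_comp _ _ _ (fun x => r_ k * x) A); last exact: cA.
by apply: is_derive_continuous; derive_fun.
Qed.

Lemma powR_expa_Phi k x : 0 < x ->
  x `^ a * Phi alpha beta mu j k x = mode k (x `^ (2 * kap)).
Proof.
move=> x0; rewrite PhiE// mulrA -powRD ?subrr ?powRr0 ?mul1r//.
by rewrite (gt_eqF x0) implybT.
Qed.

Lemma cvg_powR_expa_Phi k :
  x `^ a * Phi alpha beta mu j k x @[x --> 0^'+] --> trace k.
Proof.
apply: (@cvg_trans _ (mode k (x `^ (2 * kap)) @[x --> 0^'+])).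
  apply: near_eq_cvg; near=> x; rewrite powR_expa_Phi//.
apply: (cvg_comp (fun x : R => x `^ (2 * kap)) (mode k)); last exact: continuous_mode.
by apply: powR_cvg0; rewrite mulr_gt0 ?kappa_gt0.
Unshelve. all: by end_near. Qed.

Lemma powR_expa_Phi_le k x : 0 < x ->
  `|x `^ a * Phi alpha beta mu j k x| <= trace k.
Proof. by move=> x0; rewrite powR_expa_Phi// mode_le// powR_ge0. Qed.

Lemma measurable_Phi k : measurable_fun (`]0%R, 1%R[%classic : set R) (Phi alpha beta mu j k).
Proof.
apply: (@eq_measurable_fun _ _ _ _ _ (fun x => x `^ (- a) * mode k (x `^ (2 * kap)))).
  by move=> x; rewrite inE/= in_itv/= => /andP[x0 _]; rewrite PhiE.
apply: measurable_funTS; apply: measurable_funM; first exact: measurable_powR.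
apply: (measurableT_comp (f := mode k)); last exact: measurable_powR.
by apply: continuous_measurable_fun; exact: continuous_mode.
Qed.

(** The exponent is that of rho^v d rho for rho = x^(2 kap). Being above -1, it also places x^(-a)
    in L^2_beta. *)
Lemma weightE x : 0 < x ->
  (x `^ (- a)) ^+ 2 * weight beta x = x `^ (2 * kap * (v + 1) - 1).
Proof.
move=> x0; rewrite /weight -powR_mulrn ?powR_ge0// -powRrM -powRD.
  by rewrite expaE /kappa; congr (_ `^ _); field.
by rewrite (gt_eqF x0) implybT.
Qed.

Let th0 : 0 < 2 * kap. Proof. by rewrite mulr_gt0 ?kappa_gt0. Qed.

Lemma Rintegrable_weight : (leb R).-integrable `]0, 1[
  (EFin \o (fun x => (x `^ (- a)) ^+ 2 * weight beta x)).
Proof.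
have I : (leb R).-integrable `]0, 1[ (EFin \o (fun x =>
    (2 * kap * (v + 1))^-1 * (2 * kap * (v + 1) * x `^ (2 * kap * (v + 1) - 1)))).
  by apply: RintegrableZ => //; exact: Rintegrable_powR_pred.
apply: (eq_Rintegrable _ _ I) => // x; rewrite /= in_itv/= => /andP[x0 _].
by rewrite weightE// mulrA mulVf ?mul1r// gt_eqF// mulr_gt0.
Qed.

(** In the variable rho the products of modes reduce to a pure power and to the three Lommel
    integrals; for equal modes the value A(r)^2 is what the normalisation divides by. *)
Lemma Phi_orthonormal k l :
  L2dot (weight beta) 1 (Phi alpha beta mu j k) (Phi alpha beta mu j l) = (k == l)%:R.
Proof.
have E : L2dot (weight beta) 1 (Phi alpha beta mu j k) (Phi alpha beta mu j l) =
    \int[leb R]_(x in `]0, 1[) (2 * kap * x `^ (2 * kap * (v + 1) - 1) *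
      (mode k (x `^ (2 * kap)) * mode l (x `^ (2 * kap)) / (2 * kap))).
  apply: eq_Rintegral => x; rewrite inE/= in_itv/= => /andP[x0 _].
  rewrite !PhiE// -weightE//; move: (mode _ _) (mode _ _) (_ `^ _) (weight _ _) => p q t u.
  by field; rewrite gt_eqF// kappa_gt0.
have zneq m n : m != n -> r_ m != r_ n.
  move=> mn; apply/eqP => rmn.
  have : j m ^+ 2 = j n ^+ 2 by apply: (mulIf (x := 4^-1)).
  move=> /eqP; rewrite eqrXn2 ?ltW ?zero_gt0// => /eqP jmn.
  have [hj _] := j_zeros; move: mn; rewrite neq_ltn => /orP[] /hj; rewrite jmn ltxx//.
have k0 := kappa_gt0.
have Z (K : R) (f g : R -> R) (I : R) : (forall x, 0 < x -> g x = K * f x) ->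
    (leb R).-integrable `]0, 1[ (EFin \o f) -> \int[leb R]_(x in `]0, 1[) f x = I ->
    \int[leb R]_(x in `]0, 1[) g x = K * I.
  move=> gf If <-; rewrite -RintegralZl//.
  by apply: eq_Rintegral => x; rewrite inE/= in_itv/= => /andP[x0 _]; rewrite gf.
have cE : Num.sqrt (2 * kap) ^+ 2 = 2 * kap by rewrite sqr_sqrtr// ltW.
have key (q n Y t : R) : q ^+ 2 = 2 * kap -> n != 0 ->
    2 * kap * t * (q / n * Y * (q / n * Y) / (2 * kap)) = n ^- 2 * (2 * kap * t * Y ^+ 2).
  move=> qE n0; have k20 : 2 * kap != 0 by rewrite gt_eqF.
  by rewrite -qE in k20 *; field; rewrite n0 -sqrf_eq0 k20.
rewrite {}E; case: k l => [|k] [|l] /=.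
- rewrite -[RHS](mul1r 1); apply: (Z _ _ _ _ _ (Rintegrable_powR_pred th0 v10)).
    move=> x x0; rewrite mul1r -expr2 sqr_sqrtr; last first.
      by apply: mulr_ge0; [apply: mulr_ge0 => //|]; exact: ltW.
    by field; rewrite gt_eqF.
  by rewrite /Rintegral integral_powR_pred.
- have [I1 I2] := integral_bessel_const v0 th0 dB cC recC (besselG_zero l).
  rewrite -[RHS](mulr0 (Num.sqrt (2 * (v + 1) * kap) * (Num.sqrt (2 * kap) / `|A (r_ l)|) /
    (2 * kap))).
  by apply: (Z _ _ _ _ _ I1 I2) => x x0; move: (Num.sqrt _) (Num.sqrt _) (A _) (`|_|^-1) =>
    ? ? ? ?; ring.
- have [I1 I2] := integral_bessel_const v0 th0 dB cC recC (besselG_zero k).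
  rewrite -[RHS](mulr0 (Num.sqrt (2 * (v + 1) * kap) * (Num.sqrt (2 * kap) / `|A (r_ k)|) /
    (2 * kap))).
  by apply: (Z _ _ _ _ _ I1 I2) => x x0; move: (Num.sqrt _) (Num.sqrt _) (A _) (`|_|^-1) =>
    ? ? ? ?; ring.
- rewrite eqSS; have [->|kl] := eqVneq k l.
    have [I1 I2] := integral_bessel_sq v0 th0 dA dB cC recC (besselG_zero l).
    have n2 : `|A (r_ l)| ^+ 2 = A (r_ l) ^+ 2 by rewrite real_normK ?num_real.
    have nA : A (r_ l) != 0 by exact: besselG_at_zero_neq0.
    rewrite (Z (A (r_ l) ^- 2) _ _ _ _ I1 I2); first by rewrite mulVf// sqrf_eq0.
    have n0 : `|A (r_ l)| != 0 by rewrite normr_eq0.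
    by move=> x x0; rewrite -n2; exact: key.
  have [I1 I2] := integral_bessel_neq v0 th0 dA dB cC recC (zneq _ _ kl) (besselG_zero k)
    (besselG_zero l).
  rewrite -[RHS](mulr0 ((Num.sqrt (2 * kap) / `|A (r_ k)|) * (Num.sqrt (2 * kap) / `|A (r_
    l)|) / (2 * kap))).
  apply: (Z _ _ _ _ _ I1 I2) => x x0.
  by move: (Num.sqrt _) (A _) (A _) (`|_|^-1) (`|_|^-1) => ? ? ? ? ?; ring.
Qed.

(** Apart from the constant mode, the numerator is O(J^(2v+1)) at the zero J by
    [besselG_at_zero_ge], and the denominator is at least a multiple of J^(2s+2). The quotient is
    O(J^(-1-e)) with e = 2 (s - v) > 0, and the zeros grow at least linearly. *)
Lemma is_cvg_trace : cvgn (series (fun k => trace k ^+ 2 / (w k * (1 + lam alpha j k)))).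
Proof.
(* The constant mode has lam = 0 and is set aside, so that 1 + lam may be bounded below by lam. *)
apply: is_cvg_series_shift1.
have [m m0 jm] := zero_ge.
have [c c0 hc] := besselG_at_zero_ge v0 dA dB recC A0 (r0 0).
pose e := 2 * (s - v); have e0 : 0 < e by rewrite mulr_gt0// subr_gt0.
pose K1 := 2 * kap * A 0 ^+ 2 / c / (2 `^ (2 * v + 1)) / (kap ^+ 2) `^ s / kap ^+ 2.
pose K := K1 * m `^ (- (1 + e)).
have s0 : 0 < s by exact: lt_trans s_gt.
have k0 := kappa_gt0.
have K10 : 0 <= K1.
  have kk : 0 <= kap ^+ 2 by exact: sqr_ge0.
  have AA : 0 <= 2 * kap * A 0 ^+ 2 by rewrite mulr_ge0 ?sqr_ge0// ltW.
  rewrite /K1.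
  apply: divr_ge0 => //; apply: divr_ge0; last exact: powR_ge0.
  apply: divr_ge0; last exact: powR_ge0.
  by apply: divr_ge0 => //; exact: ltW.
apply: (@series_le_cvg _ _ (fun k => K * k.+1%:R `^ (- (1 + e)))).
- by move=> k; rewrite divr_ge0 ?sqr_ge0// mulr_ge0 ?addr_ge0 ?lam_ge0// ltW//
    spectral_weight_gt0.
- by move=> k; apply: mulr_ge0; [apply: mulr_ge0 => //|]; exact: powR_ge0.
- move=> k; rewrite /trace /= /spectral_weight/= mulr0.
  have j0 := zero_gt0 k.
  have nA := besselG_at_zero_neq0 k.
  have rk0 : r_ 0 <= r_ k.
    have [hj _] := j_zeros.
    rewrite ler_pM2r// ler_pXn2r ?nnegrE ?(ltW (zero_gt0 _))//.
    by case: k {j0 nA} => [|k]; [exact: lexx|apply/ltW/hj].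
  have hA := hc _ rk0 (besselG_zero k).
  have A2 : 0 < A (r_ k) ^+ 2 by rewrite lt_neqAle sqr_ge0 eq_sym sqrf_eq0 nA.
  have rE : (r_ k) `^ (v + 2^-1) = j k `^ (2 * v + 1) / 2 `^ (2 * v + 1).
    have -> : r_ k = (j k / 2) `^ 2 by rewrite powR_mulrn ?divr_ge0 ?ltW//; field.
    rewrite -powRrM (_ : 2 * (v + 2^-1) = 2 * v + 1); last by field.
    rewrite powRM ?invr_ge0 ?(ltW j0)//; congr (_ * _).
    by rewrite -[X in X `^ _]powR_inv1// -powRrM mulN1r powRN.
  set J := j k; pose q := J `^ (- (1 + e)).
  have jE : J `^ (2 * v + 1) / (J ^+ 2) `^ s / J ^+ 2 = q.
    rewrite -!(powR_mulrn 2) ?ltW// -powRrM -!powRN -!powRD /q ?(gt_eqF j0) ?implybT//.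
    by congr (_ `^ _); rewrite /e; ring.
  have qm : q <= m `^ (- (1 + e)) * k.+1%:R `^ (- (1 + e)).
    rewrite /q !powRN -invfM -powRM ?(ltW m0) ?ler0n//.
    rewrite lef_pV2 ?posrE ?powR_gt0 ?mulr_gt0//.
    apply: ge0_ler_powR; rewrite ?nnegrE ?jm ?(ltW j0)//; first by rewrite addr_ge0// ltW.
    by rewrite mulr_ge0// ltW.
  have -> : (Num.sqrt (2 * kap) / `|A (r_ k)| * A 0) ^+ 2 = 2 * kap * A 0 ^+ 2 / A (r_ k) ^+ 2.
    rewrite !exprMn exprVn real_normK ?num_real// sqr_sqrtr; first by ring.
    by rewrite mulr_ge0// ltW.
  have L : 2 * kap * A 0 ^+ 2 / A (r_ k) ^+ 2 <= 2 * kap * A 0 ^+ 2 / c * (J `^ (2 * v + 1)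
    / 2 `^ (2 * v + 1)).
    rewrite -rE -[leRHS]mulrA; apply: ler_wpM2l.
      by apply: mulr_ge0; [exact: ltW|exact: sqr_ge0].
    by rewrite -[leLHS]mul1r ler_pdivrMr// -mulrA ler_pdivlMl// mulr1.
  have l0 : 0 < kap ^+ 2 * J ^+ 2 by rewrite mulr_gt0 ?exprn_gt0.
  have d0 : 0 < (kap ^+ 2 * J ^+ 2) `^ s by rewrite powR_gt0.
  apply: (@le_trans _ _ (2 * kap * A 0 ^+ 2 / c * (J `^ (2 * v + 1) / 2 `^ (2 * v + 1)) /
    ((kap ^+ 2 * J ^+ 2) `^ s * (kap ^+ 2 * J ^+ 2)))).
    apply: ler_pM => //.
    - by apply: divr_ge0; [apply: mulr_ge0; [exact: ltW|exact: sqr_ge0]|exact: ltW].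
    - rewrite invr_ge0; apply: mulr_ge0; first exact: powR_ge0.
      by apply: addr_ge0 => //; exact: ltW.
    - have p1 : 0 < 1 + kap ^+ 2 * J ^+ 2 by rewrite ltr_wpDl.
      rewrite lef_pV2; [|rewrite posrE; exact: mulr_gt0..].
      by rewrite ler_pM2l// lerDr.
  rewrite powRM ?sqr_ge0//.
  apply: (@le_trans _ _ (K1 * q)).
    rewrite -jE le_eqVlt; apply/orP; left; apply/eqP.
    rewrite /K1 !invfM; move: ((kap ^+ 2)`^ s)^-1 ((J ^+ 2)`^ s)^-1 => ? ?.
    by ring.
  by rewrite /K -(mulrA K1) ler_wpM2l.
- exact/cvgP/cvg_seriesZ/is_cvg_series_powR.
Qed.

End Modes.

(** * Series *)

Section SeriesTools.
Context {R : realType}.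
Implicit Types (f g a d w : nat -> R) (c x y t X Y : R).

(** Turns a family of Young inequalities into a Cauchy-Schwarz inequality, for sums and integrals
    alike; the optimum is t = sqrt Y / sqrt X. *)
Lemma le_sqrt_of_AMGM c X Y : 0 <= X -> 0 <= Y ->
  (forall t, 0 < t -> c <= (t * X + Y / t) / 2) -> c <= Num.sqrt X * Num.sqrt Y.
Proof.
move=> X0 Y0 h; have x0 := sqrtr_ge0 X; have y0 := sqrtr_ge0 Y.
rewrite -(sqr_sqrtr X0) -(sqr_sqrtr Y0) in h.
move: (Num.sqrt X) (Num.sqrt Y) x0 y0 h => x y x0 y0 h.
apply/ler_addgt0Pr => e e0.
(* The optimum y / x is replaced by (y + q) / (x + q), positive even when x or y is 0; the loss q (x
   + y) / 2 stays below e. *)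
pose q := e / (x + y + 1).
have xy1 : 0 < x + y + 1 by rewrite ltr_wpDl// addr_ge0.
have q0 : 0 < q by rewrite divr_gt0.
have xq : 0 < x + q by rewrite ltr_wpDl.
have yq : 0 < y + q by rewrite ltr_wpDl.
apply: (le_trans (h ((y + q) / (x + q)) _)); first by rewrite divr_gt0.
rewrite invf_div.
have h1 : (y + q) / (x + q) * x ^+ 2 <= (y + q) * x.
  rewrite mulrAC ler_pdivrMr// -mulrA ler_wpM2l ?(ltW yq)// expr2 ler_wpM2l//.
  by rewrite lerDl ltW.
have h2 : y ^+ 2 * ((x + q) / (y + q)) <= y * (x + q).
  rewrite mulrA ler_pdivrMr// expr2 -!mulrA ler_wpM2l// mulrC ler_wpM2l ?(ltW xq)//.
  by rewrite lerDl ltW.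
have h3 : q * (x + y) <= e.
  rewrite /q mulrAC ler_pdivrMr// ler_wpM2l ?(ltW e0)//.
  by rewrite lerDl.
by move: h1 h2 h3; lra.
Qed.

Lemma cvg_series_abs f : cvgn (series (fun k => `|f k|)) -> cvgn (series f).
Proof. by move=> h; exact: normed_cvg. Qed.

Lemma le_cvg_series_abs f g : (forall k, `|f k| <= g k) -> cvgn (series g) ->
  cvgn (series (fun k => `|f k|)).
Proof. by move=> fg; apply: series_le_cvg => // k; exact: le_trans (fg k). Qed.

Lemma le_cvg_series f g : (forall k, `|f k| <= g k) -> cvgn (series g) ->
  cvgn (series f).
Proof. by move=> fg cg; apply: cvg_series_abs; exact: le_cvg_series_abs cg. Qed.

Lemma is_cvg_seriesZ_fun c f : cvgn (series f) -> cvgn (series (fun k => c * f k)).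
Proof. by move=> /(cvg_seriesZ c) /cvgP. Qed.

Lemma is_cvg_seriesD_fun f g : cvgn (series f) -> cvgn (series g) ->
  cvgn (series (fun k => f k + g k)).
Proof. by move=> cf cg; apply/cvg_ex; eexists; exact: cvg_seriesD cf cg. Qed.

Lemma lim_seriesZ_fun c f : cvgn (series f) ->
  limn (series (fun k => c * f k)) = c * limn (series f).
Proof. by move=> /(cvg_seriesZ c)/cvg_lim; apply. Qed.

Lemma lim_seriesD_fun f g : cvgn (series f) -> cvgn (series g) ->
  limn (series (fun k => f k + g k)) = limn (series f) + limn (series g).
Proof. by move=> cf cg; apply/cvg_lim => //; exact: cvg_seriesD. Qed.

Lemma series_ge0_le_lim f n : (forall k, 0 <= f k) -> cvgn (series f) ->
  series f n <= limn (series f).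
Proof.
move=> f0 cf; apply: nondecreasing_cvgn_le => //.
by apply: nondecreasing_series => k _ _; exact: f0.
Qed.

Lemma lim_series_ge0 f : (forall k, 0 <= f k) -> cvgn (series f) ->
  0 <= limn (series f).
Proof.
by move=> f0 cf; have := series_ge0_le_lim 0 f0 cf; rewrite /series/= big_geq.
Qed.

Lemma lim_series_le_fun f g : cvgn (series f) -> cvgn (series g) ->
  (forall k, f k <= g k) -> limn (series f) <= limn (series g).
Proof. exact: lim_series_le. Qed.

Lemma ge0_series_bounded_cvg f c : (forall k, 0 <= f k) ->
  (forall n, series f n <= c) -> cvgn (series f).
Proof.
move=> f0 fc; apply: nondecreasing_is_cvgn.
  by apply: nondecreasing_series => k _ _; exact: f0.
by exists c => _ [n _ <-].
Qed.

Lemma abs_lim_series_le f : cvgn (series (fun k => `|f k|)) ->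
  `|limn (series f)| <= limn (series (fun k => `|f k|)).
Proof. exact: lim_series_norm. Qed.

Lemma cvg_series_tail g n : cvgn (series g) ->
  series (fun k => if (k < n)%N then 0 else g k) @ \oo --> limn (series g) - series g n.
Proof.
move=> cg; pose h k := if (k < n)%N then 0 else g k.
have E m : series h (m + n)%N = series g (m + n)%N - series g n.
  elim: m => [|m IH].
    rewrite add0n subrr /series/= big_nat big1// => k /andP[_ kn].
    by rewrite /h kn.
  rewrite addSn; have S u i : series u i.+1 = series u i + u i :> R by rewrite seriesSr.
  by rewrite !S IH {1}/h ltnNge leq_addl/=; ring.
rewrite -(cvg_shiftn n); rewrite (_ : (fun m => _) = (fun m => series g (m + n)%N - series
  g n)).
  by apply: cvgB; [rewrite (cvg_shiftn n (series g))|exact: cvg_cst].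
exact/funext.
Qed.

Lemma lim_series_tail g n : cvgn (series g) ->
  limn (series (fun k => if (k < n)%N then 0 else g k)) = limn (series g) - series g n.
Proof. by move=> /(cvg_series_tail (n := n))/cvg_lim; apply. Qed.

Lemma series_tail_le f g n : (forall k, `|f k| <= g k) -> cvgn (series g) ->
  `|limn (series f) - series f n| <= limn (series g) - series g n.
Proof.
move=> fg cg; have cf := le_cvg_series fg cg.
rewrite -!lim_series_tail//.
have cgn := cvgP _ (cvg_series_tail (n := n) cg).
have h k : `|if (k < n)%N then 0 else f k| <= if (k < n)%N then 0 else g k.
  by case: ifP; rewrite ?normr0.
have ca := le_cvg_series_abs h cgn.
by apply: le_trans (abs_lim_series_le ca) _; exact: lim_series_le_fun.
Qed.

(** Young's inequality 2 |a d| <= t w a^2 + d^2 / (t w) is summed for each t, and t is optimised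
    last. *)
Lemma series_CauchySchwarz w a d : (forall k, 0 < w k) ->
  cvgn (series (fun k => w k * a k ^+ 2)) ->
  cvgn (series (fun k => d k ^+ 2 / w k)) ->
  cvgn (series (fun k => `|a k * d k|)) /\
  `|limn (series (fun k => a k * d k))| <=
    Num.sqrt (limn (series (fun k => w k * a k ^+ 2))) *
    Num.sqrt (limn (series (fun k => d k ^+ 2 / w k))).
Proof.
move=> w0 cX cY.
have le t k : 0 < t -> `|a k * d k| <= t / 2 * (w k * a k ^+ 2) + (t^-1 / 2) * (d k ^+ 2 / w k).
  move=> t0; have wk := w0 k; rewrite normrM -subr_ge0.
  have -> : t / 2 * (w k * a k ^+ 2) + t^-1 / 2 * (d k ^+ 2 / w k) - `|a k| * `|d k| =
    (2 * t * w k)^-1 * (t * w k * `|a k| - `|d k|) ^+ 2.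
    rewrite -(real_normK (num_real (a k))) -(real_normK (num_real (d k))).
    by field; rewrite !gt_eqF.
  by apply: mulr_ge0; [rewrite invr_ge0 !mulr_ge0// ltW|exact: sqr_ge0].
have cs t : cvgn (series (fun k => t / 2 * (w k * a k ^+ 2) + (t^-1 / 2) * (d k ^+ 2 / w k))).
  by apply: is_cvg_seriesD_fun; apply: is_cvg_seriesZ_fun.
have ca := le_cvg_series_abs (le 1 ^~ ltr01) (cs 1).
split => //; apply: le_sqrt_of_AMGM.
- by apply: lim_series_ge0 => // k; apply: mulr_ge0; [exact: ltW|exact: sqr_ge0].
- by apply: lim_series_ge0 => // k; apply: divr_ge0; [exact: sqr_ge0|exact: ltW].
move=> t t0; apply: le_trans (abs_lim_series_le ca) _.
apply: le_trans (lim_series_le_fun ca (cs t) (le t ^~ t0)) _.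
rewrite lim_seriesD_fun; [|exact: is_cvg_seriesZ_fun|exact: is_cvg_seriesZ_fun].
rewrite !lim_seriesZ_fun//.
by rewrite le_eqVlt; apply/orP; left; apply/eqP; field; rewrite gt_eqF.
Qed.

(** Dominated convergence for series. The filter is arbitrary because it serves both for x
    decreasing to 0 and for continuity in time. Cutting where the tail of g is below e / 3 leaves
    finitely many terms. *)
Lemma tannery (T : Type) (F : set_system T) {FF : Filter F} (f : T -> nat -> R)
    (l g : nat -> R) : cvgn (series g) -> (forall k, `|l k| <= g k) ->
  (\forall x \near F, forall k, `|f x k| <= g k) ->
  (forall k, f x k @[x --> F] --> l k) ->
  limn (series (f x)) @[x --> F] --> limn (series l).
Proof.
move=> cg lg fg fl; apply/cvgrPdist_lt => e e0.
have e3 : 0 < e / 3 by rewrite divr_gt0.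
have [n hn] : exists n, limn (series g) - series g n < e / 3.
  have /cvgrPdist_lt/(_ _ e3)[n _ h] := cg; exists n.
  by apply: le_lt_trans (h n (leqnn n)); exact: ler_norm.
have sl : series (f x) n @[x --> F] --> series l n.
  elim: n {hn} => [|n IH].
    by rewrite /series/= big_geq//; under eq_fun do rewrite big_geq//; exact: cvg_cst.
  rewrite seriesSr; under eq_fun do rewrite seriesSr.
  exact: cvgD.
have /cvgrPdist_lt/(_ _ e3) sle := sl.
near=> x.
have fx : forall k, `|f x k| <= g k by near: x.
have h1 := series_tail_le n lg cg.
have h2 := series_tail_le n fx cg.
have h3 : `|series l n - series (f x) n| < e / 3 by near: x.
have -> : limn (series l) - limn (series (f x)) =
  (limn (series l) - series l n) + (series l n - series (f x) n) -
  (limn (series (f x)) - series (f x) n) by ring.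
apply: le_lt_trans (ler_normB _ _) _.
apply: (@le_lt_trans _ _ (`|limn (series l) - series l n| + `|series l n - series (f x) n| +
   `|limn (series (f x)) - series (f x) n|)).
  by rewrite lerD2r ler_normD.
by lra.
Unshelve. all: by end_near. Qed.

End SeriesTools.
Arguments is_cvg_seriesZ_fun {R} c [f].
Arguments lim_seriesZ_fun {R} c [f].

(** * Expansions along the modes *)

Lemma cvg_series_finsupp (R : realType) (f : nat -> R) (n : nat) :
  (forall k, (n <= k)%N -> f k = 0) -> series f @ \oo --> series f n.
Proof.
move=> f0; have E m : series f (m + n)%N = series f n :> R.
  elim: m => [//|m IH]; rewrite addSn.
  have -> : series f (m + n).+1 = series f (m + n)%N + f (m + n)%N :> R by rewrite seriesSr.
  by rewrite IH f0 ?addr0// leq_addl.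
rewrite -(cvg_shiftn n) (_ : (fun m => _) = (fun=> series f n)); first exact: cvg_cst.
exact/funext.
Qed.

Lemma cvg_comb0 (R : realType) (p q : R) (f g : nat -> R) :
  f @ \oo --> (0 : R) -> g @ \oo --> (0 : R) ->
  (fun n => p * f n + q * g n) @ \oo --> (0 : R).
Proof.
move=> f0 g0; have : (fun n => p * f n + q * g n) @ \oo --> p * 0 + q * 0.
  by apply: cvgD; apply: cvgM => //; exact: cvg_cst.
by rewrite !mulr0 addr0.
Qed.

Section Spectral.
Context {R : realType}.
Variables (alpha beta mu s : R) (j : nat -> R).
Hypotheses (alpha_lt2 : alpha < 2) (mu_lt : mu < mucrit (alpha + beta))
  (j_zeros : positive_zeros (besselJ (nu alpha beta mu + 1)) j)
  (s_gt : nu alpha beta mu < s).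
Implicit Types (x y t : R) (k l m n : nat) (u z f g : R -> R) (b : nat -> R).

Local Notation W := (weight beta).
Local Notation Phi := (Phi alpha beta mu j).
Local Notation coef := (coef alpha beta mu j).
Local Notation w := (spectral_weight alpha j s).
Local Notation lam := (lam alpha j).
Local Notation c := (trace alpha beta mu j).
Local Notation a := (expa alpha beta mu).
Local Notation L2w := (L2 W 1).
Local Notation Hs := (Hs alpha beta mu j s).
Local Notation Hs_norm := (Hs_norm alpha beta mu j s).
Local Notation psi x := (x `^ (- a)).
Local Notation Rint f := ((leb R).-integrable `]0, 1[ (EFin \o f)).

Let w0 k : 0 < w k. Proof. exact: (spectral_weight_gt0 s alpha_lt2 j_zeros). Qed.
Let lam0 k : 0 <= lam k. Proof. exact: lam_ge0. Qed.
Let c0 k : 0 <= c k. Proof. exact: trace_ge0. Qed.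
Let cK : cvgn (series (fun k => c k ^+ 2 / (w k * (1 + lam k)))).
Proof. exact: is_cvg_trace. Qed.
Let W0 x : 0 <= W x. Proof. exact: powR_ge0. Qed.
Let mW D : measurable_fun D W. Proof. by apply: measurable_funTS; exact: measurable_powR. Qed.
Let mPhi k : measurable_fun (`]0%R, 1%R[%classic : set R) (Phi k).
Proof. exact: measurable_Phi. Qed.
Let psi2W : Rint (fun x => (psi x) ^+ 2 * W x).
Proof. exact: Rintegrable_weight. Qed.
Let orth k l : L2dot W 1 (Phi k) (Phi l) = (k == l)%:R.
Proof. exact: Phi_orthonormal. Qed.

Lemma Phi_le k x : 0 < x -> `|Phi k x| <= c k * psi x.
Proof.
move=> x0; rewrite PhiE// normrM ger0_norm ?powR_ge0// mulrC.
apply: ler_wpM2r; first exact: powR_ge0.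
by apply: mode_le => //; exact: powR_ge0.
Qed.

Lemma L2_mul f g : L2w f -> L2w g -> Rint (fun x => f x * g x * W x).
Proof.
move=> [mf f2] [mg g2].
have I : Rint (fun x => f x ^+ 2 * W x + g x ^+ 2 * W x) by exact: RintegrableD.
apply: (Rintegrable_le _ _ _ I) => //.
  by apply: measurable_funM; [exact: measurable_funM|exact: mW].
move=> x _; rewrite !normrM (ger0_norm (W0 x)) -mulrDl ler_wpM2r//.
rewrite -(real_normK (num_real (f x))) -(real_normK (num_real (g x))).
by have := normr_ge0 (f x); have := normr_ge0 (g x); nra.
Qed.

(** x^(-a) lies in L^2_beta and is the common majorant in what follows. *)
Lemma L2_le f (q : R) : measurable_fun (`]0%R, 1%R[%classic : set R) f ->
  (forall x, 0 < x -> x < 1 -> `|f x| <= q * psi x) -> L2w f.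
Proof.
move=> mf fq; split => //.
have I : Rint (fun x => q ^+ 2 * (psi x ^+ 2 * W x)) by exact: RintegrableZ.
apply: (Rintegrable_le _ _ _ I) => //.
  by apply: measurable_funM; [exact: measurable_funX|exact: mW].
move=> x /=; rewrite in_itv/= => /andP[x0 x1].
rewrite normrM (ger0_norm (W0 x)) mulrA ler_wpM2r// ger0_norm ?sqr_ge0//.
rewrite -exprMn -(real_normK (num_real (f x))) ler_pXn2r ?nnegrE//; first exact: fq.
exact: le_trans (fq _ x0 x1).
Qed.

Lemma L2_Phi k : L2w (Phi k).
Proof. by apply: (L2_le (q := c k)) => // x x0 _; exact: Phi_le. Qed.

Lemma L2_lin (q : R) f g : L2w f -> L2w g -> L2w (fun x => q * f x + g x).
Proof.
move=> [mf f2] [mg g2].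
have mfg : measurable_fun (`]0%R, 1%R[%classic : set R) (fun x => q * f x + g x).
  by apply: measurable_funD => //; apply: measurable_funM.
split => //.
have I : Rint (fun x => 2 * q ^+ 2 * (f x ^+ 2 * W x) + 2 * (g x ^+ 2 * W x)).
  by apply: RintegrableD => //; apply: RintegrableZ.
apply: (Rintegrable_le _ _ _ I) => //.
  by apply: measurable_funM; [exact: measurable_funX|exact: mW].
move=> x _; rewrite normrM (ger0_norm (W0 x)) ger0_norm ?sqr_ge0//.
rewrite [leRHS](_ : _ = (2 * q ^+ 2 * f x ^+ 2 + 2 * g x ^+ 2) * W x); last by ring.
rewrite ler_wpM2r// -subr_ge0.
have -> : 2 * q ^+ 2 * f x ^+ 2 + 2 * g x ^+ 2 - (q * f x + g x) ^+ 2 = (q * f x - g x) ^+ 2.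
  by ring.
exact: sqr_ge0.
Qed.

Lemma coef_lin (q : R) f g k : L2w f -> L2w g ->
  coef (fun x => q * f x + g x) k = q * coef f k + coef g k.
Proof.
move=> Lf Lg; have If := L2_mul Lf (L2_Phi k); have Ig := L2_mul Lg (L2_Phi k).
rewrite /coef /L2dot -RintegralZl// -RintegralD//; last exact: RintegrableZ.
by apply: eq_Rintegral => x _; ring.
Qed.

Lemma eq_coef f g k : (forall x, 0 < x -> x < 1 -> f x = g x) -> coef f k = coef g k.
Proof.
move=> fg; apply: eq_Rintegral => x; rewrite inE/= in_itv/= => /andP[x0 x1].
by rewrite fg.
Qed.

Lemma coef_le f (q : R) k : L2w f -> (forall x, 0 < x -> x < 1 -> `|f x| <= q * psi x) ->
  `|coef f k| <= q * (c k * \int[leb R]_(x in `]0, 1[) (psi x ^+ 2 * W x)).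
Proof.
move=> Lf fq; have If := L2_mul Lf (L2_Phi k).
rewrite /coef /L2dot mulrA -RintegralZl//.
apply: le_trans (le_normr_Rintegral _ If) _ => //.
apply: le_Rintegral => //; first exact: (integrable_norm If).
  exact: RintegrableZ.
move=> x /=; rewrite in_itv/= => /andP[x0 x1].
rewrite !normrM (ger0_norm (W0 x)) mulrA ler_wpM2r//.
have -> : q * c k * psi x ^+ 2 = (q * psi x) * (c k * psi x) by ring.
by apply: ler_pM => //; [exact: fq|exact: Phi_le].
Qed.

Definition finsum b n x : R := \sum_(k < n) b k * Phi k x.

Lemma finsumS b n : finsum b n.+1 = (fun x => b n * Phi n x + finsum b n x).
Proof. by apply/funext => x; rewrite /finsum big_ord_recr addrC. Qed.

Lemma series_finsum b n x : series (fun k => b k * Phi k x) n = finsum b n x.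
Proof. by rewrite /series/= big_mkord. Qed.

Lemma L2_0 : L2w (fun=> 0).
Proof.
apply: (L2_le (q := 0)); first exact: measurable_cst.
by move=> x _ _; rewrite normr0 mul0r.
Qed.

Lemma finsum0 b : finsum b 0 = (fun=> 0).
Proof. by apply/funext => x; rewrite /finsum big_ord0. Qed.

Lemma L2_finsum b n : L2w (finsum b n).
Proof.
elim: n => [|n IH]; first by rewrite finsum0; exact: L2_0.
by rewrite finsumS; apply: L2_lin => //; exact: L2_Phi.
Qed.

Lemma coef0 k : coef (fun=> 0) k = 0.
Proof.
transitivity (coef (fun x => -1 * Phi k x + Phi k x) k).
  by apply: eq_coef => x _ _; rewrite mulN1r addNr.
by rewrite coef_lin; [rewrite mulN1r addNr|exact: L2_Phi|exact: L2_Phi].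
Qed.

Lemma coef_finsum b n k : coef (finsum b n) k = if (k < n)%N then b k else 0.
Proof.
elim: n => [|n IH].
  by rewrite finsum0 coef0.
rewrite finsumS coef_lin; [|exact: L2_Phi|exact: L2_finsum].
have -> : coef (Phi n) k = (n == k)%:R by exact: orth.
rewrite IH; case: (ltngtP k n) => [kn|nk|->].
- by rewrite mulr0 add0r ltnS (ltnW kn).
- by rewrite mulr0 add0r ltnS leqNgt nk.
- by rewrite ltnSn mulr1 addr0.
Qed.

(* A series [sum_k b_k Phi_k] with [sum_k |b_k| c_k] finite converges uniformly with
   respect to the weight [psi], which belongs to [L^2_beta]. *)
Section Expansion.
Variable b : nat -> R.
Hypothesis bc : cvgn (series (fun k => `|b k| * c k)).

Definition expansion x : R := limn (series (fun k => b k * Phi k x)).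

Let tail n := limn (series (fun k => `|b k| * c k)) - series (fun k => `|b k| * c k) n.

Let term_le k x : 0 < x -> `|b k * Phi k x| <= psi x * (`|b k| * c k).
Proof.
move=> x0; rewrite normrM [leRHS](_ : _ = `|b k| * (c k * psi x)); last by ring.
by apply: ler_wpM2l => //; exact: Phi_le.
Qed.

Let cvg_bound x : cvgn (series (fun k => psi x * (`|b k| * c k))).
Proof. exact: is_cvg_seriesZ_fun. Qed.

Lemma cvg_expansion x : 0 < x -> series (fun k => b k * Phi k x) @ \oo --> expansion x.
Proof. by move=> x0; apply: (le_cvg_series (fun k => term_le k x0)) => //; exact:
  cvg_bound. Qed.

(** The bound separates into a tail independent of x and the fixed function x^(-a); the coefficients
    and the L^2 convergence are both read off from it. *)
Lemma expansion_tail_le n x : 0 < x -> `|expansion x - finsum b n x| <= tail n * psi x.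
Proof.
move=> x0; rewrite -series_finsum /expansion.
have h := series_tail_le n (fun k => term_le k x0) (@cvg_bound x).
apply: (le_trans h).
rewrite lim_seriesZ_fun// /tail [series (fun k => psi x * _) n](_ : _ = psi x * series (fun
  k => `|b k| * c k) n).
  by rewrite -mulrBr mulrC.
by rewrite /series/= mulr_sumr.
Qed.

Lemma measurable_expansion : measurable_fun (`]0%R, 1%R[%classic : set R) expansion.
Proof.
apply: (measurable_fun_cvg (h := fun n x => finsum b n x)).
  by move=> n; have [] := L2_finsum b n.
move=> x; rewrite /= in_itv/= => /andP[x0 _].
by under eq_fun do rewrite -series_finsum; exact: cvg_expansion.
Qed.

Lemma L2_expansion : L2w expansion.
Proof.
apply: (L2_le (q := tail 0)); first exact: measurable_expansion.
by move=> x x0 _; have := expansion_tail_le 0 x0; rewrite finsum0 subr0.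
Qed.

Lemma cvg_tail : tail @ \oo --> (0 : R).
Proof.
rewrite -(subrr (limn (series (fun k => `|b k| * c k)))).
by apply: cvgB => //; exact: cvg_cst.
Qed.

Let L2_diff n : L2w (fun x => expansion x - finsum b n x).
Proof.
have := L2_lin (-1) (L2_finsum b n) L2_expansion.
by congr L2; apply/funext => x; rewrite mulN1r addrC.
Qed.

(** For n > k the truncation has coefficient b k by orthonormality, and the remainder contributes at
    most a fixed multiple of [tail n]. *)
Lemma coef_expansion k : coef expansion k = b k.
Proof.
pose P := c k * \int[leb R]_(x in `]0, 1[) (psi x ^+ 2 * W x).
have h n : (k < n)%N -> `|coef expansion k - b k| <= tail n * P.
  move=> kn; have -> : coef expansion k - b k = coef (fun x => expansion x - finsum b n x) k.
    have -> : (fun x => expansion x - finsum b n x) = (fun x => -1 * finsum b n x +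
      expansion x).
      by apply/funext => x; rewrite mulN1r addrC.
    rewrite coef_lin; [|exact: L2_finsum|exact: L2_expansion].
    by rewrite coef_finsum kn mulN1r addrC.
  apply: coef_le; first exact: L2_diff.
  by move=> x x0 _; exact: expansion_tail_le.
apply/eqP; rewrite -subr_eq0 -normr_eq0 eq_le normr_ge0 andbT.
have ct : tail n * P @[n --> \oo] --> 0 * P.
  by apply: cvgM; [exact: cvg_tail|exact: cvg_cst].
rewrite -(mul0r P) -(cvg_lim _ ct)//; apply: limr_ge; first exact: cvgP ct.
by near=> n; apply: h; near: n; exact: nbhs_infty_gt.
Unshelve. all: by end_near. Qed.

Lemma L2cvg_expansion : L2cvg W 1 (fun n x => \sum_(k < n) b k * Phi k x) expansion.
Proof.
pose P := \int[leb R]_(x in `]0, 1[) (psi x ^+ 2 * W x).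
have ub n : (\int[leb R]_(x in `]0%R, 1%R[) ((expansion x - finsum b n x) ^+ 2 * W x)%:E <=
  (tail n ^+ 2 * P)%:E)%E.
  have [_ I] := L2_diff n.
  have J : Rint (fun x => tail n ^+ 2 * (psi x ^+ 2 * W x)) by exact: RintegrableZ.
  rewrite -RintegralZl// -[leLHS]fineK; last exact: integrable_fin_num.
  rewrite lee_fin; apply: le_Rintegral => // x /=; rewrite in_itv/= => /andP[x0 _].
  rewrite mulrA ler_wpM2r// -exprMn -(real_normK (num_real (_ - _))).
  rewrite ler_pXn2r ?nnegrE//; first exact: expansion_tail_le.
  exact: le_trans (expansion_tail_le n x0).
rewrite /L2cvg; apply: (@squeeze_cvge _ _ _ _ (fun=> 0%E) _ (fun n => (tail n ^+ 2 * P)%:E)).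
- near=> n; rewrite ub andbT; apply: integral_ge0 => x _.
  by rewrite lee_fin mulr_ge0// sqr_ge0.
- exact: cvg_cst.
- apply: cvg_EFin; first exact: nearW.
  rewrite -(mul0r P) -[X in X * P](mulr0 (0 : R)).
  apply: cvgM; last exact: cvg_cst.
  by under eq_fun do rewrite expr2; apply: cvgM; exact: cvg_tail.
Unshelve. all: by end_near. Qed.

Lemma Hs_expansion : cvgn (series (fun k => w k * b k ^+ 2)) -> Hs expansion.
Proof.
move=> wb; split; first exact: L2_expansion.
  rewrite (_ : (fun n x => _) = (fun n x => \sum_(k < n) b k * Phi k x)); first exact:
    L2cvg_expansion.
  by apply/funext => n; apply/funext => x; apply: eq_bigr => k _; rewrite coef_expansion.
rewrite (_ : (fun k => _) = (fun k => w k * b k ^+ 2))//.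
by apply/funext => k; rewrite coef_expansion.
Qed.

End Expansion.

Lemma Hs_finsum b n : Hs (finsum b n).
Proof.
pose b' k := if (k < n)%N then b k else 0.
have b'0 k : (n <= k)%N -> b' k = 0 by rewrite /b' ltnNge => ->.
have bc : cvgn (series (fun k => `|b' k| * c k)).
  apply: cvgP; apply: (@cvg_series_finsupp _ _ n) => k nk.
  by rewrite b'0// normr0 mul0r.
have -> : finsum b n = expansion b'.
  apply/funext => x; apply/esym/cvg_lim => //.
  have -> : finsum b n x = series (fun k => b' k * Phi k x) n.
    by rewrite series_finsum; apply: eq_bigr => k _; rewrite /b' ltn_ord.
  by apply: cvg_series_finsupp => k nk; rewrite b'0// mul0r.
apply: Hs_expansion => //.
apply: cvgP; apply: (@cvg_series_finsupp _ _ n) => k nk.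
by rewrite b'0// expr0n mulr0.
Qed.

Lemma Hs_0 : Hs (fun=> 0).
Proof. by rewrite -(finsum0 (fun=> 0)); exact: Hs_finsum. Qed.

Lemma Hs_Phi k : Hs (Phi k).
Proof.
have -> : Phi k = finsum (fun l => (l == k)%:R) k.+1.
  apply/funext => x; rewrite finsumS eqxx mul1r /finsum big1 ?addr0//.
  by move=> i _; rewrite (ltn_eqF (ltn_ord i)) mul0r.
exact: Hs_finsum.
Qed.

Lemma Hs_coef_cvg z : Hs z -> cvgn (series (fun k => w k * coef z k ^+ 2)).
Proof. by case. Qed.

(** Both the L^2 convergence of the expansion and the weighted sum are controlled by (q X + Z)^2 <=
    2 q^2 X^2 + 2 Z^2. *)
Lemma Hs_lin (q : R) (y z : R -> R) : Hs y -> Hs z -> Hs (fun x => q * y x + z x).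
Proof.
move=> [Ly cy sy] [Lz cz sz]; split; first exact: L2_lin.
  pose Sy n := finsum (coef y) n; pose Sz n := finsum (coef z) n.
  have E n x : \sum_(k < n) coef (fun x => q * y x + z x) k * Phi k x = q * Sy n x + Sz n x.
    rewrite /Sy /Sz /finsum mulr_sumr -big_split; apply: eq_bigr => k _.
    by rewrite coef_lin// mulrDl mulrA.
  have Ld f g : L2w f -> L2w g -> Rint (fun x => (f x - g x) ^+ 2 * W x).
    move=> Lf Lg; have [_] := L2_lin (-1) Lg Lf.
    by apply: eq_Rintegrable => // x _; rewrite mulN1r addrC.
  have Iy n : Rint (fun x => (y x - Sy n x) ^+ 2 * W x) by apply: Ld => //; exact: L2_finsum.
  have Iz n : Rint (fun x => (z x - Sz n x) ^+ 2 * W x) by apply: Ld => //; exact: L2_finsum.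
  have Iyz n : Rint (fun x => ((q * y x + z x) - (q * Sy n x + Sz n x)) ^+ 2 * W x).
    by apply: Ld; apply: L2_lin => //; exact: L2_finsum.
  (* [L2cvg] is extended-valued; for square integrable differences it amounts to convergence of real
     integrals. *)
  have toR f (h : nat -> R -> R) : (forall n, Rint (fun x => (f x - h n x) ^+ 2 * W x)) ->
      L2cvg W 1 h f <-> (\int[leb R]_(x in `]0, 1[) ((f x - h n x) ^+ 2 * W x)) @[n -->
        \oo] --> (0 : R).
    move=> I; rewrite /L2cvg; split => [/fine_cvgP[_]//|h0].
    apply/fine_cvgP; split => //.
    by apply: nearW => n; exact: integrable_fin_num (I n).
  have -> : (fun n x => \sum_(k < n) coef (fun x => q * y x + z x) k * Phi k x) =
      (fun n x => q * Sy n x + Sz n x).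
    by apply/funext => n; apply/funext => x; exact: E.
  apply: (toR _ _ Iyz).2.
  have hy : (\int[leb R]_(x in `]0, 1[) ((y x - Sy n x) ^+ 2 * W x)) @[n --> \oo] --> (0 : R).
    by apply: (toR y Sy Iy).1; rewrite /Sy /finsum; exact: cy.
  have hz : (\int[leb R]_(x in `]0, 1[) ((z x - Sz n x) ^+ 2 * W x)) @[n --> \oo] --> (0 : R).
    by apply: (toR z Sz Iz).1; rewrite /Sz /finsum; exact: cz.
  apply: (@squeeze_cvgr _ _ _ _ (fun=> 0)
    (fun n => 2 * q ^+ 2 * \int[leb R]_(x in `]0, 1[) ((y x - Sy n x) ^+ 2 * W x) +
              2 * \int[leb R]_(x in `]0, 1[) ((z x - Sz n x) ^+ 2 * W x))).
  - near=> n; apply/andP; split.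
      by apply: Rintegral_ge0 => x _; rewrite mulr_ge0// sqr_ge0.
    have Jy : Rint (fun x => 2 * q ^+ 2 * ((y x - Sy n x) ^+ 2 * W x)) by exact: RintegrableZ.
    have Jz : Rint (fun x => 2 * ((z x - Sz n x) ^+ 2 * W x)) by exact: RintegrableZ.
    rewrite -!RintegralZl// -RintegralD//; apply: le_Rintegral => //.
      exact: RintegrableD.
    move=> x _; rewrite [leRHS](_ : _ = (2 * q ^+ 2 * (y x - Sy n x) ^+ 2 + 2 * (z x - Sz n
      x) ^+ 2) * W x).
      rewrite ler_wpM2r// -subr_ge0.
      rewrite (_ : _ - _ = (q * (y x - Sy n x) - (z x - Sz n x)) ^+ 2); first exact: sqr_ge0.
      by ring.
    by ring.
  - exact: cvg_cst.
  - exact: (cvg_comb0 _ _ hy hz).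
apply: (@le_cvg_series _ _ (fun k => 2 * q ^+ 2 * (w k * coef y k ^+ 2) + 2 * (w k * coef z
  k ^+ 2))).
  move=> k; rewrite coef_lin// ger0_norm; last by apply: mulr_ge0; [exact: ltW|exact: sqr_ge0].
  rewrite [leRHS](_ : _ = w k * (2 * q ^+ 2 * coef y k ^+ 2 + 2 * coef z k ^+ 2)); last by ring.
  apply: ler_wpM2l; first exact: ltW.
  rewrite -subr_ge0 (_ : _ - _ = (q * coef y k - coef z k) ^+ 2); first exact: sqr_ge0.
  by ring.
exact: (is_cvg_seriesD_fun (is_cvg_seriesZ_fun _ sy) (is_cvg_seriesZ_fun _ sz)).
Unshelve. all: by end_near. Qed.

End Spectral.

(** * The dual spaces *)

Lemma Hs_L2 (R : realType) (alpha beta mu s : R) (j : nat -> R) (z : R -> R) :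
  Hs alpha beta mu j s z -> L2 (weight beta) 1 z.
Proof. by case. Qed.

Local Opaque Hs coef Phi spectral_weight lam trace finsum expansion.

Section Duality.
Context {R : realType}.
Variables (alpha beta mu s : R) (j : nat -> R).
Hypotheses (alpha_lt2 : alpha < 2) (mu_lt : mu < mucrit (alpha + beta))
  (j_zeros : positive_zeros (besselJ (nu alpha beta mu + 1)) j)
  (s_gt : nu alpha beta mu < s).
Implicit Types (x t : R) (k n : nat) (y z : R -> R) (b d : nat -> R)
  (l : (R -> R) -> R).

Local Notation Phi := (Phi alpha beta mu j).
Local Notation coef := (coef alpha beta mu j).
Local Notation w := (spectral_weight alpha j s).
Local Notation lam := (lam alpha j).
Local Notation c := (trace alpha beta mu j).
Local Notation a := (expa alpha beta mu).
Local Notation Hs := (Hs alpha beta mu j s).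
Local Notation Hs_norm := (Hs_norm alpha beta mu j s).
Local Notation Hd := (Hd alpha beta mu j s).
Local Notation Hd_norm := (Hd_norm alpha beta mu j s).
Local Notation Sgrp := (Sgrp alpha beta mu j).
Local Notation finsum := (finsum alpha beta mu j).
Local Notation expansion := (expansion alpha beta mu j).

Let w0 k : 0 < w k. Proof. exact: (spectral_weight_gt0 s alpha_lt2 j_zeros). Qed.
Let w_ge0 k : 0 <= w k. Proof. exact: ltW. Qed.
Let lam0 k : 0 <= lam k. Proof. exact: lam_ge0. Qed.
Let c0 k : 0 <= c k. Proof. exact: trace_ge0. Qed.
Let cK : cvgn (series (fun k => c k ^+ 2 / (w k * (1 + lam k)))).
Proof. exact: is_cvg_trace. Qed.
Let HsC z : Hs z -> cvgn (series (fun k => w k * coef z k ^+ 2)).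
Proof. exact: Hs_coef_cvg. Qed.
Let HsL z : Hs z -> L2 (weight beta) 1 z. Proof. exact: Hs_L2. Qed.
Let Hs0 : Hs (fun=> 0). Proof. exact: Hs_0. Qed.
Let HsPhi k : Hs (Phi k). Proof. exact: Hs_Phi. Qed.
Let Hsfin b n : Hs (finsum b n). Proof. exact: Hs_finsum. Qed.
Let Hslin (q : R) y z : Hs y -> Hs z -> Hs (fun x => q * y x + z x).
Proof. exact: Hs_lin. Qed.
Let coeflin (q : R) y z k : Hs y -> Hs z -> coef (fun x => q * y x + z x) k = q * coef y k
  + coef z k.
Proof. by move=> Hy Hz; apply: coef_lin; try exact: HsL; assumption. Qed.
Let coeffin b n k : coef (finsum b n) k = if (k < n)%N then b k else 0.
Proof. exact: coef_finsum. Qed.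
Let coef0' k : coef (fun=> 0) k = 0.
Proof. exact: (coef0 alpha_lt2 mu_lt j_zeros). Qed.
Let Phi_le' k x : 0 < x -> `|x `^ a * Phi k x| <= c k.
Proof. exact: powR_expa_Phi_le. Qed.

Lemma expR_lam_le1 k t : 0 <= t -> expR (- lam k * t) <= 1.
Proof. by move=> t0; rewrite -expR0 ler_expR mulNr oppr_le0 mulr_ge0. Qed.

(** e^(-2qt) <= 1 / (1 + 2tq) and 1 + q <= (1 + 1/(2t)) (1 + 2tq). This trades smoothing for the
    factor 1 / (1 + lam k) of the trace sum. *)
Lemma expR_sqr_le (q t : R) : 0 <= q -> 0 < t ->
  expR (- q * t) ^+ 2 <= (1 + (2 * t)^-1) / (1 + q).
Proof.
move=> q0 t0; have q1 : 0 < 1 + q by rewrite ltr_wpDr.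
have t20 : 0 < 2 * t by rewrite mulr_gt0.
rewrite ler_pdivlMr// -expRM_natl (_ : 2%:R * (- q * t) = - (2 * t * q)); last by ring.
rewrite expRN mulrC ler_pdivrMr ?expR_gt0//.
have h := @expR_ge1Dx R (2 * t * q).
apply: (@le_trans _ _ ((1 + (2 * t)^-1) * (1 + 2 * t * q))); last first.
  by apply: ler_wpM2l => //; rewrite addr_ge0// invr_ge0 ltW.
rewrite -subr_ge0 (_ : _ - _ = 2 * t * q + (2 * t)^-1); last by field; rewrite gt_eqF.
by rewrite addr_ge0 ?mulr_ge0 ?invr_ge0 ?(ltW t0) ?(ltW t20).
Qed.

(** The condition under which [expansion] behaves well, obtained for smoothed coefficients by
    Cauchy-Schwarz against the trace sum [cK]. *)
Lemma is_cvg_heat (b : nat -> R) t : 0 < t -> cvgn (series (fun k => w k * b k ^+ 2)) ->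
  cvgn (series (fun k => `|expR (- lam k * t) * b k| * c k)).
Proof.
move=> t0 cb; pose d k := expR (- lam k * t) * c k.
have cd : cvgn (series (fun k => d k ^+ 2 / w k)).
  apply: (@le_cvg_series _ _ (fun k => (1 + (2 * t)^-1) * (c k ^+ 2 / (w k * (1 + lam
    k))))); last first.
    exact: is_cvg_seriesZ_fun.
  move=> k; rewrite ger0_norm; last by apply: divr_ge0 => //; exact: sqr_ge0.
  rewrite /d exprMn; have h := expR_sqr_le (lam0 k) t0.
  have -> : (1 + (2 * t)^-1) * (c k ^+ 2 / (w k * (1 + lam k))) =
      (1 + (2 * t)^-1) / (1 + lam k) * (c k ^+ 2 / w k).
    by field; rewrite !gt_eqF// ltr_wpDr.
  rewrite -[leLHS]mulrA; apply: ler_wpM2r; last exact: h.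
  by apply: divr_ge0 => //; exact: sqr_ge0.
have [+ _] := series_CauchySchwarz w0 cb cd.
rewrite (_ : (fun k => `|b k * d k|) = (fun k => `|expR (- lam k * t) * b k| * c k))//.
apply/funext => k; rewrite /d mulrA (mulrC (b k)) normrM (ger0_norm (c0 k)).
by [].
Qed.

Lemma Sgrp0 z : Sgrp 0 z = z. Proof. by rewrite /Sgrp eqxx. Qed.

Lemma Sgrp_expansion t z : 0 < t ->
  Sgrp t z = expansion (fun k => expR (- lam k * t) * coef z k).
Proof. by move=> t0; rewrite /Sgrp gt_eqF. Qed.

Lemma coef_Sgrp t z k : 0 <= t -> Hs z ->
  coef (Sgrp t z) k = expR (- lam k * t) * coef z k.
Proof.
rewrite le_eqVlt => /predU1P[<- _|t0 Hz]; first by rewrite Sgrp0 mulr0 expR0 mul1r.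
rewrite Sgrp_expansion//; apply: coef_expansion => //.
by apply: is_cvg_heat => //; exact: HsC.
Qed.

Let weighted_heat_le t (b : nat -> R) k : 0 <= t ->
  w k * (expR (- lam k * t) * b k) ^+ 2 <= w k * b k ^+ 2.
Proof.
move=> t0; apply: ler_wpM2l => //; rewrite exprMn -[leRHS]mul1r.
apply: ler_wpM2r; first exact: sqr_ge0.
by rewrite exprn_ile1 ?expR_ge0// expR_lam_le1.
Qed.

Lemma Hs_Sgrp t z : 0 <= t -> Hs z -> Hs (Sgrp t z).
Proof.
rewrite le_eqVlt => /predU1P[<-|t0] Hz.
  by rewrite (Sgrp0 z); exact: Hz.
rewrite (Sgrp_expansion z t0).
apply: (Hs_expansion alpha_lt2 mu_lt j_zeros (is_cvg_heat t0 (HsC Hz))).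
apply: (@le_cvg_series _ _ (fun k => w k * coef z k ^+ 2) _ (HsC Hz)) => k.
rewrite ger0_norm; last by apply: mulr_ge0; [exact: w_ge0|exact: sqr_ge0].
by apply: weighted_heat_le; exact: ltW.
Qed.

Lemma Hs_norm_ge0 z : 0 <= Hs_norm z. Proof. exact: sqrtr_ge0. Qed.

Lemma Hs_norm_Sgrp_le t z : 0 <= t -> Hs z -> Hs_norm (Sgrp t z) <= Hs_norm z.
Proof.
move=> t0 Hz; have HS := Hs_Sgrp t0 Hz.
rewrite /Hs_norm ler_wsqrtr//; apply: lim_series_le_fun; [exact: (HsC HS)|exact: (HsC Hz)|]
  => k.
by rewrite (coef_Sgrp k t0 Hz); exact: weighted_heat_le.
Qed.

(** The added 0 matches the shape c y + z in which linearity on H^s is stated. *)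
Lemma Hs_norm_scale (q : R) z : Hs z -> Hs_norm (fun x => q * z x + 0) = `|q| * Hs_norm z.
Proof.
move=> Hz; rewrite /Hs_norm.
rewrite (_ : (fun k => w k * _) = (fun k => q ^+ 2 * (w k * coef z k ^+ 2))); last first.
  apply/funext => k; rewrite (coeflin _ _ Hz Hs0) coef0'.
  by rewrite addr0 exprMn mulrCA.
rewrite (lim_seriesZ_fun (q ^+ 2) (HsC Hz)) sqrtrM; last exact: sqr_ge0.
by rewrite sqrtr_sqr.
Qed.

(** x^a Phi_k tends to c_k and never exceeds it in modulus, so |b k| c_k is a majorant independent
    of x and [tannery] applies. *)
Lemma cvg_expa_Sgrp t z : 0 < t -> Hs z ->
  x `^ a * Sgrp t z x @[x --> 0^'+] -->
    limn (series (fun k => expR (- lam k * t) * coef z k * c k)).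
Proof.
move=> t0 Hz; set b := fun k => expR (- lam k * t) * coef z k.
have bc : cvgn (series (fun k => `|b k| * c k)) by apply: is_cvg_heat => //; exact: HsC.
have h : limn (series (fun k => b k * (x `^ a * Phi k x))) @[x --> 0^'+] -->
    limn (series (fun k => b k * c k)).
  apply: (tannery bc).
  - by move=> k; rewrite normrM (ger0_norm (c0 k)).
  - near=> x; move=> k; rewrite normrM; apply: ler_wpM2l => //.
    by apply: Phi_le'; near: x; exact: nbhs_right_gt.
  - by move=> k; apply: cvgM; [exact: cvg_cst|exact: cvg_powR_expa_Phi].
apply: cvg_trans h; apply: near_eq_cvg; near=> x.
have x0 : 0 < x by near: x; exact: nbhs_right_gt.
rewrite (Sgrp_expansion z t0); apply/cvg_lim => //.
have -> : (fun k => b k * (x `^ a * Phi k x)) = (fun k => x `^ a * (b k * Phi k x)).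
  by apply/funext => k; rewrite mulrCA.
exact: (cvg_seriesZ (x `^ a) (cvg_expansion alpha_lt2 mu_lt j_zeros bc x0)).
Unshelve. all: by end_near. Qed.

Lemma OaE t z : 0 < t -> Hs z -> Oa alpha beta mu (Sgrp t z) =
  limn (series (fun k => expR (- lam k * t) * coef z k * c k)).
Proof. by move=> t0 Hz; apply/cvg_lim => //; exact: cvg_expa_Sgrp. Qed.

(** The functional with coefficients d k. It lies in H^{-s} once the sum of d k^2 / w k is finite,
    and by [Hd_seqE] each element of H^{-s} has this form. *)
Definition seq_dual d z : R := limn (series (fun k => coef z k * d k)).

Lemma seq_dual_le d z : cvgn (series (fun k => d k ^+ 2 / w k)) -> Hs z ->
  `|seq_dual d z| <= Num.sqrt (limn (series (fun k => d k ^+ 2 / w k))) * Hs_norm z.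
Proof.
move=> cd Hz; have [_ h] := series_CauchySchwarz w0 (HsC Hz) cd.
by rewrite mulrC; exact: h.
Qed.

Lemma seq_dual_cvg d z : cvgn (series (fun k => d k ^+ 2 / w k)) -> Hs z ->
  cvgn (series (fun k => coef z k * d k)).
Proof.
move=> cd Hz; apply: cvg_series_abs.
by have [h _] := series_CauchySchwarz w0 (HsC Hz) cd; exact: h.
Qed.

Lemma Hd_seq_dual d l : cvgn (series (fun k => d k ^+ 2 / w k)) ->
  (forall z, Hs z -> l z = seq_dual d z) -> Hd l.
Proof.
move=> cd ld; split.
  move=> q y z Hy Hz; rewrite (ld _ (Hslin q Hy Hz)) (ld _ Hy) (ld _ Hz).
  have cy := seq_dual_cvg cd Hy; have cz := seq_dual_cvg cd Hz.
  rewrite /seq_dual -(lim_seriesZ_fun q cy) -(lim_seriesD_fun (is_cvg_seriesZ_fun q cy) cz).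
  have -> : (fun k => coef (fun x => q * y x + z x) k * d k) =
      (fun k => q * (coef y k * d k) + coef z k * d k).
    by apply/funext => k; rewrite (coeflin q k Hy Hz) mulrDl mulrA.
  by [].
exists (Num.sqrt (limn (series (fun k => d k ^+ 2 / w k)))) => z Hz.
by rewrite (ld _ Hz); exact: (seq_dual_le cd Hz).
Qed.

Lemma Hs_norm0 : Hs_norm (fun=> 0) = 0.
Proof.
rewrite /Hs_norm (_ : (fun k => w k * _) = (fun=> 0)).
  by rewrite (_ : series _ = fun=> 0) ?lim_cst ?sqrtr0//; apply/funext => n; rewrite
    /series/= big1.
by apply/funext => k; rewrite coef0' expr0n mulr0.
Qed.

Lemma Hd_norm_le l (M : R) : 0 <= M -> (forall z, Hs z -> `|l z| <= M * Hs_norm z) ->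
  Hd_norm l <= M.
Proof.
move=> M0 lM; apply: ge_sup.
  (* The supremum is over a nonempty set, as the zero function belongs to the unit ball. *)
  exists `|l (fun=> 0)|, (fun=> 0) => //; split; first exact: Hs0.
  by rewrite Hs_norm0.
move=> _ [z [Hz z1] <-]; apply: le_trans (lM z Hz) _.
by rewrite -[leRHS]mulr1 ler_wpM2l.
Qed.

Lemma Hd_lin0 l : Hd l -> l (fun=> 0) = 0.
Proof.
move=> [lin _]; have := lin 1 _ _ Hs0 Hs0.
rewrite (_ : (fun x => _) = (fun=> 0)); last by apply/funext => x; rewrite mulr0 addr0.
rewrite mul1r => h; apply: (addrI (l (fun=> 0))).
by rewrite addr0 -h.
Qed.

Lemma Hd_has_ubound l : Hd l ->
  has_ubound [set `|l z| | z in [set z | Hs z /\ Hs_norm z <= 1]].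
Proof.
move=> [_ [M lM]]; exists `|M| => _ [y [Hy y1] <-]; apply: le_trans (lM y Hy) _.
apply: le_trans (ler_norm _) _; rewrite normrM -[leRHS]mulr1 ler_wpM2l//.
by rewrite ger0_norm; [exact: y1|exact: Hs_norm_ge0].
Qed.

Lemma Hd_norm_ge0 l : Hd l -> 0 <= Hd_norm l.
Proof.
move=> Hl; apply: le_trans (normr_ge0 (l (fun=> 0))) _.
apply: ub_le_sup; first exact: Hd_has_ubound.
by exists (fun=> 0) => //; split; [exact: Hs0|rewrite Hs_norm0].
Qed.

(** Rescaling to the unit ball; when z has norm 0, boundedness of l already gives l z = 0. *)
Lemma Hd_norm_ge l z : Hd l -> Hs z -> `|l z| <= Hd_norm l * Hs_norm z.
Proof.
move=> Hl Hz; have [lin [M lM]] := Hl.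
have lZ (q : R) : l (fun x => q * z x + 0) = q * l z.
  by rewrite (lin q _ _ Hz Hs0) (Hd_lin0 Hl) addr0.
have [nz|nz] := eqVneq (Hs_norm z) 0.
  by have := lM z Hz; rewrite nz !mulr0.
have nz0 : 0 < Hs_norm z by rewrite lt_neqAle eq_sym nz Hs_norm_ge0.
rewrite -ler_pdivrMr//; apply: ub_le_sup; first exact: Hd_has_ubound.
exists (fun x => (Hs_norm z)^-1 * z x + 0); last first.
  by rewrite lZ normrM gtr0_norm ?invr_gt0// mulrC.
split; first exact: (Hslin _ Hz Hs0).
by rewrite (Hs_norm_scale _ Hz) gtr0_norm ?invr_gt0// mulVf.
Qed.

Lemma Hd_finsum l b n : Hd l -> l (finsum b n) = \sum_(k < n) b k * l (Phi k).
Proof.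
move=> Hl; have [lin _] := Hl; elim: n => [|n IH].
  by rewrite finsum0 (Hd_lin0 Hl) big_ord0.
by rewrite finsumS (lin _ _ _ (HsPhi n) (Hsfin b n)) IH big_ord_recr addrC.
Qed.

Let Hs_norm_finsum b n : Hs_norm (finsum b n) = Num.sqrt (\sum_(k < n) w k * b k ^+ 2).
Proof.
rewrite /Hs_norm; congr Num.sqrt; apply/cvg_lim => //.
rewrite (_ : \sum_(k < n) _ = series (fun k => w k * coef (finsum b n) k ^+ 2) n).
  by apply: cvg_series_finsupp => k nk; rewrite coeffin ltnNge nk expr0n mulr0.
by rewrite /series/= big_mkord; apply: eq_bigr => k _; rewrite coeffin ltn_ord.
Qed.

(** Testing l on the finite sum with coefficients l (Phi k) / w k makes both the value and the
    squared norm equal to the partial sum S, so S <= M sqrt S and S <= M^2. *)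
Lemma Hd_seq_cvg l : Hd l -> cvgn (series (fun k => l (Phi k) ^+ 2 / w k)).
Proof.
move=> Hl; have [_ [M lM]] := Hl.
apply: (@ge0_series_bounded_cvg _ _ (M ^+ 2)).
  by move=> k; apply: divr_ge0 => //; exact: sqr_ge0.
move=> n; set S := series _ n.
pose b k := l (Phi k) / w k.
have S0 : 0 <= S by apply: sumr_ge0 => k _; apply: divr_ge0 => //; exact: sqr_ge0.
have E1 : l (finsum b n) = S.
  rewrite (Hd_finsum _ _ Hl) /S /series/= big_mkord; apply: eq_bigr => k _.
  by rewrite /b; ring.
have E2 : Hs_norm (finsum b n) = Num.sqrt S.
  rewrite Hs_norm_finsum /S /series/= big_mkord; congr Num.sqrt; apply: eq_bigr => k _.
  by rewrite /b; field; rewrite gt_eqF.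
have := lM _ (Hsfin b n); rewrite E1 E2 ger0_norm// => h.
have [s0|s0] := eqVneq (Num.sqrt S) 0.
  by rewrite s0 mulr0 in h; apply: le_trans h (sqr_ge0 _).
have s1 : 0 < Num.sqrt S by rewrite lt_neqAle eq_sym s0 sqrtr_ge0.
move: h; rewrite -{1}(sqr_sqrtr S0) expr2 ler_pM2r// => h.
rewrite -(sqr_sqrtr S0) ler_pXn2r ?nnegrE ?sqrtr_ge0//.
exact: le_trans (sqrtr_ge0 _) h.
Qed.

(** The truncations of z converge to z in the norm of H^s, the squared distance being a tail of its
    weighted series, and l is bounded. *)
Lemma Hd_seqE l z : Hd l -> Hs z -> l z = seq_dual (fun k => l (Phi k)) z.
Proof.
move=> Hl Hz; have [lin [M lM]] := Hl.
pose D n x := -1 * finsum (coef z) n x + z x.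
have HD n : Hs (D n) by exact: (Hslin _ (Hsfin _ n) Hz).
have ND n : Hs_norm (D n) = Num.sqrt (limn (series (fun k => w k * coef z k ^+ 2)) -
    series (fun k => w k * coef z k ^+ 2) n).
  rewrite /Hs_norm -(lim_series_tail n (HsC Hz)).
  congr (Num.sqrt (limn (series _))); apply/funext => k.
  rewrite (coeflin _ _ (Hsfin _ n) Hz) coeffin; case: ifP => _; first by rewrite mulN1r
    addNr expr0n mulr0.
  by rewrite mulr0 add0r.
apply/esym/cvg_lim => //.
rewrite (_ : series _ = (fun n => l z - l (D n))); last first.
  apply/funext => n; rewrite (lin _ _ _ (Hsfin _ n) Hz) (Hd_finsum _ _ Hl) mulN1r opprD
    opprK addrCA subrr addr0.
  by rewrite /series/= big_mkord.
rewrite -[X in _ --> X]subr0; apply: cvgB; first exact: cvg_cst.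
apply/norm_cvg0P; apply: (@squeeze_cvgr _ _ _ _ (fun=> 0) (fun n => M * Hs_norm (D n))).
- by near=> n; rewrite normr_ge0 (lM _ (HD n)).
- exact: cvg_cst.
- rewrite -(mulr0 M); apply: cvgM; first exact: cvg_cst.
  rewrite (_ : (fun n => Hs_norm (D n)) = (fun n => Num.sqrt (limn (series (fun k => w k *
    coef z k ^+ 2)) -
    series (fun k => w k * coef z k ^+ 2) n))); last exact/funext.
  rewrite -sqrtr0; apply: continuous_cvg; first exact: sqrt_continuous.
  rewrite -(subrr (limn (series (fun k => w k * coef z k ^+ 2)))).
  by apply: cvgB; [exact: cvg_cst|exact: (HsC Hz)].
Unshelve. all: by end_near. Qed.

(** Reduces continuity into H^{-s} to continuity of each coefficient and a summable bound uniform in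
    time: the squared norm of an increment is at most a series to which [tannery] applies. *)
Lemma Hd_continuous_seq (T : R) (u : R -> (R -> R) -> R) (d : R -> nat -> R) (g : nat -> R) :
  cvgn (series g) ->
  (forall t k, t \in `[0, T] -> d t k ^+ 2 / w k <= g k) ->
  (forall t k, t \in `[0, T] -> d t' k @[t' --> within `[0, T] (nbhs t)] --> d t k) ->
  (forall t z, t \in `[0, T] -> Hs z -> u t z = seq_dual (d t) z) ->
  Hd_continuous alpha beta mu j T s u.
Proof.
move=> cg dg dc ud.
have cd t : t \in `[0, T] -> cvgn (series (fun k => d t k ^+ 2 / w k)).
  move=> tT; apply: (le_cvg_series _ cg) => k.
  by rewrite ger0_norm ?dg//; apply: divr_ge0 => //; exact: sqr_ge0.
split=> t tT; first by apply: (Hd_seq_dual (cd t tT)) => z; exact: ud.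
pose e t' k := (d t' k - d t k) ^+ 2 / w k.
(* The 4 comes from (x - y)^2 <= 2 x^2 + 2 y^2, with both squares bounded through g. *)
have eg t' k : t' \in `[0, T] -> `|e t' k| <= 4 * g k.
  move=> t'T; rewrite ger0_norm; last by apply: divr_ge0 => //; exact: sqr_ge0.
  apply: (@le_trans _ _ (2 * (d t' k ^+ 2 / w k) + 2 * (d t k ^+ 2 / w k))).
    rewrite -subr_ge0 (_ : _ - _ = (d t' k + d t k) ^+ 2 / w k); last by rewrite /e; ring.
    by apply: divr_ge0 => //; exact: sqr_ge0.
  by have := dg t' k t'T; have := dg t k tT; lra.
have c4g := is_cvg_seriesZ_fun 4 cg.
have ce t' : t' \in `[0, T] -> cvgn (series (e t')).
  by move=> t'T; apply: (le_cvg_series _ c4g) => k; exact: eg.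
have lim0 : limn (series (e t')) @[t' --> within `[0, T] (nbhs t)] --> (0 : R).
  have l0 : limn (series (fun=> 0 : R)) = (0 : R).
    by rewrite (_ : series _ = fun=> 0) ?lim_cst//; apply/funext => n; rewrite /series/= big1.
  rewrite -[X in _ --> X]l0; apply: (tannery c4g).
  - by move=> k; rewrite normr0; apply: le_trans (eg t k tT).
  - by near=> t'; move=> k; apply: eg; near: t'; exact: withinT.
  - move=> k; have h0 : d t' k - d t k @[t' --> within `[0, T] (nbhs t)] --> (0 : R).
      by rewrite -[X in _ --> X](subrr (d t k)); apply: cvgB; [exact: dc|exact: cvg_cst].
    have -> : e ^~ k = (fun t' => (d t' k - d t k) * ((d t' k - d t k) / w k)).
      by apply/funext => t'; rewrite /e expr2 mulrA.
    rewrite -[X in _ --> X](mul0r (0 / w k)); apply: cvgM; first exact: h0.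
    by apply: cvgM; [exact: h0|exact: cvg_cst].
have uE t' z : t' \in `[0, T] -> Hs z -> u t' z - u t z = seq_dual (fun k => d t' k - d t k) z.
  move=> t'T Hz; rewrite (ud _ _ t'T Hz) (ud _ _ tT Hz).
  rewrite /seq_dual (_ : (fun k => coef z k * (_ - _)) =
    (fun k => coef z k * d t' k + -1 * (coef z k * d t k))); last by apply/funext => k; ring.
  have h1 := seq_dual_cvg (cd t' t'T) Hz; have h2 := seq_dual_cvg (cd t tT) Hz.
  by rewrite (lim_seriesD_fun h1 (is_cvg_seriesZ_fun (-1) h2)) (lim_seriesZ_fun _ h2) mulN1r.
have Nle t' : t' \in `[0, T] -> Hd_norm (fun z => u t' z - u t z) <= Num.sqrt (limn (series
  (e t'))).
  move=> t'T; apply: Hd_norm_le; first exact: sqrtr_ge0.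
  move=> z Hz; rewrite (uE _ _ t'T Hz).
  exact: (seq_dual_le (ce _ t'T) Hz).
apply: (@squeeze_cvgr _ _ _ _ (fun=> 0) (fun t' => Num.sqrt (limn (series (e t'))))).
- near=> t'; have t'T : t' \in `[0, T] by near: t'; exact: withinT.
  rewrite (Nle _ t'T) andbT; apply: Hd_norm_ge0.
  have ce' := ce _ t'T; apply: (Hd_seq_dual ce') => z Hz; exact: (uE _ _ t'T Hz).
- exact: cvg_cst.
- rewrite -[X in _ --> X]sqrtr0.
  by apply: continuous_cvg; [exact: sqrt_continuous|exact: lim0].
Unshelve. all: by end_near. Qed.

End Duality.

(** * Integration in time *)

Section SeriesIntegral.
Context d (T : measurableType d) (R : realType).
Variables (mu : {measure set T -> \bar R}) (D : set T) (mD : measurable D).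
Implicit Types (h : nat -> T -> R).

Local Notation Rintegrable f := (mu.-integrable D (EFin \o f)).

Lemma Rintegral_series_partial h n : (forall k, Rintegrable (h k)) ->
  Rintegrable (fun x => series (h ^~ x) n) /\
  \int[mu]_(x in D) series (h ^~ x) n = series (fun k => \int[mu]_(x in D) h k x) n.
Proof.
move=> ih; elim: n => [|n [IH1 IH2]].
  have -> : (fun x => series (h ^~ x) 0) = (fun=> 0).
    by apply/funext => x; rewrite /series/= big_geq.
  split; first exact: integrable0.
  by rewrite /series/= big_geq// /Rintegral integral0.
have -> : (fun x => series (h ^~ x) n.+1) = (fun x => series (h ^~ x) n + h n x).
  by apply/funext => x; rewrite seriesSr.
split; first exact: RintegrableD.
by rewrite RintegralD// IH2 seriesSr.
Qed.

(** Monotone convergence makes the sum of the |h k| an integrable majorant of all partial sums;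
    dominated convergence then exchanges sum and integral. *)
Lemma Rintegral_series h : (forall k, Rintegrable (h k)) ->
  cvgn (series (fun k => \int[mu]_(x in D) `|h k x|)) ->
  (forall x, D x -> cvgn (series (fun k => `|h k x|))) ->
  Rintegrable (fun x => limn (series (h ^~ x))) /\
  \int[mu]_(x in D) limn (series (h ^~ x)) =
    limn (series (fun k => \int[mu]_(x in D) h k x)).
Proof.
move=> ih ch px; pose A k x := `|h k x|.
have iA k : Rintegrable (A k) by exact: integrable_norm (ih k).
pose G x := limn (series (A ^~ x)); pose F x := limn (series (h ^~ x)).
have mG : measurable_fun D G.
  apply: (measurable_fun_cvg (h := fun n x => series (A ^~ x) n)) => // n.
  by apply: Rintegrable_measurable; exact: (Rintegral_series_partial n iA).1.
have mF : measurable_fun D F.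
  apply: (measurable_fun_cvg (h := fun n x => series (h ^~ x) n)) => [n|x Dx].
    by apply: Rintegrable_measurable; exact: (Rintegral_series_partial n ih).1.
  by apply: cvg_series_abs; exact: px.
have GE : (\int[mu]_(x in D) (G x)%:E = (limn (series (fun k => \int[mu]_(x in D) A k
  x)))%:E)%E.
  pose g n x := (series (A ^~ x) n)%:E.
  have h1 : (\int[mu]_(x in D) g n x)%E @[n --> \oo] --> (\int[mu]_(x in D) limn (g ^~ x))%E.
    apply: cvg_monotone_convergence => //.
    - by move=> n; apply: measurable_int; exact: (Rintegral_series_partial n iA).1.
    - by move=> n x _; rewrite /g lee_fin /series/=; apply: sumr_ge0 => k _; exact: normr_ge0.
    - move=> x _ m n mn; rewrite /g lee_fin.
      by apply: (@nondecreasing_series _ _ xpredT) => // k _ _; exact: normr_ge0.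
  have h2 : (\int[mu]_(x in D) g n x)%E @[n --> \oo] --> (limn (series (fun k =>
    \int[mu]_(x in D) A k x)))%:E.
    rewrite (_ : (fun n => _) = (fun n => (series (fun k => \int[mu]_(x in D) A k x) n)%:E)).
      by apply: cvg_EFin; [exact: nearW|exact: ch].
    apply/funext => n; have [I <-] := Rintegral_series_partial n iA.
    by rewrite /Rintegral fineK//; exact: integrable_fin_num I.
  rewrite -(cvg_unique _ h1 h2)//; apply: eq_integral => x; rewrite inE => Dx.
  by apply/esym/cvg_lim => //; apply: cvg_EFin; [exact: nearW|exact: px].
have iG : Rintegrable G.
  apply/integrableP; split; first exact/measurable_EFinP.
  rewrite (_ : (\int[mu]_(x in D) _)%E = (\int[mu]_(x in D) (G x)%:E)%E).
    by rewrite GE ltry.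
  apply: eq_integral => x; rewrite inE => Dx /=; rewrite ger0_norm//.
  by apply: lim_series_ge0; [move=> k; exact: normr_ge0|exact: px].
have SF x : D x -> (series (h ^~ x) n)%:E @[n --> \oo] --> (F x)%:E.
  by move=> Dx; apply: cvg_EFin; [exact: nearW|apply: cvg_series_abs; exact: px].
have SG n x : D x -> (`|(series (h ^~ x) n)%:E| <= (G x)%:E)%E.
  move=> Dx; rewrite /= lee_fin; apply: le_trans (ler_norm_sum _ _ _) _.
  by apply: series_ge0_le_lim; [move=> k; exact: normr_ge0|exact: px].
have mF' : measurable_fun D (EFin \o F) by exact/measurable_EFinP.
have [iF _ h3] := dominated_convergence mD
  (fun n => measurable_int _ (Rintegral_series_partial n ih).1)
  mF' (aeW mu SF) iG (aeW mu (fun x n => SG n x)).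
split; first exact: iF.
have FE : (\int[mu]_(x in D) (EFin \o F) x)%E = (\int[mu]_(x in D) F x)%:E.
  by rewrite /Rintegral fineK//; exact: integrable_fin_num iF.
rewrite FE in h3; have := fine_cvg h3.
rewrite (_ : fine \o _ = series (fun k => \int[mu]_(x in D) h k x)).
  by move=> h4; apply/esym/cvg_lim => //; exact: h4.
by apply/funext => n; rewrite /= -(Rintegral_series_partial n ih).2.
Qed.

End SeriesIntegral.

Section TimeIntegrals.
Context {R : realType}.
Implicit Types (f g : R -> R) (q t tau T : R).

Lemma Rintegrable_cst_oo (a b k : R) : (leb R).-integrable `]a, b[ (EFin \o (fun=> k)).
Proof.
apply: (integrableS _ _ _ (Rintegrable_cst_cc a b k)) => //.
exact: subset_itv_oo_cc.
Qed.

Lemma sub_itv0_oo tau T : tau <= T -> (`]0, tau[ : set R) `<=` `]0, T[.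
Proof.
move=> tauT t /=; rewrite !in_itv/= => /andP[-> h].
exact: lt_le_trans tauT.
Qed.

Lemma L2time_sub tau T f : tau <= T -> L2time T f -> L2time tau f.
Proof.
move=> tauT [mf f2]; split.
  by apply: (measurable_funS _ (sub_itv0_oo tauT)).
by apply: (integrableS _ _ _ f2) => //; exact: sub_itv0_oo.
Qed.

Lemma L2time_integrable tau f : L2time tau f -> (leb R).-integrable `]0, tau[ (EFin \o f).
Proof.
move=> [mf f2].
have I : (leb R).-integrable `]0, tau[ (EFin \o (fun t => f t ^+ 2 * 1 + 1)).
  by apply: RintegrableD => //; exact: Rintegrable_cst_oo.
apply: (Rintegrable_le _ _ _ I) => // t _; rewrite mulr1.
rewrite -(real_normK (num_real (f t))).
have := normr_ge0 (f t); nra.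
Qed.

Lemma measurable_expR_conv q tau (D : set R) :
  measurable_fun D (fun t => expR (- q * (tau - t))).
Proof.
apply: measurable_funTS; apply: continuous_measurable_fun => t.
by apply: is_derive_continuous; derive_fun.
Qed.

Lemma expR_conv_le1 q tau t : 0 <= q -> t <= tau -> expR (- q * (tau - t)) <= 1.
Proof.
by move=> q0 t0; rewrite -expR0 ler_expR mulNr oppr_le0 mulr_ge0// subr_ge0.
Qed.

Lemma L2time_conv q tau f : 0 <= q -> L2time tau f ->
  (leb R).-integrable `]0, tau[ (EFin \o (fun t => f t * expR (- q * (tau - t)))).
Proof.
move=> q0 Lf; have I := integrable_norm (L2time_integrable Lf).
apply: (Rintegrable_le _ _ _ I) => //.
  by apply: measurable_funM; [case: Lf|exact: measurable_expR_conv].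
move=> t /=; rewrite in_itv/= => /andP[_ tt]; rewrite normrM -[leRHS]mulr1.
by rewrite ler_wpM2l// ger0_norm ?expR_ge0// expR_conv_le1// ltW.
Qed.

Lemma integrable_expR_conv_sqr q tau : 0 <= q ->
  (leb R).-integrable `]0, tau[ (EFin \o (fun t => expR (- q * (tau - t)) ^+ 2)).
Proof.
move=> q0; apply: (Rintegrable_le _ _ _ (Rintegrable_cst_oo 0 tau 1)) => //.
  by apply: measurable_funX; exact: measurable_expR_conv.
move=> t /=; rewrite in_itv/= => /andP[_ tt]; rewrite ger0_norm ?sqr_ge0//.
by rewrite exprn_ile1 ?expR_ge0// expR_conv_le1// ltW.
Qed.

(** After multiplication by 1 + q, the integral itself is at most tau because the integrand is at
    most 1, and q times it is at most 1/2 by explicit integration. The bound thus covers q = 0 as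
    well. *)
Lemma integral_expR_conv_sqr_le q tau : 0 <= q -> 0 <= tau ->
  \int[leb R]_(t in `]0, tau[) expR (- q * (tau - t)) ^+ 2 <= (tau + 1 / 2) / (1 + q).
Proof.
move=> q0; rewrite le_eqVlt => /predU1P[<-|tau0].
  by rewrite set_itv_ge ?bnd_simp// Rintegral_set0 add0r divr_ge0// addr_ge0.
have q1 : 0 < 1 + q by rewrite ltr_wpDr.
have iE := integrable_expR_conv_sqr tau q0.
rewrite ler_pdivlMr// mulrDr mulr1; apply: lerD.
  rewrite [leRHS](_ : _ = \int[leb R]_(t in `]0, tau[) 1); last first.
    by rewrite Rintegral_cst//= lebesgue_measure_itv/= lte_fin tau0 oppr0 adde0 mul1r.
  apply: le_Rintegral => //; first exact: Rintegrable_cst_oo.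
  move=> t /=; rewrite in_itv/= => /andP[_ tt].
  by rewrite exprn_ile1 ?expR_ge0// expR_conv_le1// ltW.
pose F (t : R) := expR (- q * (tau - t)) ^+ 2.
have dF t : is_derive t 1 F (2 * q * expR (- q * (tau - t)) ^+ 2).
  by eapply is_derive_eq; [rewrite /F; derive_fun|rewrite /=; ring].
have cF t : {for t, continuous F} by apply: is_derive_continuous.
have E : (\int[leb R]_(t in `]0%R, tau[) (2 * q * expR (- q * (tau - t)) ^+ 2)%:E = (F tau
  - F 0)%:E)%E.
  apply: (@ge0_FTC_open _ F) => //.
  - by move=> t _ _; apply: is_derive_continuous; derive_fun.
  - by move=> t _ _; rewrite mulr_ge0 ?mulr_ge0// sqr_ge0.
  - by apply: cvg_at_right_filter; exact: cF.
  - by apply: cvg_at_left_filter; exact: cF.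
have E2 : 2 * q * \int[leb R]_(t in `]0, tau[) expR (- q * (tau - t)) ^+ 2 = F tau - F 0.
  by rewrite -RintegralZl// /Rintegral E.
have : F tau = 1 by rewrite /F subrr mulr0 expR0 expr1n.
have : 0 <= F 0 by exact: sqr_ge0.
move: E2; set X := \int[leb R]_(t in _) _; nra.
Qed.

Lemma L2time_normE T f : L2time_norm T f = Num.sqrt (\int[leb R]_(t in `]0, T[) (f t ^+ 2 * 1)).
Proof. by rewrite /L2norm /L2dot; under eq_Rintegral do rewrite -expr2. Qed.

(** Cauchy-Schwarz in time, with tau replaced by T on the right to make the bound uniform. *)
Lemma integral_conv_le q tau T f : 0 <= q -> 0 <= tau -> tau <= T -> L2time T f ->
  \int[leb R]_(t in `]0, tau[) `|f t * expR (- q * (tau - t))| <=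
    L2time_norm T f * Num.sqrt ((T + 1 / 2) / (1 + q)).
Proof.
move=> q0 tau0 tauT Lf; have Lft := L2time_sub tauT Lf.
rewrite L2time_normE.
have X0 : 0 <= \int[leb R]_(t in `]0, T[) (f t ^+ 2 * 1).
  by apply: Rintegral_ge0 => t _; rewrite mulr1 sqr_ge0.
have q1 : 0 < 1 + q by rewrite ltr_wpDr.
have Y0 : 0 <= (T + 1 / 2) / (1 + q) by rewrite divr_ge0 ?addr_ge0// (le_trans tau0).
apply: le_sqrt_of_AMGM => // p p0.
have [_ i1] := Lft; have i2 := integrable_expR_conv_sqr tau q0.
have j1 : (leb R).-integrable `]0, tau[ (EFin \o (fun t => p / 2 * (f t ^+ 2 * 1))).
  exact: RintegrableZ.
have j2 : (leb R).-integrable `]0, tau[ (EFin \o (fun t => p^-1 / 2 * expR (- q * (tau -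
  t)) ^+ 2)).
  exact: RintegrableZ.
have i3 : (leb R).-integrable `]0, tau[ (EFin \o (fun t => p / 2 * (f t ^+ 2 * 1) + p^-1 /
  2 * expR (- q * (tau - t)) ^+ 2)).
  exact: RintegrableD.
apply: (le_trans (le_Rintegral _ (integrable_norm (L2time_conv q0 Lft)) i3 _)) => //.
  move=> t _ /=; rewrite normrM -(real_normK (num_real (f t))) (ger0_norm (expR_ge0 _)) mulr1.
  rewrite -subr_ge0; set x := `|f t|; set y := expR _.
  have -> : p / 2 * x ^+ 2 + p^-1 / 2 * y ^+ 2 - x * y = (p * x - y) ^+ 2 / (2 * p).
    by field; rewrite gt_eqF.
  by rewrite divr_ge0 ?sqr_ge0// mulr_ge0// ltW.
rewrite RintegralD// !RintegralZl//.
have h1 : \int[leb R]_(t in `]0, tau[) (f t ^+ 2 * 1) <= \int[leb R]_(t in `]0, T[) (f t ^+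
  2 * 1).
  have [mf i0] := Lf; rewrite /Rintegral fine_le//.
  - exact: integrable_fin_num i1.
  - exact: integrable_fin_num i0.
  - apply: ge0_subset_integral => //; last exact: sub_itv0_oo.
      exact: measurable_int i0.
    by move=> t _; rewrite lee_fin mulr1 sqr_ge0.
have h2 := integral_expR_conv_sqr_le q0 tau0.
have h3 : (tau + 1 / 2) / (1 + q) <= (T + 1 / 2) / (1 + q).
  by rewrite ler_wpM2r ?lerD2r// invr_ge0 ltW.
have h4 : p / 2 * \int[leb R]_(t in `]0, tau[) (f t ^+ 2 * 1) <= p / 2 * \int[leb R]_(t in
  `]0, T[) (f t ^+ 2 * 1).
  by rewrite ler_wpM2l// divr_ge0// ltW.
have h5 : p^-1 / 2 * \int[leb R]_(t in `]0, tau[) expR (- q * (tau - t)) ^+ 2 <= p^-1 / 2 *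
  ((T + 1 / 2) / (1 + q)).
  by rewrite ler_wpM2l ?(le_trans h2)// divr_ge0// invr_ge0 ltW.
apply: (le_trans (lerD h4 h5)).
by rewrite le_eqVlt; apply/orP; left; apply/eqP; ring.
Qed.

(** The dependence on t inside the integrand factors out as e^(-q t), leaving an indefinite integral
    of f(r) e^(q r). *)
Lemma continuous_conv q T f t : 0 <= q -> 0 < T -> L2time T f -> t \in `[0, T] ->
  \int[leb R]_(r in `]0, t'[) (f r * expR (- q * (t' - r))) @[t' --> within `[0, T] (nbhs
    t)] -->
  \int[leb R]_(r in `]0, t[) (f r * expR (- q * (t - r))).
Proof.
move=> q0 T0 Lf tT.
pose e (r : R) := f r * expR (q * r).
have me D : measurable_fun D (fun r : R => expR (q * r)).
  apply: measurable_funTS; apply: continuous_measurable_fun => r.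
  by apply: is_derive_continuous; derive_fun.
have ie : (leb R).-integrable `]0, T[ (EFin \o e).
  have I : (leb R).-integrable `]0, T[ (EFin \o (fun r => expR (q * T) * `|f r|)).
    by apply: RintegrableZ => //; exact: integrable_norm (L2time_integrable Lf).
  apply: (Rintegrable_le _ _ _ I) => //.
    by apply: measurable_funM; [case: Lf|exact: me].
  move=> r /=; rewrite in_itv/= => /andP[_ rT]; rewrite normrM mulrC ler_wpM2r//.
  by rewrite ger0_norm ?expR_ge0// ler_expR ler_wpM2l// ltW.
(* Extension by zero: f is controlled on the open interval only, while the indefinite integral lives
   on [0, T]. *)
pose g := e \_ `]0, T[.
have sub : (`[0, T] : set R) `&` `]0, T[ = `]0, T[%classic by apply/setIidr; exact:
  subset_itv_oo_cc.
have ig : (leb R).-integrable `[0, T] (EFin \o g).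
  rewrite (_ : EFin \o g = (EFin \o e) \_ `]0, T[); last first.
    by apply/funext => r; rewrite /g /= !patchE; case: ifP.
  by apply/integrable_restrict => //; rewrite sub.
have := parameterized_integral_continuous (ltW T0) ig.
move=> /subspace_continuousP/(_ t tT) h.
have gE t' : t' \in `[0, T] ->
    \int[leb R]_(r in `]0, t'[) (f r * expR (- q * (t' - r))) =
    expR (- q * t') * parameterized_integral (leb R) 0 t' g.
  rewrite in_itv/= => /andP[t'0 t'T].
  have ie' : (leb R).-integrable `]0, t'[ (EFin \o e).
    by apply: (integrableS _ _ _ ie) => //; exact: sub_itv0_oo.
  rewrite (_ : parameterized_integral _ _ _ _ = \int[leb R]_(r in `]0, t'[) e r).
    rewrite -RintegralZl//; apply: eq_Rintegral => r _.
    rewrite /e mulrCA -expRD; congr (_ * expR _); ring.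
  have ig' : (leb R).-integrable `]0, t'[ (EFin \o g).
    apply: (integrableS _ _ _ ig) => //.
    by apply: subset_trans (sub_itv0_oo t'T) _; exact: subset_itv_oo_cc.
  rewrite /parameterized_integral -Rintegral_itv_obnd_cbnd; last first.
    apply: (integrableS _ _ _ ig) => // r /=.
    by rewrite !in_itv/= => /andP[r0 rt]; rewrite (ltW r0) (le_trans rt).
  rewrite -Rintegral_itv_bndo_bndc//; apply: eq_Rintegral => r.
  by rewrite inE => /(sub_itv0_oo t'T) rT; rewrite /g patchE mem_set.
rewrite gE//.
apply: cvg_trans (_ : (expR (- q * t') * parameterized_integral (leb R) 0 t' g @[t' -->
  within `[0, T] (nbhs t)] --> _)).
  apply: near_eq_cvg; near=> t'; rewrite gE//.
  by near: t'; exact: withinT.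
apply: cvgM; last exact: h.
apply: cvg_within_filter.
have : {for t, continuous (fun t' : R => expR (- q * t'))} by apply: is_derive_continuous;
  derive_fun.
exact.
Unshelve. all: by end_near. Qed.

End TimeIntegrals.

(** * The controlled evolution *)

(** The point 0 is a null set, so the bound is asked only for t > 0, where the duality formula
    holds. *)
Lemma le_Linfty_norm (R : realType) (T M : R) (g : R -> R) :
  (forall t, t \in `]0, T] -> `|g t| <= M) -> (Linfty_norm T g <= M%:E)%E.
Proof.
move=> gM; apply/ess_supP.
exists ((~` `[0, T]) `|` [set 0]); split.
- by apply: measurableU => //; apply: measurableC.
- rewrite /mrestr; apply: (@subset_measure0 _ _ _ (leb R) _ [set 0]) => //.
  + by apply: measurableI => //; apply: measurableU => //; apply: measurableC.
  + by move=> t [[nt|->]].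
  + exact: lebesgue_measure_set1.
move=> t /= ntM; have [->|t0] := eqVneq t 0; first by right.
left => /=; rewrite in_itv/= => /andP[t0' tT]; apply: ntM.
by rewrite lee_fin gM// in_itv/= lt_neqAle eq_sym t0 t0' tT.
Qed.

Section Evolution.
Context {R : realType}.
Variables (T alpha beta mu s : R) (j : nat -> R).
Hypotheses (T_gt0 : 0 < T) (alpha_lt2 : alpha < 2)
  (mu_lt : mu < mucrit (alpha + beta))
  (j_zeros : positive_zeros (besselJ (nu alpha beta mu + 1)) j)
  (s_gt : nu alpha beta mu < s).
Implicit Types (t tau : R) (k n : nat) (f z : R -> R) (l : (R -> R) -> R).

Local Notation Phi := (Phi alpha beta mu j).
Local Notation coef := (coef alpha beta mu j).
Local Notation w := (spectral_weight alpha j s).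
Local Notation lam := (lam alpha j).
Local Notation c := (trace alpha beta mu j).
Local Notation Hs := (Hs alpha beta mu j s).
Local Notation Hs_norm := (Hs_norm alpha beta mu j s).
Local Notation Hd := (Hd alpha beta mu j s).
Local Notation Hd_norm := (Hd_norm alpha beta mu j s).
Local Notation Hd_continuous := (Hd_continuous alpha beta mu j T s).
Local Notation Oa := (Oa alpha beta mu).
Local Notation Sgrp := (Sgrp alpha beta mu j).
Local Notation Sdual := (Sdual alpha beta mu j).
Local Notation Bop := (Bop alpha beta mu j).
Local Notation sdual := (seq_dual alpha beta mu j).

Let w0 k : 0 < w k. Proof. exact: (spectral_weight_gt0 s alpha_lt2 j_zeros). Qed.
Let lam0 k : 0 <= lam k. Proof. exact: lam_ge0. Qed.
Let c0 k : 0 <= c k. Proof. exact: trace_ge0. Qed.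
Let cK : cvgn (series (fun k => c k ^+ 2 / (w k * (1 + lam k)))).
Proof. exact: is_cvg_trace. Qed.
Let HsC z : Hs z -> cvgn (series (fun k => w k * coef z k ^+ 2)).
Proof. exact: Hs_coef_cvg. Qed.
Let HsS t z : 0 <= t -> Hs z -> Hs (Sgrp t z).
Proof. exact: (Hs_Sgrp alpha_lt2 mu_lt j_zeros). Qed.
Let heat (b : nat -> R) t : 0 < t -> cvgn (series (fun k => w k * b k ^+ 2)) ->
  cvgn (series (fun k => `|expR (- lam k * t) * b k| * c k)).
Proof. exact: (is_cvg_heat alpha_lt2 mu_lt j_zeros s_gt). Qed.
Let Oa_series t z : 0 < t -> Hs z -> Oa (Sgrp t z) =
  limn (series (fun k => expR (- lam k * t) * coef z k * c k)).
Proof. exact: (OaE alpha_lt2 mu_lt j_zeros s_gt). Qed.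
Let dual_le (d : nat -> R) z : cvgn (series (fun k => d k ^+ 2 / w k)) -> Hs z ->
  `|sdual d z| <= Num.sqrt (limn (series (fun k => d k ^+ 2 / w k))) * Hs_norm z.
Proof. exact: (seq_dual_le alpha_lt2 j_zeros). Qed.
Let dual_cvg (d : nat -> R) z : cvgn (series (fun k => d k ^+ 2 / w k)) -> Hs z ->
  cvgn (series (fun k => coef z k * d k)).
Proof. exact: (seq_dual_cvg alpha_lt2 j_zeros). Qed.
Let HdE l z : Hd l -> Hs z -> l z = sdual (fun k => l (Phi k)) z.
Proof. exact: (Hd_seqE alpha_lt2 mu_lt j_zeros). Qed.
Let HdC l : Hd l -> cvgn (series (fun k => l (Phi k) ^+ 2 / w k)).
Proof. exact: (Hd_seq_cvg alpha_lt2 mu_lt j_zeros). Qed.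
Let Hd_dual (d : nat -> R) l : cvgn (series (fun k => d k ^+ 2 / w k)) ->
  (forall z, Hs z -> l z = sdual d z) -> Hd l.
Proof. exact: (Hd_seq_dual alpha_lt2 mu_lt j_zeros). Qed.
Let normd_ge l z : Hd l -> Hs z -> `|l z| <= Hd_norm l * Hs_norm z.
Proof. exact: (Hd_norm_ge alpha_lt2 mu_lt j_zeros). Qed.
Let normd_le l (M : R) : 0 <= M -> (forall z, Hs z -> `|l z| <= M * Hs_norm z) ->
  Hd_norm l <= M.
Proof. exact: (Hd_norm_le alpha_lt2 mu_lt j_zeros). Qed.
Let normd_ge0 l : Hd l -> 0 <= Hd_norm l.
Proof. exact: (Hd_norm_ge0 alpha_lt2 mu_lt j_zeros). Qed.
Let coefS t z k : 0 <= t -> Hs z -> coef (Sgrp t z) k = expR (- lam k * t) * coef z k.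
Proof. exact: (coef_Sgrp alpha_lt2 mu_lt j_zeros). Qed.
Let norms_ge0 z : 0 <= Hs_norm z. Proof. exact: Hs_norm_ge0. Qed.

Definition forcing_coef f k tau : R :=
  \int[leb R]_(t in `]0, tau[) (f t * expR (- lam k * (tau - t))).

Definition trace_energy : R :=
  limn (series (fun k => c k ^+ 2 / (w k * (1 + lam k)))).

Let weighted_sqr (N : R) k :
  (c k * (N * Num.sqrt ((T + 1 / 2) / (1 + lam k)))) ^+ 2 / w k =
  N ^+ 2 * (T + 1 / 2) * (c k ^+ 2 / (w k * (1 + lam k))).
Proof.
have lk : 0 < 1 + lam k by rewrite ltr_wpDr.
rewrite !exprMn sqr_sqrtr; last by rewrite divr_ge0 ?addr_ge0// ltW.
by field; rewrite !gt_eqF.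
Qed.

Let weighted_cvg (N : R) :
  cvgn (series (fun k => N ^+ 2 * (T + 1 / 2) * (c k ^+ 2 / (w k * (1 + lam k))))).
Proof. exact: (is_cvg_seriesZ_fun _ cK). Qed.

Let weighted_le f tau k : tau \in `[0, T] -> L2time T f ->
  (c k * forcing_coef f k tau) ^+ 2 / w k <=
  L2time_norm T f ^+ 2 * (T + 1 / 2) * (c k ^+ 2 / (w k * (1 + lam k))).
Proof.
rewrite in_itv/= => /andP[tau0 tauT] Lf; rewrite -weighted_sqr.
apply: ler_wpM2r; first by rewrite invr_ge0 ltW.
rewrite !exprMn; apply: ler_wpM2l; first exact: sqr_ge0.
rewrite -exprMn -[leLHS](real_normK (num_real _)).
have h : `|forcing_coef f k tau| <= L2time_norm T f * Num.sqrt ((T + 1 / 2) / (1 + lam k)).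
  apply: le_trans (le_normr_Rintegral _ (L2time_conv (lam0 k) (L2time_sub tauT Lf))) _ => //.
  exact: (integral_conv_le (lam0 k) tau0 tauT Lf).
by rewrite ler_pXn2r ?nnegrE//; exact: le_trans (normr_ge0 _) h.
Qed.

Let conv_cvg f tau : tau \in `[0, T] -> L2time T f ->
  cvgn (series (fun k => (c k * forcing_coef f k tau) ^+ 2 / w k)).
Proof.
move=> tauT Lf.
apply: (@le_cvg_series _ _ (fun k => L2time_norm T f ^+ 2 * (T + 1 / 2) * (c k ^+ 2 / (w k
  * (1 + lam k))))).
  by move=> k; rewrite ger0_norm; [exact: weighted_le|apply: divr_ge0; [exact:
    sqr_ge0|exact: ltW]].
exact: weighted_cvg.
Qed.

(** [Rintegral_series] exchanges sum and time integral; its summability condition is Cauchy-Schwarz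
    between z and the bounds of [integral_conv_le]. On the open interval tau - t > 0, so the trace
    series is available at every t. *)
Lemma Bop_series f tau z : tau \in `[0, T] -> L2time T f -> Hs z ->
  (leb R).-integrable `]0, tau[ (EFin \o (fun t => f t * Oa (Sgrp (tau - t) z))) /\
  Bop tau f z = sdual (fun k => c k * forcing_coef f k tau) z.
Proof.
move=> tauI Lf Hz; have := tauI; rewrite in_itv/= => /andP[tau0 tauT].
have Lft := L2time_sub tauT Lf.
pose e k t := f t * expR (- lam k * (tau - t)).
have ie k : (leb R).-integrable `]0, tau[ (EFin \o e k) by exact: L2time_conv.
pose h k t := coef z k * c k * e k t.
have ih k : (leb R).-integrable `]0, tau[ (EFin \o h k) by exact: RintegrableZ.
have ch : cvgn (series (fun k => \int[leb R]_(t in `]0, tau[) `|h k t|)).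
  pose d k := c k * (L2time_norm T f * Num.sqrt ((T + 1 / 2) / (1 + lam k))).
  have cd : cvgn (series (fun k => d k ^+ 2 / w k)).
    rewrite (_ : (fun k => _) = (fun k => L2time_norm T f ^+ 2 * (T + 1 / 2) * (c k ^+ 2 /
      (w k * (1 + lam k))))).
      exact: weighted_cvg.
    by apply/funext => k; exact: weighted_sqr.
  have [cad _] := series_CauchySchwarz w0 (HsC Hz) cd.
  apply: (@le_cvg_series _ _ (fun k => `|coef z k * d k|) _ cad) => k.
  rewrite ger0_norm; last by apply: Rintegral_ge0 => t _; exact: normr_ge0.
  have -> : \int[leb R]_(t in `]0, tau[) `|h k t| = `|coef z k * c k| * \int[leb R]_(t in
    `]0, tau[) `|e k t|.
    rewrite -RintegralZl//; last exact: integrable_norm (ie k).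
    by apply: eq_Rintegral => t _; rewrite /h normrM.
  rewrite /d mulrA [leRHS]normrM; apply: ler_wpM2l; first exact: normr_ge0.
  by apply: le_trans (ler_norm _); exact: integral_conv_le.
have hE t : h ^~ t = (fun k => f t * (expR (- lam k * (tau - t)) * coef z k * c k)).
  by apply/funext => k; rewrite /h /e; ring.
have px t : `]0%R, tau[%classic t -> cvgn (series (fun k => `|h k t|)).
  rewrite /= in_itv/= => /andP[t0 tt].
  rewrite (_ : (fun k => _) = (fun k => `|f t| * (`|expR (- lam k * (tau - t)) * coef z k|
    * c k))).
    apply: is_cvg_seriesZ_fun; apply: heat; first by rewrite subr_gt0.
    exact: HsC.
  apply/funext => k; rewrite (_ : h k t = f t * (expR (- lam k * (tau - t)) * coef z k * c k)).
    by rewrite !normrM (ger0_norm (c0 k)).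
  exact: (congr1 (fun g => g k) (hE t)).
have [iF FE] : (leb R).-integrable `]0, tau[ (EFin \o (fun t => limn (series (h ^~ t)))) /\
    \int[leb R]_(t in `]0, tau[) limn (series (h ^~ t)) =
    limn (series (fun k => \int[leb R]_(t in `]0, tau[) h k t)).
  exact: Rintegral_series.
have sumE t : `]0%R, tau[%classic t -> limn (series (h ^~ t)) = f t * Oa (Sgrp (tau - t) z).
  rewrite /= in_itv/= => /andP[t0 tt]; have tt0 : 0 < tau - t by rewrite subr_gt0.
  rewrite hE (Oa_series tt0 Hz) lim_seriesZ_fun//.
  apply: cvg_series_abs.
  rewrite (_ : (fun k => _) = (fun k => `|expR (- lam k * (tau - t)) * coef z k| * c k)).
    exact: (heat tt0 (HsC Hz)).
  by apply/funext => k; rewrite normrM (ger0_norm (c0 k)).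
split; first by apply: (eq_Rintegrable _ _ iF); [exact: measurable_itv|exact: sumE].
have -> : Bop tau f z = \int[leb R]_(t in `]0, tau[) limn (series (h ^~ t)).
  by apply: eq_Rintegral => t; rewrite inE => tI; rewrite sumE.
rewrite FE; congr (limn (series _)); apply/funext => k.
by rewrite /h RintegralZl// mulrA.
Qed.

Lemma Hd_Bop f tau : tau \in `[0, T] -> L2time T f -> Hd (Bop tau f).
Proof.
move=> tauT Lf; apply: (Hd_dual (conv_cvg tauT Lf)) => z Hz.
exact: (Bop_series tauT Lf Hz).2.
Qed.

Lemma Bop_lin f g (q : R) tau z : tau \in `[0, T] -> L2time T f -> L2time T g -> Hs z ->
  Bop tau (fun t => q * f t + g t) z = q * Bop tau f z + Bop tau g z.
Proof.
move=> tauT Lf Lg Hz.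
have [i1 _] := Bop_series tauT Lf Hz; have [i2 _] := Bop_series tauT Lg Hz.
rewrite /Defs.Bop -RintegralZl// -RintegralD//; last exact: RintegrableZ.
by apply: eq_Rintegral => t _; ring.
Qed.

Lemma Bop_le f tau z : tau \in `[0, T] -> L2time T f -> Hs z ->
  `|Bop tau f z| <= Num.sqrt ((T + 1 / 2) * trace_energy) * L2time_norm T f * Hs_norm z.
Proof.
move=> tauT Lf Hz; rewrite (Bop_series tauT Lf Hz).2.
apply: (le_trans (dual_le (conv_cvg tauT Lf) Hz)).
apply: ler_wpM2r; first exact: norms_ge0.
rewrite -[X in _ * X](ger0_norm (sqrtr_ge0 _)) -sqrtr_sqr mulrC -sqrtrM ?sqr_ge0//.
apply: ler_wsqrtr; rewrite mulrA -lim_seriesZ_fun//.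
by apply: lim_series_le_fun; [exact: conv_cvg|exact: weighted_cvg|move=> k; exact: weighted_le].
Qed.

Lemma Bop_norm_le f tau : tau \in `[0, T] -> L2time T f ->
  Hd_norm (Bop tau f) <= Num.sqrt ((T + 1 / 2) * trace_energy) * L2time_norm T f.
Proof.
move=> tauT Lf; apply: normd_le; first by apply: mulr_ge0; exact: sqrtr_ge0.
by move=> z Hz; exact: Bop_le.
Qed.

Let conv_continuous f k t : L2time T f -> t \in `[0, T] ->
  c k * forcing_coef f k t' @[t' --> within `[0, T] (nbhs t)] --> c k * forcing_coef f k t.
Proof.
move=> Lf tT; apply: cvgM; first exact: cvg_cst.
exact: (continuous_conv (lam0 k) T_gt0 Lf tT).
Qed.

(** The semigroup is diagonal: its factors move from the coefficients of z to those of l. *)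
Lemma dual_Sgrp l t z : Hd l -> 0 <= t -> Hs z ->
  l (Sgrp t z) = sdual (fun k => expR (- lam k * t) * l (Phi k)) z.
Proof.
move=> Hl t0 Hz; rewrite (HdE Hl (HsS t0 Hz)); congr (limn (series _)).
by apply/funext => k; rewrite (coefS k t0 Hz); ring.
Qed.

Lemma SdualE l t z : Hd l -> 0 <= t -> Hs z -> Sdual t l z = l (Sgrp t z).
Proof.
move=> Hl t0 Hz; rewrite (dual_Sgrp Hl t0 Hz); congr (limn (series _)).
by apply/funext => k; rewrite mulrC.
Qed.

Definition evolution u0 f tau z : R := u0 (Sgrp tau z) + Bop tau f z.

Let evo_coef u0 f tau k := expR (- lam k * tau) * u0 (Phi k) + c k * forcing_coef f k tau.

Let heat_sqr_le l t k : 0 <= t ->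
  (expR (- lam k * t) * l (Phi k)) ^+ 2 / w k <= l (Phi k) ^+ 2 / w k.
Proof.
move=> t0; apply: ler_wpM2r; first by rewrite invr_ge0 ltW.
rewrite exprMn -[leRHS]mul1r; apply: ler_wpM2r; first exact: sqr_ge0.
by rewrite exprn_ile1 ?expR_ge0//; exact: expR_lam_le1.
Qed.

Let heat_sqr_cvg l t : 0 <= t -> Hd l ->
  cvgn (series (fun k => (expR (- lam k * t) * l (Phi k)) ^+ 2 / w k)).
Proof.
move=> t0 Hl; apply: (@le_cvg_series _ _ (fun k => l (Phi k) ^+ 2 / w k)); last exact: HdC.
by move=> k; rewrite ger0_norm; [exact: heat_sqr_le|apply: divr_ge0; [exact: sqr_ge0|exact:
  ltW]].
Qed.

Lemma evolution_series u0 f tau z : tau \in `[0, T] -> L2time T f -> Hd u0 -> Hs z ->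
  evolution u0 f tau z = sdual (evo_coef u0 f tau) z.
Proof.
move=> tauT Lf Hu Hz; have := tauT; rewrite in_itv/= => /andP[tau0 _].
rewrite /evolution (dual_Sgrp Hu tau0 Hz) (Bop_series tauT Lf Hz).2.
have h1 := dual_cvg (heat_sqr_cvg tau0 Hu) Hz; have h2 := dual_cvg (conv_cvg tauT Lf) Hz.
rewrite /seq_dual -(lim_seriesD_fun h1 h2); congr (limn (series _)).
by apply/funext => k; rewrite /evo_coef mulrDr.
Qed.

(** The majorant adds twice the bound of the free part to twice that of the forced part, both
    uniform in time. *)
Lemma evolution_continuous u0 f : L2time T f -> Hd u0 -> Hd_continuous (evolution u0 f).
Proof.
move=> Lf Hu.
pose g k := 2 * (u0 (Phi k) ^+ 2 / w k) +
  2 * (L2time_norm T f ^+ 2 * (T + 1 / 2) * (c k ^+ 2 / (w k * (1 + lam k)))).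
apply: (Hd_continuous_seq alpha_lt2 mu_lt j_zeros (d := evo_coef u0 f) (g := g)).
- by apply: is_cvg_seriesD_fun; apply: is_cvg_seriesZ_fun; [exact: HdC|exact: weighted_cvg].
- move=> t k tT; have := tT; rewrite in_itv/= => /andP[t0 _].
  apply: (@le_trans _ _ (2 * ((expR (- lam k * t) * u0 (Phi k)) ^+ 2 / w k) + 2 * ((c k *
    forcing_coef f k t) ^+ 2 / w k))).
    rewrite -subr_ge0 /evo_coef; set x := expR _ * _; set y := c k * _.
    rewrite (_ : _ - _ = (x - y) ^+ 2 / w k); last by ring.
    by apply: divr_ge0; [exact: sqr_ge0|exact: ltW].
  by apply: lerD; apply: ler_wpM2l => //; [exact: heat_sqr_le|exact: weighted_le].
- move=> t k tT; apply: cvgD; last exact: conv_continuous.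
  apply: cvg_within_filter; apply: cvgM; last exact: cvg_cst.
  have h : {for t, continuous (fun t' : R => expR (- lam k * t'))}.
    by apply: is_derive_continuous; derive_fun.
  exact: h.
- by move=> t z tT Hz; exact: evolution_series.
Qed.

Lemma Hd_evolution u0 f tau : tau \in `[0, T] -> L2time T f -> Hd u0 -> Hd (evolution u0 f tau).
Proof. by move=> tauT Lf Hu; have [h _] := evolution_continuous Lf Hu; exact: h. Qed.

Lemma Bop_continuous f : L2time T f -> Hd_continuous (fun tau => Bop tau f).
Proof.
move=> Lf; apply: (Hd_continuous_seq alpha_lt2 mu_lt j_zeros (d := fun t k => c k *
  forcing_coef f k t)
  (g := fun k => L2time_norm T f ^+ 2 * (T + 1 / 2) * (c k ^+ 2 / (w k * (1 + lam k))))).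
- exact: weighted_cvg.
- by move=> t k tT; exact: weighted_le.
- by move=> t k tT; exact: conv_continuous.
- by move=> t z tT Hz; exact: (Bop_series tT Lf Hz).2.
Qed.

(** S(tau) does not increase the norm of H^s, so u0 contributes with constant 1. *)
Lemma evolution_norm_le u0 f tau z : tau \in `[0, T] -> L2time T f -> Hd u0 -> Hs z ->
  `|evolution u0 f tau z| <=
    (Hd_norm u0 + Num.sqrt ((T + 1 / 2) * trace_energy) * L2time_norm T f) * Hs_norm z.
Proof.
move=> tauT Lf Hu Hz; have := tauT; rewrite in_itv/= => /andP[tau0 _].
rewrite mulrDl; apply: (le_trans (ler_normD _ _)); apply: lerD; last exact: Bop_le.
apply: (le_trans (normd_ge Hu (HsS tau0 Hz))).
apply: ler_wpM2l; first exact: normd_ge0.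
exact: (Hs_norm_Sgrp_le alpha_lt2 mu_lt j_zeros).
Qed.

Lemma Hd_sub l l' : Hd l -> Hd l' -> Hd (fun z => l z - l' z).
Proof.
move=> [lin [M lM]] [lin' [M' lM']]; split.
  by move=> q y z Hy Hz; rewrite (lin q y z Hy Hz) (lin' q y z Hy Hz); ring.
exists (M + M') => z Hz; apply: (le_trans (ler_normB _ _)); rewrite mulrDl.
by apply: lerD; [exact: lM|exact: lM'].
Qed.

Lemma Hd_continuous_eval (v : R -> (R -> R) -> R) t z : Hd_continuous v -> t \in `[0, T] ->
  Hs z ->
  v t' z @[t' --> within `[0, T] (nbhs t)] --> v t z.
Proof.
move=> [Hv cv] tT Hz; apply/subr_cvg0; apply/norm_cvg0P.
apply: (@squeeze_cvgr _ _ _ _ (fun=> 0) (fun t' => Hd_norm (fun z => v t' z - v t z) *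
  Hs_norm z)).
- near=> t'; apply/andP; split; first exact: normr_ge0.
  have t'T : t' \in `[0, T] by near: t'; exact: withinT.
  exact: (normd_ge (Hd_sub (Hv _ t'T) (Hv _ tT)) Hz).
- exact: cvg_cst.
- rewrite -[X in _ --> X](mul0r (Hs_norm z)).
  by apply: cvgM; [exact: cv|exact: cvg_cst].
Unshelve. all: by end_near. Qed.

Let within_right (g : R -> R) (L : R) :
  g t @[t --> within `[0, T] (nbhs 0)] --> L -> g t @[t --> 0^'+] --> L.
Proof.
move=> h A /h hA.
have hA' : \forall t \near (0 : R), t \in `[0, T] -> A (g t) by exact: hA.
suff : \forall t \near 0^'+, A (g t) by [].
near=> t; have : t \in `[0, T].
  rewrite in_itv/=; apply/andP; split; first by apply: ltW; near: t; exact: nbhs_right_gt.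
  by near: t; exact: nbhs_right_le.
near: t; rewrite near_withinE; apply: filterS hA' => r hr _; exact: hr.
Unshelve. all: by end_near. Qed.

(** The time 0, left out by the duality formula, is recovered by continuity: for fixed z both values
    at 0 are limits from the right of the same function. *)
Lemma Hd_continuous_uniq (u v : R -> (R -> R) -> R) :
  Hd_continuous u -> Hd_continuous v ->
  (forall t z, t \in `]0, T] -> Hs z -> v t z = u t z) ->
  forall t, t \in `[0, T] -> Hd_eq alpha beta mu j s (v t) (u t).
Proof.
move=> cu cv vu t; rewrite in_itv/= le_eqVlt => /andP[/predU1P[<- _|t0 tT]] z Hz; last first.
  by apply: vu => //; rewrite in_itv/= t0.
have T0 : 0 \in `[0, T] by rewrite in_itv/= lexx ltW.
have hv := within_right (Hd_continuous_eval cv T0 Hz).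
have hu := within_right (Hd_continuous_eval cu T0 Hz).
apply: (cvg_unique _ hv) => //; apply: cvg_trans hu; apply: near_eq_cvg.
near=> r; apply/esym/vu; last exact: Hz.
rewrite in_itv/=; apply/andP; split; first by near: r; exact: nbhs_right_gt.
by near: r; exact: nbhs_right_le.
Unshelve. all: by end_near. Qed.

End Evolution.

Theorem proposition7 (R : realType) (T alpha beta mu s : R) (j : nat -> R)
  (T_gt0 : 0 < T) (alpha_ge0 : 0 <= alpha) (alpha_lt2 : alpha < 2)
  (mu_lt : mu < mucrit (alpha + beta))
  (j_zeros : positive_zeros (besselJ (nu alpha beta mu + 1)) j)
  (s_gt : nu alpha beta mu < s) :
  [/\
   (* the two terms of the duality formula make sense *)
   forall (tau : R) (f z : R -> R), tau \in `[0, T] ->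
     L2time T f -> Hs alpha beta mu j s z ->
     [/\ Hs alpha beta mu j s (Sgrp alpha beta mu j tau z),
         forall t, 0 < t ->
           cvg (x `^ expa alpha beta mu * Sgrp alpha beta mu j t z x
                  @[x --> 0^'+]) &
         (leb R).-integrable `]0, tau[
           (fun t => (f t * Oa alpha beta mu
                              (Sgrp alpha beta mu j (tau - t) z))%:E)],
   (* B(tau) is a strongly continuous family of bounded operators *)
   [/\ forall (tau : R) (f : R -> R), tau \in `[0, T] -> L2time T f ->
         Hd alpha beta mu j s (Bop alpha beta mu j tau f),
       forall (tau c : R) (f g : R -> R), tau \in `[0, T] ->
         L2time T f -> L2time T g ->
         Hd_eq alpha beta mu j s
           (Bop alpha beta mu j tau (fun t => c * f t + g t))
           (fun z => c * Bop alpha beta mu j tau f z + Bop alpha beta mu j tau g z),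
       forall tau : R, tau \in `[0, T] ->
         exists M : R, forall f : R -> R, L2time T f ->
           Hd_norm alpha beta mu j s (Bop alpha beta mu j tau f)
             <= M * L2time_norm T f &
       forall f : R -> R, L2time T f ->
         Hd_continuous alpha beta mu j T s
           (fun tau => Bop alpha beta mu j tau f)],
   (* the duality formula defines a unique u(tau) = S(tau) u0 + B(tau) f *)
   forall (f : R -> R) (u0 : (R -> R) -> R), L2time T f ->
     Hd alpha beta mu j s u0 ->
     forall tau : R, tau \in `[0, T] ->
     exists utau : (R -> R) -> R,
       [/\ Hd alpha beta mu j s utau,
           duality_formula alpha beta mu j s u0 f tau utau,
           forall l : (R -> R) -> R, Hd alpha beta mu j s l ->
             duality_formula alpha beta mu j s u0 f tau l ->
             Hd_eq alpha beta mu j s l utau &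
           0 < tau ->
             Hd_eq alpha beta mu j s utau
               (fun z => Sdual alpha beta mu j tau u0 z
                         + Bop alpha beta mu j tau f z)],
   (* existence and uniqueness of the weak solution *)
   forall (f : R -> R) (u0 : (R -> R) -> R), L2time T f ->
     Hd alpha beta mu j s u0 ->
     exists u : R -> (R -> R) -> R,
       weak_solution alpha beta mu j T s u0 f u /\
       forall v : R -> (R -> R) -> R,
         weak_solution alpha beta mu j T s u0 f v ->
         forall t, t \in `[0, T] -> Hd_eq alpha beta mu j s (v t) (u t) &
   (* a priori estimate *)
   exists C : R, 0 < C /\
     forall (f : R -> R) (u0 : (R -> R) -> R) (u : R -> (R -> R) -> R),
       L2time T f -> Hd alpha beta mu j s u0 ->
       weak_solution alpha beta mu j T s u0 f u ->
       (Linfty_norm T (fun t => Hd_norm alpha beta mu j s (u t))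
          <= (C * (Hd_norm alpha beta mu j s u0 + L2time_norm T f))%:E)%E].
Proof.
have dualE := SdualE alpha_lt2 mu_lt j_zeros s_gt.
split.
- move=> tau f z tauT Lf Hz; have := tauT; rewrite in_itv/= => /andP[tau0 _]; split.
  + exact: (Hs_Sgrp alpha_lt2 mu_lt j_zeros s_gt).
  + by move=> t t0; apply: cvgP; exact: (cvg_expa_Sgrp alpha_lt2 mu_lt j_zeros s_gt t0 Hz).
  + exact: (Bop_series T_gt0 alpha_lt2 mu_lt j_zeros s_gt tauT Lf Hz).1.
- split.
  + by move=> tau f tauT Lf; exact: (Hd_Bop T_gt0 alpha_lt2 mu_lt j_zeros s_gt tauT Lf).
  + by move=> tau q f g tauT Lf Lg z Hz; exact: (Bop_lin T_gt0 alpha_lt2 mu_lt j_zeros s_gt).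
  + move=> tau tauT; eexists => f Lf.
    exact: (Bop_norm_le T_gt0 alpha_lt2 mu_lt j_zeros s_gt tauT Lf).
  + by move=> f Lf; exact: (Bop_continuous T_gt0 alpha_lt2 mu_lt j_zeros s_gt Lf).
- move=> f u0 Lf Hu tau tauT; exists (evolution alpha beta mu j u0 f tau); split.
  + exact: (Hd_evolution T_gt0 alpha_lt2 mu_lt j_zeros s_gt tauT Lf Hu).
  + by [].
  (* The formula prescribes the value at every z, and equality in H^{-s} is tested there. *)
  + by move=> l Hl dl z Hz; exact: dl.
  + by move=> tau0 z Hz; rewrite (dualE _ _ _ Hu (ltW tau0) Hz).
- move=> f u0 Lf Hu; exists (evolution alpha beta mu j u0 f).
  have cu := evolution_continuous T_gt0 alpha_lt2 mu_lt j_zeros s_gt Lf Hu.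
  split; first by split.
  move=> v [cv dv]; apply: (Hd_continuous_uniq T_gt0 alpha_lt2 mu_lt j_zeros cu cv).
  by move=> t z tT Hz; exact: dv.
- pose M := Num.sqrt ((T + 1 / 2) * trace_energy alpha beta mu s j).
  (* M bounds the operators B(tau); the 1 covers the norm of u0 and makes the constant positive. *)
  exists (1 + M); split; first by rewrite ltr_pwDl// sqrtr_ge0.
  move=> f u0 u Lf Hu [cu du]; apply: le_Linfty_norm => t tT.
  have tT' : t \in `[0, T] by move: tT; rewrite !in_itv/= => /andP[/ltW -> ->].
  have N0 : 0 <= L2time_norm T f by exact: sqrtr_ge0.
  have H0 := Hd_norm_ge0 alpha_lt2 mu_lt j_zeros Hu.
  have M0 : 0 <= M by exact: sqrtr_ge0.
  rewrite ger0_norm; last exact: (Hd_norm_ge0 alpha_lt2 mu_lt j_zeros (cu.1 _ tT')).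
  apply: (@le_trans _ _ (Hd_norm alpha beta mu j s u0 + M * L2time_norm T f)).
    apply: (Hd_norm_le alpha_lt2 mu_lt j_zeros); first by rewrite addr_ge0// mulr_ge0.
    move=> z Hz; rewrite (du _ tT _ Hz).
    exact: (evolution_norm_le T_gt0 alpha_lt2 mu_lt j_zeros s_gt tT' Lf Hu Hz).
  have := mulr_ge0 M0 H0; lra.
Qed.
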